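(* Let $k$ be an algebraically closed field and let $R$ be a self-injective Nakayama $k$-algebra. Then, for the quasi-hereditary structure on $E_R$ given by the ideal layer function, there is an isomorphism of algebras $$\mathfrak{R}(E_R)\cong E_R.$$
   Context: A self-injective Nakayama algebra is here an algebra of the form $R=kC_n/J^m$, where $n,m\ge1$, $C_n$ is the oriented cycle with $n$ vertices and $J\subseteq kC_n$ is the two-sided ideal generated by all arrows. Modules are finitely generated left modules; products in endomorphism algebras are compositions. $\mathrm{sub}(R):=\operatorname{add}\{U\mid U\subseteq R^{\oplus n}\}$ ($\operatorname{add}$ = closure under isomorphisms, finite direct sums and direct summands), $\mathrm{SUB}(R)$ is the direct sum of all indecomposables in $\mathrm{sub}(R)$ up to isomorphism, and $E_R:=\operatorname{End}_R(\mathrm{SUB}(R))$. The simple $E_R$-modules $S(\Lambda)$ are indexed by the indecomposable summands $\Lambda$ of $\mathrm{SUB}(R)$ ($S(\Lambda)$ is the top of the projective module $P(\Lambda)=\operatorname{Hom}_R(\Lambda,\mathrm{SUB}(R))$). The ideal layer function is $l(\Lambda)=\dim_kR-\dim_k\Lambda$, and induces the order $S(\Lambda_1)<S(\Lambda_2)$ iff $l(\Lambda_1)<l(\Lambda_2)$; $E_R$ is quasi-hereditary for this order. For a quasi-hereditary algebra $A$ with simples $S_i$, projective covers $P_i$ and injective envelopes $Q_i$, the standard module $\Delta_i$ is the largest quotient of $P_i$, and the costandard module $\nabla_i$ the largest submodule of $Q_i$, all of whose composition factors $S_j$ satisfy $j\le i$. The basic characteristic tilting module $T$ is the direct sum of one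 copy of each indecomposable module (up to isomorphism) having both a finite filtration by standard modules and a finite filtration by costandard modules; the Ringel dual is $\mathfrak{R}(A):=\operatorname{End}_A(T)^{\mathrm{op}}$. *)

(* Defs.v *)
From HB Require Import structures.
From mathcomp Require Import all_boot all_order all_algebra.
From mathcomp Require Import finmap.
From mathcomp Require Import boolp classical_sets.
From mathcomp.multinomials Require Import monalg.

Set Implicit Arguments.
Unset Strict Implicit.
Unset Printing Implicit Defensive.

Import GRing.Theory.
Local Open Scope ring_scope.

Record quiver := Quiver {
  vertex : finType;
  arrow : finType;
  source : arrow -> vertex;
  target : arrow -> vertex;
  vertex_inhabited : (0 < #|vertex|)%N
}.

Section Paths.
Variable Q : quiver.

Fixpoint walk (v : vertex Q) (s : seq (arrow Q)) : bool :=
  if s is a :: s' then (source a == v) && walk (target a) s' else true.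

Fixpoint walk_end (v : vertex Q) (s : seq (arrow Q)) : vertex Q :=
  if s is a :: s' then walk_end (target a) s' else v.

(* A path is its starting vertex together with the arrows it traverses, in
   order; [::] gives the path of length 0 at the vertex. *)
Definition qpath := {p : vertex Q * seq (arrow Q) | walk p.1 p.2}.

Definition path_start (p : qpath) : vertex Q := (val p).1.
Definition path_arrows (p : qpath) : seq (arrow Q) := (val p).2.
Definition path_end (p : qpath) := walk_end (path_start p) (path_arrows p).

Definition trivial_path (v : vertex Q) : qpath :=
  exist (fun p : vertex Q * seq (arrow Q) => walk p.1 p.2) (v, [::]) isT.

Lemma arrow_walk (a : arrow Q) : walk (source a) [:: a].
Proof. by rewrite /= eqxx. Qed.

Definition arrow_path (a : arrow Q) : qpath :=
  exist (fun p : vertex Q * seq (arrow Q) => walk p.1 p.2)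
    (source a, [:: a]) (arrow_walk a).

(* "First q, then p", as for maps; [None] when p does not start where q ends. *)
Definition path_comp (p q : qpath) : option qpath :=
  if path_end q == path_start p
  then insub (path_start q, path_arrows q ++ path_arrows p) : option qpath
  else None.

Lemma walk_cat v s t : walk v (s ++ t) = walk v s && walk (walk_end v s) t.
Proof. by elim: s v => [|a s IH] v //=; rewrite IH andbA. Qed.

Lemma walk_end_cat v s t : walk_end v (s ++ t) = walk_end (walk_end v s) t.
Proof. by elim: s v => [|a s IH] v /=. Qed.

Variant path_comp_spec (p q : qpath) : option qpath -> Prop :=
| PathComp r of path_end q = path_start p & path_start r = path_start q
    & path_arrows r = path_arrows q ++ path_arrows p & path_end r = path_end p :
    path_comp_spec p q (Some r)
| PathCompNone of path_end q <> path_start p : path_comp_spec p q None.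

Lemma path_compP p q : path_comp_spec p q (path_comp p q).
Proof.
rewrite /path_comp; case: eqP => [e|ne]; last by constructor.
have w : walk (path_start q) (path_arrows q ++ path_arrows p).
  by rewrite walk_cat (valP q) /= -/(path_end q) e (valP p).
case: insubP => [r _ er|]; last by rewrite w.
have [e1 e2] : path_start r = path_start q
    /\ path_arrows r = path_arrows q ++ path_arrows p.
  by rewrite /path_start /path_arrows er.
constructor=> //; rewrite /path_end e1 e2 walk_end_cat.
by rewrite -/(path_end q) e.
Qed.

Lemma qpath_inj (p q : qpath) :
  path_start p = path_start q -> path_arrows p = path_arrows q -> p = q.
Proof.
case: p q => [[v s] w] [[v' s'] w']; rewrite /path_start /path_arrows /=.
by move=> e1 e2; apply: val_inj; rewrite /= e1 e2.
Qed.

Lemma path_compA p q r :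
  obind (path_comp p) (path_comp q r) = obind (path_comp^~ r) (path_comp p q).
Proof.
case: (path_compP q r) => [x e1 xs xa xe|ne]; case: (path_compP p q) => [y f1 ys ya ye|nf] //=.
- case: (path_compP p x) => [u g us ua ue|]; last by rewrite xe.
  case: (path_compP y r) => [z h zs za ze|]; last by rewrite ys.
  congr Some; apply: qpath_inj; first by rewrite us zs.
  by rewrite ua za xa ya catA.
- by case: (path_compP p x) => //; rewrite xe.
- by case: (path_compP y r) => //; rewrite ys.
Qed.

Lemma path_comp_triv_l v p :
  path_comp (trivial_path v) p = if path_end p == v then Some p else None.
Proof.
case: (path_compP (trivial_path v) p) => [r e rs ra re|ne].
  rewrite e eqxx; congr Some; apply: qpath_inj => //.
  by rewrite ra /path_arrows /= cats0.
by case: eqP => // e; case: ne.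
Qed.

Lemma path_comp_triv_r v p :
  path_comp p (trivial_path v) = if path_start p == v then Some p else None.
Proof.
case: (path_compP p (trivial_path v)) => [r e rs ra re|ne].
  by rewrite -e eqxx; congr Some; apply: qpath_inj => //; rewrite -e rs.
by case: eqP => // e; case: ne.
Qed.

End Paths.

Section Bilinear.
Variables (k : pzRingType) (V : lmodType k) (T : Type) (b : T -> V).
Variable m : V -> V -> V.
Hypothesis indV : forall P : V -> Prop,
  P 0 -> (forall f g, P f -> P g -> P (f + g)) ->
  (forall c f, P f -> P (c *: f)) -> (forall p, P (b p)) -> forall f, P f.

Lemma bilinear_1l e : right_distributive m +%R ->
  (forall c f g, c *: m f g = m f (c *: g)) ->
  (forall p, m e (b p) = b p) -> left_id e m.
Proof.
move=> D Z h; have N0 f : m f 0 = 0 by have := Z 0 f 0; rewrite !scale0r.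
by apply: indV => // [f f' ef ef'|c f ef]; rewrite ?D -?Z ?ef ?ef'.
Qed.

Lemma bilinear_1r e : left_distributive m +%R ->
  (forall c f g, c *: m f g = m (c *: f) g) ->
  (forall p, m (b p) e = b p) -> right_id e m.
Proof.
move=> D Z h; have N0 f : m 0 f = 0 by have := Z 0 0 f; rewrite !scale0r.
by apply: indV => // [f f' ef ef'|c f ef]; rewrite ?D -?Z ?ef ?ef'.
Qed.

Lemma bilinear_assoc :
  left_distributive m +%R -> right_distributive m +%R ->
  (forall c f g, c *: m f g = m (c *: f) g) ->
  (forall c f g, c *: m f g = m f (c *: g)) ->
  (forall p q r, m (b p) (m (b q) (b r)) = m (m (b p) (b q)) (b r)) ->
  associative m.
Proof.
move=> D E Y Z h3 f g h.
have M0 x : m 0 x = 0 by have := Y 0 0 x; rewrite !scale0r.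
have N0 x : m x 0 = 0 by have := Z 0 x 0; rewrite !scale0r.
move: f; apply: indV => [|f f' ef ef'|c f ef|p].
- by rewrite !M0.
- by rewrite !D ef ef'.
- by rewrite -!Y ef.
move: g; apply: indV => [|f f' ef ef'|c f ef|q].
- by rewrite M0 !N0 M0.
- by rewrite D !E D ef ef'.
- by rewrite -Y -!Z -Y ef.
move: h; apply: indV => [|f f' ef ef'|c f ef|r] //.
- by rewrite !N0.
- by rewrite !E ef ef'.
- by rewrite -!Z ef.
Qed.

End Bilinear.

Section PathAlgebra.
Variables (k : fieldType) (Q : quiver).

Definition path_algebra : Type := {malg k[qpath Q]}.

HB.instance Definition _ := GRing.Lmodule.on path_algebra.

Implicit Types (f g h : path_algebra) (p q r : qpath Q).

Definition of_path p : path_algebra := mkmalgU p 1.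

Definition of_opath (o : option (qpath Q)) : path_algebra :=
  if o is Some r then of_path r else 0.

Definition path_algebra_mul f g : path_algebra :=
  \sum_(p <- msupp f) \sum_(q <- msupp g)
    (mcoeff p f * mcoeff q g) *: of_opath (path_comp p q).

Definition path_algebra_one : path_algebra :=
  \sum_(v : vertex Q) of_path (trivial_path v).

Lemma path_algebra_mulw (d e : {fset qpath Q}) f g :
  (msupp f `<=` d)%fset -> (msupp g `<=` e)%fset ->
  path_algebra_mul f g = \sum_(p <- d) \sum_(q <- e)
    (mcoeff p f * mcoeff q g) *: of_opath (path_comp p q).
Proof.
move=> led lee; rewrite /path_algebra_mul (big_fset_incl _ led) /=; last first.
  move=> p _ /mcoeff_outdom fp; rewrite big1 // => q _.
  by rewrite fp mul0r scale0r.
apply: eq_bigr => p _; apply: big_fset_incl => // q _ /mcoeff_outdom ->.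
by rewrite mulr0 scale0r.
Qed.

Lemma path_algebra_mulDl : left_distributive path_algebra_mul +%R.
Proof.
move=> f g h.
rewrite (path_algebra_mulw (msuppD_le f g) (fsubset_refl (msupp h))).
rewrite (path_algebra_mulw (fsubsetUl _ (msupp g)) (fsubset_refl (msupp h))).
rewrite (path_algebra_mulw (fsubsetUr (msupp f) _) (fsubset_refl (msupp h))).
rewrite -big_split /=; apply: eq_bigr => p _.
rewrite -big_split /=; apply: eq_bigr => q _.
by rewrite mcoeffD mulrDl scalerDl.
Qed.

Lemma path_algebra_mulDr : right_distributive path_algebra_mul +%R.
Proof.
move=> h f g.
rewrite (path_algebra_mulw (fsubset_refl (msupp h)) (msuppD_le f g)).
rewrite (path_algebra_mulw (fsubset_refl (msupp h)) (fsubsetUl _ (msupp g))).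
rewrite (path_algebra_mulw (fsubset_refl (msupp h)) (fsubsetUr (msupp f) _)).
rewrite -big_split /=; apply: eq_bigr => p _.
rewrite -big_split /=; apply: eq_bigr => q _.
by rewrite mcoeffD mulrDr scalerDl.
Qed.

Lemma path_algebra_mulZl (c : k) f g :
  c *: path_algebra_mul f g = path_algebra_mul (c *: f) g.
Proof.
rewrite (path_algebra_mulw (msuppZ_le c f) (fsubset_refl (msupp g))).
rewrite scaler_sumr; apply: eq_bigr => p _.
rewrite scaler_sumr; apply: eq_bigr => q _.
by rewrite scalerA mcoeffZ mulrA.
Qed.

Lemma path_algebra_mulZr (c : k) f g :
  c *: path_algebra_mul f g = path_algebra_mul f (c *: g).
Proof.
rewrite (path_algebra_mulw (fsubset_refl (msupp f)) (msuppZ_le c g)).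
rewrite scaler_sumr; apply: eq_bigr => p _.
rewrite scaler_sumr; apply: eq_bigr => q _.
by rewrite scalerA mcoeffZ mulrCA.
Qed.

Lemma path_algebra_mul0l g : path_algebra_mul 0 g = 0.
Proof. by have := path_algebra_mulZl 0 0 g; rewrite !scale0r. Qed.

Lemma path_algebra_mul0r g : path_algebra_mul g 0 = 0.
Proof. by have := path_algebra_mulZr 0 g 0; rewrite !scale0r. Qed.

Lemma path_algebra_mulPP p q :
  path_algebra_mul (of_path p) (of_path q) = of_opath (path_comp p q).
Proof.
rewrite (path_algebra_mulw msuppU_le msuppU_le) !big_seq_fset1.
by rewrite !mcoeffUU mulr1 scale1r.
Qed.

Lemma path_algebraE f : f = \sum_(p <- msupp f) mcoeff p f *: of_path p.
Proof.
rewrite {1}[f]monalgE; apply: eq_bigr => p _; apply/malgP => q.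
by rewrite /of_path mcoeffU mcoeffZ mcoeffU mulr_natr.
Qed.

Lemma path_algebra_ind (P : path_algebra -> Prop) :
  P 0 -> (forall f g, P f -> P g -> P (f + g)) ->
  (forall c f, P f -> P (c *: f)) -> (forall p, P (of_path p)) ->
  forall f, P f.
Proof.
move=> P0 PD PZ PP f; rewrite [f]path_algebraE.
by elim/big_ind: _ => // p _; apply: PZ.
Qed.

Lemma path_algebra_mulPO p (o : option (qpath Q)) :
  path_algebra_mul (of_path p) (of_opath o) = of_opath (obind (path_comp p) o).
Proof.
by case: o => [q|] /=; rewrite ?path_algebra_mulPP ?path_algebra_mul0r.
Qed.

Lemma path_algebra_mulOP q (o : option (qpath Q)) :
  path_algebra_mul (of_opath o) (of_path q) =
  of_opath (obind (fun p => path_comp p q) o).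
Proof.
by case: o => [p|] /=; rewrite ?path_algebra_mulPP ?path_algebra_mul0l.
Qed.

Lemma path_algebra_mulA : associative path_algebra_mul.
Proof.
apply: (bilinear_assoc path_algebra_ind path_algebra_mulDl path_algebra_mulDr
  path_algebra_mulZl path_algebra_mulZr) => p q r.
apply: (etrans (congr1 (path_algebra_mul (of_path p))
  (path_algebra_mulPP q r))).
apply: esym; apply: (etrans (congr1 (fun f => path_algebra_mul f (of_path r))
  (path_algebra_mulPP p q))).
apply: (etrans (path_algebra_mulOP r (path_comp p q))).
by rewrite -path_compA; apply: (esym (path_algebra_mulPO p (path_comp q r))).
Qed.

Lemma path_algebra_mul1l : left_id path_algebra_one path_algebra_mul.
Proof.
apply: (bilinear_1l path_algebra_ind path_algebra_mulDr path_algebra_mulZr).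
move=> p; rewrite (big_morph (fun f => path_algebra_mul f (of_path p))
  (fun f g => path_algebra_mulDl f g (of_path p))
  (path_algebra_mul0l (of_path p))).
rewrite (bigD1 (path_end p)) //= big1 => [|v vp].
  by rewrite path_algebra_mulPP path_comp_triv_l eqxx addr0.
by rewrite path_algebra_mulPP path_comp_triv_l eq_sym (negPf vp).
Qed.

Lemma path_algebra_mul1r : right_id path_algebra_one path_algebra_mul.
Proof.
apply: (bilinear_1r path_algebra_ind path_algebra_mulDl path_algebra_mulZl).
move=> p; rewrite (big_morph (path_algebra_mul (of_path p))
  (fun f g => path_algebra_mulDr (of_path p) f g)
  (path_algebra_mul0r (of_path p))).
rewrite (bigD1 (path_start p)) //= big1 => [|v vp].
  by rewrite path_algebra_mulPP path_comp_triv_r eqxx addr0.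
by rewrite path_algebra_mulPP path_comp_triv_r eq_sym (negPf vp).
Qed.

Lemma path_algebra_one_neq0 : path_algebra_one != 0.
Proof.
have [v _] := card_gt0P (vertex_inhabited Q).
apply/eqP => /(congr1 (mcoeff (trivial_path v))) /eqP.
rewrite mcoeff0 raddf_sum (bigD1 v) //= big1 => [|w wv].
  by rewrite mcoeffUU addr0 oner_eq0.
by rewrite mcoeffU; case: eqP => // -[] e; rewrite e eqxx in wv.
Qed.

HB.instance Definition _ := GRing.Zmodule_isNzRing.Build path_algebra
  path_algebra_mulA path_algebra_mul1l path_algebra_mul1r
  path_algebra_mulDl path_algebra_mulDr path_algebra_one_neq0.
HB.instance Definition _ :=
  GRing.Lmodule_isLalgebra.Build k path_algebra path_algebra_mulZl.
HB.instance Definition _ :=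
  GRing.Lalgebra_isAlgebra.Build k path_algebra path_algebra_mulZr.

End PathAlgebra.

(* The oriented cycle with n.+1 vertices. *)
Lemma card_ordS_gt0 (n : nat) : (0 < #|'I_n.+1|)%N.
Proof. by rewrite card_ord. Qed.

Definition oriented_cycle (n : nat) : quiver :=
  @Quiver 'I_n.+1 'I_n.+1 id (@ordS n.+1) (card_ordS_gt0 n).

Section Ideals.
Variable A : pzRingType.
Implicit Types X I J : set A.

Definition ideal_gen X : set A := fun x =>
  exists (r : nat) (a g b : 'I_r -> A),
    (forall i, X (g i)) /\ x = \sum_(i < r) a i * g i * b i.

Definition ideal_mul I J : set A := fun x =>
  exists (r : nat) (a b : 'I_r -> A),
    (forall i, I (a i)) /\ (forall i, J (b i)) /\ x = \sum_(i < r) a i * b i.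

Definition ideal_exp I (m : nat) : set A := iter m (ideal_mul I) setT.

End Ideals.

Definition arrow_ideal (k : fieldType) (Q : quiver) : set (path_algebra k Q) :=
  ideal_gen (range (fun a => of_path k (arrow_path a))).

(* R is isomorphic to k C_n / J^m for some n, m >= 1: the quotient is given by
   a surjection with kernel J^m. *)
Definition self_injective_nakayama (k : fieldType) (R : algType k) : Prop :=
  exists (n m : nat) (pi : {lrmorphism path_algebra k (oriented_cycle n) -> R}),
    (forall y, exists x, pi x = y) /\
    (forall x, pi x = 0 <-> ideal_exp (@arrow_ideal k (oriented_cycle n)) m.+1 x).

(* The library's algebras are nonzero, so that End(M) is one only when M is not
   the zero module. *)
HB.mixin Record isNonzeroModule (V : Type) of GRing.Nmodule V := {
  nonzero_module : exists x : V, x <> 0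
}.

#[short(type="nzLmodType")]
HB.structure Definition NzLmodule (A : pzRingType) :=
  {V of GRing.Lmodule A V & isNonzeroModule V}.

Section SubQuotient.
Variables (A : pzRingType) (M : lmodType A) (U : submodClosed M).

Definition submod : Type := {x : M | x \in U}.
HB.instance Definition _ := SubChoice.on submod.
HB.instance Definition _ := [SubChoice_isSubLmodule of submod by <:].

(* The quotient M / U is that of abelian groups, for which the library wants U
   to be declared closed under opposites. *)
Lemma submodClosed_zmod : zmod_closed U.
Proof.
split=> [|x y Ux Uy]; first exact: rpred0.
by rewrite -scaleN1r rpredD ?rpredZ.
Qed.
Definition zmod_of_submod : {pred M} := [pred x | x \in U].
HB.instance Definition _ :=
  GRing.isZmodClosed.Build M zmod_of_submod submodClosed_zmod.

Definition quotmod : Type := Quotient.quot zmod_of_submod.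
HB.instance Definition _ := GRing.Zmodule.on quotmod.

Definition quotmod_pi (x : M) : quotmod :=
  \pi_(Quotient.quot zmod_of_submod)%qT x.

Lemma quotmod_piP x y : quotmod_pi x = quotmod_pi y <-> x - y \in U.
Proof.
rewrite /quotmod_pi; split=> [/eqP|h]; last apply/eqP.
  by rewrite -Quotient.idealrBE.
by rewrite -Quotient.idealrBE.
Qed.

Lemma quotmod_piD x y : quotmod_pi (x + y) = quotmod_pi x + quotmod_pi y.
Proof. exact: (raddfD (\pi_(Quotient.quot zmod_of_submod)%qT)). Qed.

Lemma quotmod_reprK (x : quotmod) :
  quotmod_pi (repr (x : Quotient.quot zmod_of_submod)) = x.
Proof. exact: (@reprK _ (Quotient.quot zmod_of_submod)). Qed.

Definition quotmod_scale (a : A) (x : quotmod) : quotmod :=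
  quotmod_pi (a *: repr (x : Quotient.quot zmod_of_submod)).

Lemma quotmod_scaleE a x : quotmod_scale a (quotmod_pi x) = quotmod_pi (a *: x).
Proof.
apply/quotmod_piP; rewrite -scalerBr; apply: rpredZ.
by apply/quotmod_piP; rewrite quotmod_reprK.
Qed.

Lemma quotmod_ind (P : quotmod -> Prop) :
  (forall x, P (quotmod_pi x)) -> forall x, P x.
Proof. by move=> h x; rewrite -(quotmod_reprK x). Qed.

Lemma quotmod_scaleA a b x :
  quotmod_scale a (quotmod_scale b x) = quotmod_scale (a * b) x.
Proof. by elim/quotmod_ind: x => x; rewrite !quotmod_scaleE scalerA. Qed.

Lemma quotmod_scale1 : left_id 1 quotmod_scale.
Proof. by elim/quotmod_ind => x; rewrite quotmod_scaleE scale1r. Qed.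

Lemma quotmod_scaleDr : right_distributive quotmod_scale +%R.
Proof.
move=> a; elim/quotmod_ind => x; elim/quotmod_ind => y.
by rewrite -quotmod_piD !quotmod_scaleE scalerDr quotmod_piD.
Qed.

Lemma quotmod_scaleDl x : {morph quotmod_scale^~ x : a b / a + b}.
Proof.
by elim/quotmod_ind: x => x a b; rewrite !quotmod_scaleE scalerDl quotmod_piD.
Qed.

HB.instance Definition _ := GRing.Zmodule_isLmodule.Build A quotmod
  quotmod_scaleA quotmod_scale1 quotmod_scaleDr quotmod_scaleDl.

End SubQuotient.

Section DirectSum.
Variables (A : pzRingType) (I : finType) (M : I -> lmodType A).

Definition dsum : Type := {dffun forall i, M i}.
HB.instance Definition _ := Choice.on dsum.

Implicit Types x y z : dsum.

Definition dsum0 : dsum := [ffun i => 0 : M i].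
Definition dsum_opp x : dsum := [ffun i => - x i].
Definition dsum_add x y : dsum := [ffun i => x i + y i].
Definition dsum_scale (a : A) x : dsum := [ffun i => a *: x i].

Lemma dsum_addA : associative dsum_add.
Proof. by move=> x y z; apply/ffunP => i; rewrite !ffunE addrA. Qed.
Lemma dsum_addC : commutative dsum_add.
Proof. by move=> x y; apply/ffunP => i; rewrite !ffunE addrC. Qed.
Lemma dsum_add0 : left_id dsum0 dsum_add.
Proof. by move=> x; apply/ffunP => i; rewrite !ffunE add0r. Qed.
Lemma dsum_addN : left_inverse dsum0 dsum_opp dsum_add.
Proof. by move=> x; apply/ffunP => i; rewrite !ffunE addNr. Qed.

HB.instance Definition _ :=
  GRing.isZmodule.Build dsum dsum_addA dsum_addC dsum_add0 dsum_addN.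

Lemma dsum_scaleA a b x : dsum_scale a (dsum_scale b x) = dsum_scale (a * b) x.
Proof. by apply/ffunP => i; rewrite !ffunE scalerA. Qed.
Lemma dsum_scale1 : left_id 1 dsum_scale.
Proof. by move=> x; apply/ffunP => i; rewrite !ffunE scale1r. Qed.
Lemma dsum_scaleDr : right_distributive dsum_scale +%R.
Proof. by move=> a x y; apply/ffunP => i; rewrite !ffunE scalerDr. Qed.
Lemma dsum_scaleDl x : {morph dsum_scale^~ x : a b / a + b}.
Proof. by move=> a b; apply/ffunP => i; rewrite !ffunE scalerDl. Qed.

HB.instance Definition _ := GRing.Zmodule_isLmodule.Build A dsum
  dsum_scaleA dsum_scale1 dsum_scaleDr dsum_scaleDl.

End DirectSum.

Section NonzeroDirectSum.
Variables (A : pzRingType) (r : nat) (M : 'I_r.+1 -> nzLmodType A).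

Definition nzdsum : Type := dsum (fun i => M i : lmodType A).
HB.instance Definition _ := GRing.Lmodule.on nzdsum.

Lemma nzdsum_neq0 : exists x : nzdsum, x <> 0.
Proof.
have h i : {x : M i | x <> 0} by apply: cid; apply: nonzero_module.
exists ([ffun i => sval (h i)] : dsum (fun i => M i : lmodType A)).
move=> /ffunP /(_ ord0); rewrite !ffunE; exact: (svalP (h ord0)).
Qed.
HB.instance Definition _ := isNonzeroModule.Build nzdsum nzdsum_neq0.

End NonzeroDirectSum.

Section Hom.
Variables (A : pzRingType) (M N : lmodType A).

Definition hom : Type := {linear M -> N}.
HB.instance Definition _ := gen_eqMixin hom.
HB.instance Definition _ := gen_choiceMixin hom.

Definition hom_app (f : hom) : M -> N := f : {linear M -> N}.

Lemma homP (f g : hom) : hom_app f =1 hom_app g -> f = g.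
Proof.
case: f g => [f [[fD] [fZ]]] [g [[gD] [gZ]]] /= /funext.
rewrite /hom_app /= => e; subst g.
by rewrite (Prop_irrelevance fD gD) (Prop_irrelevance fZ gZ).
Qed.

Definition hom0 : hom := \0 : {linear M -> N}.
Definition hom_opp (f : hom) : hom := \- (f : {linear M -> N}) : {linear M -> N}.
Definition hom_add (f g : hom) : hom :=
  (f : {linear M -> N}) \+ (g : {linear M -> N}) : {linear M -> N}.

Lemma hom_addA : associative hom_add.
Proof. by move=> f g h; apply: homP => x; apply: addrA. Qed.
Lemma hom_addC : commutative hom_add.
Proof. by move=> f g; apply: homP => x; apply: addrC. Qed.
Lemma hom_add0 : left_id hom0 hom_add.
Proof. by move=> f; apply: homP => x; apply: add0r. Qed.
Lemma hom_addN : left_inverse hom0 hom_opp hom_add.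
Proof. by move=> f; apply: homP => x; apply: addNr. Qed.

HB.instance Definition _ :=
  GRing.isZmodule.Build hom hom_addA hom_addC hom_add0 hom_addN.

End Hom.

Definition hom_comp (A : pzRingType) (L M N : lmodType A)
    (f : hom M N) (g : hom L M) : hom L N :=
  (f : {linear M -> N}) \o (g : {linear L -> M}) : {linear L -> N}.

Section EndAlgebra.
Variables (k : fieldType) (A : algType k) (M : nzLmodType A).

(* The product is composition: (f * g) x = f (g x). *)
Definition endalg : Type := hom M M.
HB.instance Definition _ := GRing.Zmodule.on endalg.

Implicit Types f g h : endalg.

Definition endalg_one : endalg := idfun : {linear M -> M}.
Definition endalg_mul f g : endalg := hom_comp f g.

Lemma endalg_mulA : associative endalg_mul.
Proof. by move=> f g h; apply: homP. Qed.
Lemma endalg_mul1l : left_id endalg_one endalg_mul.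
Proof. by move=> f; apply: homP. Qed.
Lemma endalg_mul1r : right_id endalg_one endalg_mul.
Proof. by move=> f; apply: homP. Qed.
Lemma endalg_mulDl : left_distributive endalg_mul +%R.
Proof. by move=> f g h; apply: homP. Qed.
Lemma endalg_mulDr : right_distributive endalg_mul +%R.
Proof. by move=> f g h; apply: homP => x; apply: raddfD. Qed.
Lemma endalg_one_neq0 : endalg_one != 0 :> endalg.
Proof.
have [x x0] := @nonzero_module A M.
by apply/eqP => /(congr1 (fun f : endalg => hom_app f x)).
Qed.

HB.instance Definition _ := GRing.Zmodule_isNzRing.Build endalg
  endalg_mulA endalg_mul1l endalg_mul1r endalg_mulDl endalg_mulDr
  endalg_one_neq0.

Lemma scal_linear (c : k) (f : endalg) :
  linear (fun x : M => (c%:A : A) *: hom_app f x).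
Proof.
move=> a x y; rewrite /hom_app linearP scalerDr !scalerA.
by rewrite mulr_algl mulr_algr.
Qed.

Definition endalg_scale (c : k) f : endalg :=
  HB.pack (fun x : M => (c%:A : A) *: hom_app f x)
    (GRing.isLinear.Build A M M *:%R _ (scal_linear c f)).

Lemma endalg_scaleA b c f :
  endalg_scale b (endalg_scale c f) = endalg_scale (b * c) f.
Proof.
apply: homP => x; rewrite /hom_app /= scalerA.
by rewrite mulr_algl scalerA.
Qed.
Lemma endalg_scale1 : left_id 1 endalg_scale.
Proof. by move=> f; apply: homP => x; rewrite /hom_app /= !scale1r. Qed.
Lemma endalg_scaleDr : right_distributive endalg_scale +%R.
Proof. by move=> c f g; apply: homP => x; apply: scalerDr. Qed.
Lemma endalg_scaleDl f : {morph endalg_scale^~ f : b c / b + c}.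
Proof. by move=> b c; apply: homP => x; rewrite /hom_app /= !scalerDl. Qed.

HB.instance Definition _ := GRing.Zmodule_isLmodule.Build k endalg
  endalg_scaleA endalg_scale1 endalg_scaleDr endalg_scaleDl.

Lemma endalg_scaleAl c f g : c *: (f * g) = (c *: f) * g.
Proof. by apply: homP. Qed.
Lemma endalg_scaleAr c f g : c *: (f * g) = f * (c *: g).
Proof. by apply: homP => x; rewrite /hom_app /= linearZ. Qed.

HB.instance Definition _ :=
  GRing.Lmodule_isLalgebra.Build k endalg endalg_scaleAl.
HB.instance Definition _ :=
  GRing.Lalgebra_isAlgebra.Build k endalg endalg_scaleAr.

End EndAlgebra.

(* Hom(L, M) as a left End(M)-module: f *: h = f \o h. *)
Section HomModule.
Variables (k : fieldType) (A : algType k) (L : lmodType A) (M : nzLmodType A).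

Definition hom_module : Type := hom L M.
HB.instance Definition _ := GRing.Zmodule.on hom_module.

Definition hom_module_scale (f : endalg M) (h : hom_module) : hom_module :=
  hom_comp f h.

Lemma hom_module_scaleA f g h :
  hom_module_scale f (hom_module_scale g h) = hom_module_scale (f * g) h.
Proof. by apply: homP. Qed.
Lemma hom_module_scale1 : left_id 1 hom_module_scale.
Proof. by move=> h; apply: homP. Qed.
Lemma hom_module_scaleDr : right_distributive hom_module_scale +%R.
Proof. by move=> f g h; apply: homP => x; apply: raddfD. Qed.
Lemma hom_module_scaleDl h : {morph hom_module_scale^~ h : f g / f + g}.
Proof. by move=> f g; apply: homP. Qed.

HB.instance Definition _ := GRing.Zmodule_isLmodule.Build (endalg M) hom_module
  hom_module_scaleA hom_module_scale1 hom_module_scaleDr hom_module_scaleDl.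

End HomModule.

Section ConverseAlgebra.
Variables (k : fieldType) (A : algType k).

Definition converse_scale (c : k) (x : A^c) : A^c := c *: (x : A).

Lemma converse_scaleA b c x :
  converse_scale b (converse_scale c x) = converse_scale (b * c) x.
Proof. exact: (@scalerA k A). Qed.
Lemma converse_scale1 : left_id 1 converse_scale.
Proof. exact: (@scale1r k A). Qed.
Lemma converse_scaleDr : right_distributive converse_scale +%R.
Proof. exact: (@scalerDr k A). Qed.
Lemma converse_scaleDl x : {morph converse_scale^~ x : b c / b + c}.
Proof. by move=> b c; apply: (@scalerDl k A). Qed.

HB.instance Definition _ := GRing.Zmodule_isLmodule.Build k (A^c)
  converse_scaleA converse_scale1 converse_scaleDr converse_scaleDl.

Lemma converse_scaleAl (c : k) (x y : A^c) : c *: (x * y) = (c *: x) * y.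
Proof. exact: (@scalerAr k A c y x). Qed.
HB.instance Definition _ :=
  GRing.Lmodule_isLalgebra.Build k (A^c) converse_scaleAl.

Lemma converse_scaleAr (c : k) (x y : A^c) : c *: (x * y) = x * (c *: y).
Proof. exact: (@scalerAl k A c y x). Qed.
HB.instance Definition _ :=
  GRing.Lalgebra_isAlgebra.Build k (A^c) converse_scaleAr.

End ConverseAlgebra.

Section ModuleTheory.
Variable A : pzRingType.
Implicit Types M N P Q S D : lmodType A.

Definition isom M N : Prop := exists f : {linear M -> N}, bijective f.

Definition is_zero_module M : Prop := forall x : M, x = 0.

Definition indecomposable M : Prop :=
  ~ is_zero_module M /\
  forall N P : lmodType A,
    isom M (N * P)%type -> is_zero_module N \/ is_zero_module P.

Definition finitely_generated M : Prop :=
  exists (r : nat) (g : 'I_r -> M),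
    forall x, exists a : 'I_r -> A, x = \sum_(i < r) a i *: g i.

Inductive add_closure (C : lmodType A -> Prop) : lmodType A -> Prop :=
| add_base M : C M -> add_closure C M
| add_isom M N : isom M N -> add_closure C M -> add_closure C N
| add_zero M : is_zero_module M -> add_closure C M
| add_sum M N :
    add_closure C M -> add_closure C N -> add_closure C (M * N)%type
| add_summand M N : add_closure C (M * N)%type -> add_closure C M.

Definition in_sub : lmodType A -> Prop :=
  add_closure (fun M =>
    exists (r : nat) (U : submodClosed {ffun 'I_r -> A^o}), isom (submod U) M).

(* The family M lists, up to isomorphism and without repetition, the modules
   satisfying C. *)
Definition complete_list (I : Type) (C : lmodType A -> Prop)
    (M : I -> lmodType A) : Prop :=
  [/\ forall i, C (M i),
      forall i j, isom (M i) (M j) -> i = j &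
      forall N, C N -> exists i, isom N (M i)].

Definition is_maximal M (U : submodClosed M) : Prop :=
  (exists x, x \notin U) /\
  forall V : submodClosed M, {subset U <= V} ->
    (forall x, x \in V) \/ {subset V <= U}.

Definition radical M : {pred M} :=
  fun x => `[< forall U : submodClosed M, is_maximal U -> x \in U >].

Lemma radical_subsemimod M : subsemimod_closed (@radical M).
Proof.
split; first split.
- by apply/asboolP => U _; apply: rpred0.
- move=> x y /asboolP hx /asboolP hy; apply/asboolP => U mU.
  by apply: rpredD; [apply: hx | apply: hy].
- by move=> a x /asboolP hx; apply/asboolP => U mU; apply: rpredZ; apply: hx.
Qed.

HB.instance Definition _ M :=
  GRing.isSubSemiModClosed.Build A M (@radical M) (@radical_subsemimod M).

Definition module_top M : lmodType A := quotmod (@radical M).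

(* Projectivity and injectivity are those of the category of finitely
   generated modules. *)
Definition is_projective P : Prop :=
  forall M N (f : {linear M -> N}) (g : {linear P -> N}),
    finitely_generated M -> finitely_generated N ->
    (forall y, exists x, f x = y) ->
    exists h : {linear P -> M}, forall x, f (h x) = g x.

Definition is_injective Q : Prop :=
  forall M N (f : {linear M -> N}) (g : {linear M -> Q}),
    finitely_generated M -> finitely_generated N -> injective f ->
    exists h : {linear N -> Q}, forall x, h (f x) = g x.

Definition is_projective_cover S P : Prop :=
  finitely_generated P /\ is_projective P /\
  exists p : {linear P -> S}, (forall y, exists x, p x = y) /\
    forall U : submodClosed P,
      (forall y, exists2 x, x \in U & p x = y) -> forall x, x \in U.

Definition is_injective_envelope S Q : Prop :=
  finitely_generated Q /\ is_injective Q /\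
  exists u : {linear S -> Q}, injective u /\
    forall U : submodClosed Q,
      (forall y, u y \in U -> y = 0) -> forall x, x \in U -> x = 0.

(* S, a simple module, is a composition factor of M, i.e. S is isomorphic to
   Y / X for submodules X of Y of M. *)
Definition is_composition_factor S M : Prop :=
  exists (Y : submodClosed M) (X : submodClosed (submod Y)), isom (quotmod X) S.

(* There is 0 = M_0 <= ... <= M_r = M with M_i / M_(i-1) in C. *)
Inductive filtered (C : lmodType A -> Prop) : lmodType A -> Prop :=
| filtered_zero M : is_zero_module M -> filtered C M
| filtered_step M (U : submodClosed M) :
    filtered C (submod U) -> C (quotmod U) -> filtered C M.

(* S lists the simple modules; [lt j i] means S_j < S_i. *)
Section Highest.
Variables (I : Type) (S : I -> lmodType A) (lt : I -> I -> Prop).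

Definition factors_le (i : I) M : Prop :=
  forall j, is_composition_factor (S j) M -> j = i \/ lt j i.

Definition is_standard (i : I) D : Prop :=
  exists P (U : submodClosed P),
    [/\ is_projective_cover (S i) P, factors_le i (quotmod U),
        forall V : submodClosed P, factors_le i (quotmod V) -> {subset U <= V} &
        isom (quotmod U) D].

Definition is_costandard (i : I) D : Prop :=
  exists Q (U : submodClosed Q),
    [/\ is_injective_envelope (S i) Q, factors_le i (submod U),
        forall V : submodClosed Q, factors_le i (submod V) -> {subset V <= U} &
        isom (submod U) D].

Definition indecomposable_tilting M : Prop :=
  [/\ finitely_generated M, indecomposable M,
      filtered (fun D => exists i, is_standard i D) M &
      filtered (fun D => exists i, is_costandard i D) M].

End Highest.

End ModuleTheory.

Section Dimension.
Variables (k : fieldType) (A : algType k) (M : lmodType A).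

Definition restrict_scalars : Type := M.
HB.instance Definition _ := GRing.Zmodule.on restrict_scalars.

Definition restrict_scale (c : k) (x : restrict_scalars) : restrict_scalars :=
  (c%:A : A) *: (x : M).

Lemma restrict_scaleA b c x :
  restrict_scale b (restrict_scale c x) = restrict_scale (b * c) x.
Proof. by rewrite /restrict_scale scalerA mulr_algl scalerA. Qed.
Lemma restrict_scale1 : left_id 1 restrict_scale.
Proof. by move=> x; rewrite /restrict_scale !scale1r. Qed.
Lemma restrict_scaleDr : right_distributive restrict_scale +%R.
Proof. by move=> c x y; apply: scalerDr. Qed.
Lemma restrict_scaleDl x : {morph restrict_scale^~ x : b c / b + c}.
Proof. by move=> b c; rewrite /restrict_scale !scalerDl. Qed.

HB.instance Definition _ := GRing.Zmodule_isLmodule.Build k restrict_scalars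
  restrict_scaleA restrict_scale1 restrict_scaleDr restrict_scaleDl.

(* dim_k M; 0 when M is infinite-dimensional. *)
Definition kdim : nat :=
  xget 0%N [set d | isom (restrict_scalars : lmodType k) 'rV[k]_d].

End Dimension.

Definition ideal_layer (k : fieldType) (R : algType k) (M : lmodType R) : int :=
  (kdim (R^o : lmodType R))%:Z - (kdim M)%:Z.

Section Main.
Variables (k : fieldType) (R : algType k).
Variables (r : nat) (L : 'I_r.+1 -> nzLmodType R).

(* The family L lists the indecomposables of sub(R), so that SUB(R) is their
   direct sum. *)
Definition is_SUB : Prop :=
  complete_list (fun M => indecomposable M /\ in_sub M) L.

Definition E_R : algType k := endalg (nzdsum L).

Definition proj_module (i : 'I_r.+1) : lmodType E_R := hom_module (L i) (nzdsum L).

Definition simple_module (i : 'I_r.+1) : lmodType E_R := module_top (proj_module i).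

Definition layer_lt (i j : 'I_r.+1) : Prop :=
  (ideal_layer (L i) < ideal_layer (L j))%R.

Definition is_characteristic_tilting (s : nat) (T : 'I_s.+1 -> nzLmodType E_R) :
  Prop := complete_list (indecomposable_tilting simple_module layer_lt) T.

End Main.

Definition ringel_dual (k : fieldType) (A : algType k) (s : nat)
  (T : 'I_s.+1 -> nzLmodType A) : algType k := (endalg (nzdsum T))^c.

Definition algebra_isom (k : fieldType) (A B : algType k) : Prop :=
  exists f : {lrmorphism A -> B}, bijective f.

(* Main.v *)
Require Import Defs.
From HB Require Import structures.
From mathcomp Require Import all_boot all_order all_algebra.
From mathcomp Require Import finmap monalg.
From mathcomp Require Import zify.
From mathcomp Require Import boolp classical_sets.

(* Let R = kC_n/J^m. Every indecomposable R-module is uniserial, determined by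
   the degree of its top and its length, and is a submodule of a projective; so
   SUB(R) is the sum of all indecomposables L_i and E = End(SUB(R)) has a basis of
   maps g_i |-> t^b g_j between the generators of the L_i, multiplied by adding
   exponents.

   A left E-module M is a functor on R-modules with values M(L_i) = e_i M. Standard
   modules send the inclusions between the L_i to injections, costandard ones send
   the projections to surjections, and both properties pass to extensions. So a
   tilting module preserves images; as every L_i is the image of a map between
   projectives, such a functor is determined by its restriction to projectives,
   and splitting off the longest cyclic piece shows that the indecomposable ones
   are the T(i) of all maps from L_i that factor through a projective. The sum of
   the T(i) is the two-sided ideal of E of all endomorphisms of SUB(R) that factor
   through a projective, and right multiplication identifies E with the opposite
   of the endomorphism algebra of this left ideal. *)

Set Implicit Arguments.
Unset Strict Implicit.
Unset Printing Implicit Defensive.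

Import GRing.Theory.
Local Open Scope ring_scope.

(** * Linear algebra over a ring *)

(** Longer modules have smaller simple modules, so what Delta_i and nabla_i exclude are objects no
    longer than L_i. A non-injective map from L_i, or a non-surjective map to L_i, factors through
    its image, which is shorter than L_i; this is where the descriptions of both families come from.

    If L_i is the image of a map P -> Q of projectives, then M(P) -> M(L_i) is onto and M(L_i) ->
    M(Q) is injective, so M(L_i) is the image of M(P) -> M(Q). On projectives M amounts to a graded
    module over k[t]/t^m, and a longest cyclic piece splits off by the argument that also shows that
    indecomposable R-modules are uniserial.

    Write I for the ideal. Since the hull of each L_i is injective, I is generated as a left ideal
    by the embeddings of the L_i in their hulls and is closed under right multiplication by E. These
    embeddings are monomorphisms, so I b = 0 forces b = 0; and an E-linear map I -> E sends each of
    them to a right multiple of it, because it respects annihilators. *)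

Section LinearMaps.
Variable A : pzRingType.
Implicit Types M N P Q S : lmodType A.

Definition pack_linear M N (f : M -> N) (fL : linear f) : {linear M -> N} :=
  HB.pack f (GRing.isLinear.Build A M N *:%R f fL).

Lemma isom_refl M : isom M M.
Proof. by exists (idfun : {linear M -> M}); exists id. Qed.

Lemma isom_sym M N : isom M N -> isom N M.
Proof.
case=> f [g fK gK]; exists (pack_linear (can2_linear fK gK)).
by exists f.
Qed.

Lemma isom_trans M N P : isom M N -> isom N P -> isom M P.
Proof.
case=> f fB [g gB]; exists ((g : {linear N -> P}) \o (f : {linear M -> N})).
exact: bij_comp.
Qed.

Lemma bij_of_inj_surj (X Y : Type) (f : X -> Y) :
  injective f -> (forall y, exists x, f x = y) -> bijective f.
Proof.
move=> fI fS; pose g y := sval (cid (fS y)).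
have gK : cancel g f by move=> y; rewrite /g; case: cid.
by exists g => // x; apply: fI; rewrite gK.
Qed.

Lemma isom_of M N (f : {linear M -> N}) :
  (forall x, f x = 0 -> x = 0) -> (forall y, exists x, f x = y) -> isom M N.
Proof.
move=> f0 fS; exists f; apply: bij_of_inj_surj => // x y e.
by apply/eqP; rewrite -subr_eq0; apply/eqP/f0; rewrite raddfB /= e subrr.
Qed.

Lemma isom_can M N : isom M N ->
  exists (f : {linear M -> N}) (g : {linear N -> M}), cancel f g /\ cancel g f.
Proof.
by case=> f [g fK gK]; exists f, (pack_linear (can2_linear fK gK)).
Qed.

Lemma isom_linear M N : isom M N -> exists f : {linear M -> N},
  (forall x, f x = 0 -> x = 0) /\ (forall y, exists x, f x = y).
Proof.
case=> f fB; exists f; split=> [x fx|y].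
  by apply: (bij_inj fB); rewrite fx raddf0.
by case: fB => g fK gK; exists (g y).
Qed.

Section SubOf.
Variables (M : lmodType A) (P : M -> Prop).
Hypotheses (P0 : P 0) (PD : forall x y, P x -> P y -> P (x + y)).
Hypothesis PZ : forall a x, P x -> P (a *: x).

Let p : {pred M} := fun x => `[< P x >].

Lemma sub_of_closed : subsemimod_closed p.
Proof.
split; first split.
- exact/asboolP.
- by move=> x y /asboolP Px /asboolP Py; apply/asboolP/PD.
- by move=> a x /asboolP Px; apply/asboolP/PZ.
Qed.

Definition sub_of : submodClosed M :=
  HB.pack p (GRing.isSubSemiModClosed.Build A M p sub_of_closed).

Lemma in_sub_of x : x \in sub_of <-> P x.
Proof. by split=> [/asboolP|Px]; last exact/asboolP. Qed.

End SubOf.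

Section Cyclic.
Variables (M : lmodType A) (x : M).

Definition generates := forall y, exists a : A, y = a *: x.

Definition cyc : submodClosed M.
Proof.
refine (@sub_of M (fun y => exists a : A, y = a *: x) _ _ _).
- by exists 0; rewrite scale0r.
- by move=> _ _ [a ->] [b ->]; exists (a + b); rewrite scalerDl.
- by move=> b _ [a ->]; exists (b * a); rewrite scalerA.
Defined.

Lemma in_cyc y : y \in cyc <-> exists a : A, y = a *: x.
Proof. exact: in_sub_of. Qed.

Lemma mem_cyc a : a *: x \in cyc.
Proof. by apply/in_cyc; exists a. Qed.

Definition cyc_gen : submod cyc.
Proof. by exists x; apply/in_cyc; exists 1; rewrite scale1r. Defined.

End Cyclic.

Lemma submod_inj M (U : submodClosed M) (y z : submod U) :
  val y = val z -> y = z.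
Proof. exact: val_inj. Qed.

Definition to_submod M (U : submodClosed M) x (xU : x \in U) : submod U :=
  exist (fun x => x \in U) x xU.

Definition submod_val M (U : submodClosed M) : {linear submod U -> M} :=
  pack_linear (fun a (x y : submod U) => erefl : val (a *: x + y) = a *: val x + val y).

Lemma cyc_generates M (x : M) : generates (cyc_gen x).
Proof.
move=> [y yP]; have /in_cyc[a e] := yP; exists a; exact: submod_inj.
Qed.

Definition quot_pi M (U : submodClosed M) : {linear M -> quotmod U}.
Proof.
apply: (@pack_linear M (quotmod U) (@quotmod_pi _ M U)) => a x y.
by rewrite quotmod_piD -quotmod_scaleE.
Defined.

Lemma quot_pi0 M (U : submodClosed M) x : quot_pi U x = 0 <-> x \in U.
Proof.
rewrite -[0](raddf0 (quot_pi U)) -[x in x \in U]subr0; exact: quotmod_piP.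
Qed.

Lemma quot_pi_surj M (U : submodClosed M) y : exists x, quot_pi U x = y.
Proof. by elim/quotmod_ind: y => x; exists x. Qed.

(** A set-theoretic section [s] of [f] suffices: [g] does not see the choice of a preimage, so [g]
    after [s] is linear. *)
Lemma linear_factor M N P (f : {linear M -> N}) (g : {linear M -> P}) :
  (forall y, exists x, f x = y) -> (forall x, f x = 0 -> g x = 0) ->
  exists h : {linear N -> P}, forall x, h (f x) = g x.
Proof.
move=> fS fg; pose s y := sval (cid (fS y)).
have sK y : f (s y) = y by rewrite /s; case: cid.
have gs x : g (s (f x)) = g x.
  by apply/eqP; rewrite -subr_eq0 -raddfB; apply/eqP/fg; rewrite raddfB /= sK subrr.
have L : linear (fun y => g (s y)).
  move=> a x y; rewrite -linearP -[in RHS]gs.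
  by congr (g (s _)); rewrite linearP !sK.
by exists (pack_linear L).
Qed.

Lemma quot_isom M N (U : submodClosed M) (f : {linear M -> N}) :
  (forall y, exists x, f x = y) -> (forall x, f x = 0 <-> x \in U) ->
  isom (quotmod U) N.
Proof.
move=> fS fU.
have [||h hP] := @linear_factor _ _ _ (quot_pi U) f.
- exact: quot_pi_surj.
- by move=> x /quot_pi0 /fU.
apply: (@isom_of _ _ h) => [y|y].
  by have [x <-] := quot_pi_surj y; rewrite hP => /fU /quot_pi0.
by have [x <-] := fS y; exists (quot_pi U x).
Qed.

Lemma quot_map_isom M N (f : {linear M -> N}) (U : submodClosed M)
    (V : submodClosed N) :
  (forall y, exists x, f x = y) -> (forall x, x \in U <-> f x \in V) ->
  isom (quotmod U) (quotmod V).
Proof.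
move=> fS fUV.
apply: (@quot_isom _ _ U ((quot_pi V : {linear N -> quotmod V}) \o f)) => [y|x] /=.
  by have [z <-] := quot_pi_surj y; have [x <-] := fS z; exists x.
by split=> [/quot_pi0/fUV|/fUV/quot_pi0].
Qed.

Definition scale_by M (x : M) : {linear A^o -> M}.
Proof.
apply: (@pack_linear A^o M (fun a : A => a *: x)) => a b c.
by rewrite scalerDl scalerA.
Defined.

Lemma generates_map M N (x : M) (y : N) :
  generates x -> (forall a : A, a *: x = 0 -> a *: y = 0) ->
  exists f : {linear M -> N}, f x = y.
Proof.
move=> xM xy; have [||f fP] := @linear_factor _ _ _ (scale_by x) (scale_by y).
- by move=> z; have [a ->] := xM z; exists a.
- exact: xy.
by exists f; have := fP 1; rewrite /= !scale1r.
Qed.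

Lemma generates_fg M (x : M) : generates x -> finitely_generated M.
Proof.
move=> xM; exists 1%N, (fun=> x) => y; have [a ->] := xM y.
by exists (fun=> a); rewrite big_ord1.
Qed.

Lemma fin_generated_by M (I : finType) (g : I -> M) :
  (forall x, exists a : I -> A, x = \sum_i a i *: g i) -> finitely_generated M.
Proof.
move=> h; exists #|I|, (fun j => g (enum_val j)) => x; have [a ->] := h x.
exists (fun j => a (enum_val j)).
by rewrite (reindex (@enum_val I predT)) //=; apply: onW_bij; apply: enum_val_bij.
Qed.

Lemma internal_sum M (U V : submodClosed M) :
  (forall x, x \in U -> x \in V -> x = 0) ->
  (forall x, exists2 u, u \in U & x - u \in V) ->
  isom M (submod U * submod V)%type.
Proof.
move=> UV0 UV; apply: isom_sym.
have L : linear (fun p : submod U * submod V => val p.1 + val p.2 : M).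
  by move=> a p q; rewrite /= scalerDr addrACA.
apply: (@isom_of _ _ (pack_linear L)) => [[u v] /= e|x].
  have u0 : val u = 0.
    apply: UV0; rewrite ?(valP u) //.
    have -> : val u = - val v by apply/eqP; rewrite -addr_eq0 e.
    by rewrite -scaleN1r rpredZ // (valP v).
  have v0 : val v = 0 by rewrite u0 add0r in e.
  by congr pair; apply: submod_inj.
have [u uU xuV] := UV x.
by exists (to_submod uU, to_submod xuV); rewrite /= addrC subrK.
Qed.

Lemma indecomposable_summand M (U V : submodClosed M) :
  indecomposable M ->
  (forall x, x \in U -> x \in V -> x = 0) ->
  (forall x, exists2 u, u \in U & x - u \in V) ->
  (exists2 x, x \in U & x <> 0) -> forall x, x \in U.
Proof.
move=> [_ indM] UV0 UV [y yU y0] x.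
case: (indM _ _ (internal_sum UV0 UV)) => [U0|V0].
  by case: y0; have /(congr1 val) := U0 (to_submod yU).
have [u uU xuV] := UV x.
have /(congr1 val) /= /eqP := V0 (to_submod xuV).
by rewrite subr_eq0 => /eqP ->.
Qed.

(** Such a [z] lies in every nonzero submodule, so it generates a simple essential socle. This is
    stronger than asking that any two nonzero submodules meet. *)
Definition uniform M := exists2 z : M, z <> 0 &
  forall y, y <> 0 -> exists a : A, z = a *: y.

Lemma isom_uniform M N : isom M N -> uniform M -> uniform N.
Proof.
move=> /isom_linear[f [f0 fS]] [z z0 zP]; exists (f z) => [/f0//|y y0].
have [x fx] := fS y; have [|a ->] := zP x; first by move=> x0;
  rewrite -fx x0 raddf0 in y0.
by exists a; rewrite linearZ -fx.
Qed.

Lemma uniform_indecomposable M : uniform M -> indecomposable M.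
Proof.
move=> uM; split=> [M0|N P /isom_uniform/(_ uM)[[u v] z0 zP]].
  by case: uM => z; case; apply: M0.
apply: contrapT => /not_orP[/existsNP[x x0] /existsNP[y y0]].
have [|a] := zP (x, 0); first by case.
have [|b] := zP (0, y); first by case.
by move=> [u0 _] [_ v0]; apply: z0; rewrite u0 v0 !scaler0.
Qed.

Definition kernel_sub M N (f : {linear M -> N}) : submodClosed M.
Proof.
refine (@sub_of M (fun x => f x = 0) _ _ _).
- by rewrite linear0.
- by move=> x y fx fy; rewrite linearD fx fy addr0.
- by move=> a x fx; rewrite linearZ /= fx scaler0.
Defined.

Lemma in_kernel_sub M N (f : {linear M -> N}) x : x \in kernel_sub f <-> f x = 0.
Proof. exact: in_sub_of. Qed.

Definition image_mod M N (f : {linear M -> N}) : submodClosed N.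
Proof.
refine (@sub_of N (fun y => exists x, y = f x) _ _ _).
- by exists 0; rewrite linear0.
- by move=> _ _ [x ->] [y ->]; exists (x + y); rewrite linearD.
- by move=> a _ [x ->]; exists (a *: x); rewrite linearZ.
Defined.

Lemma in_image_mod M N (f : {linear M -> N}) y :
  y \in image_mod f <-> exists x, y = f x.
Proof. exact: in_sub_of. Qed.

Definition preimage_sub M N (f : {linear M -> N}) (U : submodClosed N) :
  submodClosed M.
Proof.
refine (@sub_of M (fun x => f x \in U) _ _ _).
- by rewrite linear0 rpred0.
- by move=> x y fx fy; rewrite linearD rpredD.
- by move=> a x fx; rewrite linearZ rpredZ.
Defined.

Lemma in_preimage_sub M N (f : {linear M -> N}) (U : submodClosed N) x :
  x \in preimage_sub f U <-> f x \in U.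
Proof. exact: in_sub_of. Qed.

Lemma linear_eq0_inj M N (f : {linear M -> N}) :
  (forall x, f x = 0 -> x = 0) -> injective f.
Proof.
move=> f0 x y e; apply/eqP; rewrite -subr_eq0; apply/eqP/f0.
by rewrite linearB e subrr.
Qed.

(** The lift [f] is onto because its image still covers [S], and a section of [f] is onto for the
    same reason. Projectivity is tested on finitely generated modules, hence the hypothesis on
    [S]. *)
Lemma projective_cover_unique S P Q : finitely_generated S ->
  is_projective_cover S P -> is_projective_cover S Q -> isom P Q.
Proof.
move=> Sfg [Pfg [Pproj [p [pS psup]]]] [Qfg [Qproj [q [qS qsup]]]].
have [f qf] := Pproj _ _ q p Qfg Sfg qS.
have fS y : exists x, f x = y.
  suff /in_image_mod[x ->] : y \in image_mod f by exists x.
  apply: qsup => s.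
  by have [x <-] := pS s; exists (f x); rewrite ?qf //; apply/in_image_mod; exists x.
have [g fg] := Qproj _ _ f (idfun : {linear Q -> Q}) Pfg Qfg fS.
have gS x : exists y, x = g y.
  apply/in_image_mod; apply: psup => s; have [y <-] := qS s.
  exists (g y); first by apply/in_image_mod; exists y.
  by rewrite -qf fg.
apply: (isom_of (f := f)) => // x fx.
by have [y e] := gS x; rewrite e; move: fx; rewrite e fg /= => ->; rewrite linear0.
Qed.

Lemma injective_envelope_unique S P Q : finitely_generated S ->
  is_injective_envelope S P -> is_injective_envelope S Q -> isom P Q.
Proof.
move=> Sfg [Pfg [Pinj [p [pI pess]]]] [Qfg [Qinj [q [qI qess]]]].
have [f fp] := Qinj _ _ p q Sfg Pfg pI.
have f0 x : f x = 0 -> x = 0.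
  move=> fx; apply: (pess (kernel_sub f)); last exact/in_kernel_sub.
  move=> y /in_kernel_sub; rewrite fp => qy.
  by apply: qI; rewrite qy linear0.
have [g gf] := Pinj _ _ f (idfun : {linear P -> P}) Pfg Qfg (linear_eq0_inj f0).
have g0 y : g y = 0 -> y = 0.
  move=> gy; apply: (qess (kernel_sub g)); last exact/in_kernel_sub.
  move=> s /in_kernel_sub; rewrite -fp gf /= => ps; apply: pI.
  by rewrite ps linear0.
apply: (isom_of (f := f)) => // y; exists (g y).
by apply: (linear_eq0_inj g0); rewrite gf.
Qed.

Lemma sub_isom M N (f : {linear M -> N}) (V : submodClosed M) (U : submodClosed N) :
  (forall x, f x = 0 -> x = 0) -> (forall y, exists x, f x = y) ->
  (forall x, x \in V <-> f x \in U) -> isom (submod V) (submod U).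
Proof.
move=> f0 fS VU.
have fU (x : submod V) : f (val x) \in U by apply/VU; apply: (valP x).
have L : linear (fun x => to_submod (fU x)).
  by move=> a x y; apply: submod_inj; rewrite /= linearP.
apply: (isom_of (f := pack_linear L)) => [x /(congr1 val) /= /f0 x0|[y yU]].
  exact: submod_inj.
have [x fx] := fS y; have xV : x \in V by apply/VU; rewrite fx.
by exists (to_submod xV); apply: submod_inj.
Qed.

Lemma sub_sub_isom M (W V : submodClosed M) : {subset V <= W} ->
  isom (submod (preimage_sub (submod_val W) V)) (submod V).
Proof.
move=> VW.
have fP (x : submod (preimage_sub (submod_val W) V)) : val (val x) \in V.
  by have /in_preimage_sub := valP x.
have L : linear (fun x => to_submod (fP x)) by move=> a x y; apply: submod_inj.
apply: (isom_of (f := pack_linear L)) => [x /(congr1 val) /= x0|[y yV]].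
  by apply: submod_inj; apply: submod_inj.
have zP : to_submod (VW _ yV) \in preimage_sub (submod_val W) V.
  exact/in_preimage_sub.
by exists (to_submod zP); apply: submod_inj.
Qed.

End LinearMaps.

(** * Scalars of the ground field in modules over an algebra *)

Section AlgebraModules.
Variables (k : fieldType) (A : algType k) (M : lmodType A).
Implicit Types (c d : k) (a : A) (x : M).

Lemma scalekA c a x : (c *: a) *: x = c%:A *: (a *: x).
Proof. by rewrite scalerA mulr_algl. Qed.

Lemma scalekC c a x : a *: (c%:A *: x) = c%:A *: (a *: x).
Proof. by rewrite !scalerA mulr_algl mulr_algr. Qed.

Lemma scalekM c d x : c%:A *: (d%:A *: x) = (c * d)%:A *: x.
Proof. by rewrite scalerA mulr_algl scalerA. Qed.

Lemma scalekDl c d x : (c + d)%:A *: x = c%:A *: x + d%:A *: x.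
Proof. by rewrite !scalerDl. Qed.

Lemma scalek1 x : (1 : k)%:A *: x = x.
Proof. by rewrite scale1r scale1r. Qed.

Lemma scalek0 x : (0 : k)%:A *: x = 0.
Proof. by rewrite scale0r scale0r. Qed.

Lemma scalekK c x : c != 0 -> c^-1%:A *: (c%:A *: x) = x.
Proof. by move=> c0; rewrite scalekM mulVf // scalek1. Qed.

End AlgebraModules.

(** * Complements and functionals in vector spaces of any dimension *)

Lemma Zorn_sub (k : fieldType) (V : lmodType k) (W : submodClosed V) :
  exists C : submodClosed V, (forall x, x \in W -> x \in C -> x = 0) /\
    (forall x, exists2 w, w \in W & x - w \in C).
Proof.
(* The sets hold only the nonzero vectors of [C], so that the union of the empty chain, which is the
   empty set, stands for the zero subspace. *)
pose P (X : set V) := exists2 C : submodClosed V,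
  (forall x, X x <-> x <> 0 /\ x \in C) & forall x, x \in W -> x \in C -> x = 0.
have [F FP FT|X [[C XC WC] Cmax]] := @Zorn_bigcup V P.
  have sub0 (x : V) : x = 0 \/ x <> 0 by apply: EM.
  have mF y Y (FY : F Y) : Y y -> y <> 0.
    by have [C YC _] := FP _ FY; move/YC => [].
  have [] := EM (exists Y, F Y).
  - move=> _.
    have cl0 : (0 = 0 :> V \/ (\bigcup_(Y in F) Y)%classic 0) by left.
    unshelve eexists (@sub_of k V
      (fun x => x = 0 \/ (\bigcup_(Y in F) Y)%classic x) cl0 _ _).
    + move=> x y [->|[X FX Xx]]; first by rewrite add0r.
      move=> [->|[Y FY Yy]]; first by rewrite addr0; right; exists X.
      have [e|ne] := sub0 (x + y); [by left | right].
      have [XY|YX] := FT _ _ FX FY.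
        exists Y => //; have [C YC _] := FP _ FY.
        apply/YC; split=> //; apply: rpredD; first by have /YC[] := XY _ Xx.
        by have /YC[] := Yy.
      exists X => //; have [C XC _] := FP _ FX.
      apply/XC; split=> //; apply: rpredD; first by have /XC[] := Xx.
      by have /XC[] := YX _ Yy.
    + move=> a x [->|[X FX Xx]]; first by left; rewrite scaler0.
      have [e|ne] := sub0 (a *: x); [by left | right].
      exists X => //; have [C XC _] := FP _ FX.
      by apply/XC; split=> //; apply: rpredZ; have /XC[] := Xx.
    + move=> x; rewrite in_sub_of; split=> [[Y FY Yx]|[x0 [//|]]] //.
      by split; [exact: mF Yx | right; exists Y].
    + move=> x xW /in_sub_of [//|[Y FY Yx]]; have [C YC WC] := FP _ FY.
      by apply: WC => //; have /YC[] := Yx.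
  - move=> nF; unshelve eexists (@sub_of k V (fun x => x = 0) erefl _ _).
    + by move=> _ _ -> ->; rewrite addr0.
    + by move=> a _ ->; rewrite scaler0.
    + move=> x; rewrite in_sub_of; split=> [[Y FY]|[]//].
      by case: nF; exists Y.
    + by move=> x _ /in_sub_of.
exists C; split=> // x; apply: contrapT => nx.
have xC : x \notin C.
  by apply/negP => xC; apply: nx; exists 0; rewrite ?rpred0 ?subr0.
pose PC y := exists2 c, c \in C & exists a, y = c + a *: x.
have PC0 : PC 0 by exists 0; rewrite ?rpred0 //; exists 0; rewrite scale0r addr0.
have PCD y z : PC y -> PC z -> PC (y + z).
  move=> [c cC [a ->]] [d dC [b ->]]; exists (c + d); rewrite ?rpredD //.
  by exists (a + b); rewrite scalerDl addrACA.
have PCZ b y : PC y -> PC (b *: y).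
  move=> [c cC [a ->]]; exists (b *: c); rewrite ?rpredZ //.
  by exists (b * a); rewrite scalerDr scalerA.
pose C' := sub_of PC0 PCD PCZ.
pose Y := [set y | y <> 0 /\ y \in C']%classic.
have XY : (X `<` Y)%classic.
  split=> [y /XC[y0 yC]|YX]; last first.
    have /XC[_] : X x; last exact/negP.
    apply: YX; split; first by move=> x0; rewrite x0 rpred0 in xC.
    by apply/in_sub_of; exists 0; rewrite ?rpred0 //; exists 1; rewrite scale1r add0r.
  split=> //; apply/in_sub_of; exists y => //.
  by exists 0; rewrite scale0r addr0.
apply: (Cmax _ XY).
exists C' => // y yW /in_sub_of [c cC [a e]].
have [a0|a0] := eqVneq a 0.
  by apply: WC => //; rewrite e a0 scale0r addr0.
case: nx; exists (a^-1 *: y); first exact: rpredZ.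
have -> : x - a^-1 *: y = - a^-1 *: c.
  by rewrite e scalerDr scalerA mulVf // scale1r opprD addrC subrK scaleNr.
exact: rpredZ.
Qed.

(** The extension is [g] after the projection onto the image of [f] along a complement [C]; [s y] is
    the preimage under [f] of the projection of [y]. *)
Lemma extend_functional (k : fieldType) (M N : lmodType k) (f : {linear M -> N})
    (g : {linear M -> k^o}) : injective f ->
  exists h : {linear N -> k^o}, forall x, h (f x) = g x.
Proof.
move=> fI.
pose PW y := exists x, y = f x.
have W0 : PW 0 by exists 0; rewrite raddf0.
have WD y z : PW y -> PW z -> PW (y + z).
  by move=> [x ->] [x' ->]; exists (x + x'); rewrite raddfD.
have WZ a y : PW y -> PW (a *: y) by move=> [x ->]; exists (a *: x); rewrite linearZ.
pose W := sub_of W0 WD WZ.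
have [C [WC0 WC]] := Zorn_sub W.
have fP y : exists x, y - f x \in C.
  by have [w /in_sub_of[x ->] yC] := WC y; exists x.
pose s y := sval (cid (fP y)); have sP y : y - f (s y) \in C by rewrite /s; case: cid.
have sU y x : y - f x \in C -> s y = x.
  move=> yx; apply: fI; apply/eqP; rewrite -subr_eq0; apply/eqP; apply: WC0.
    by apply/in_sub_of; exists (s y - x); rewrite raddfB.
  have -> : f (s y) - f x = (y - f x) - (y - f (s y)).
    by rewrite opprB [y - f x]addrC addrACA [- f x + _]addrC subrr addr0 addrC.
  by rewrite rpredD // -scaleN1r rpredZ.
have L : linear (fun y => g (s y)).
  move=> a x y; rewrite -linearP; congr (g _); apply: sU.
  rewrite linearP opprD addrACA -scalerBr; apply: rpredD => //; exact: rpredZ.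
exists (pack_linear L) => x /=; congr (g _); apply: sU.
by rewrite subrr rpred0.
Qed.

Lemma separating_functional (k : fieldType) (N : lmodType k) (x : N) :
  x <> 0 -> exists h : {linear N -> k^o}, h x = 1.
Proof.
move=> x0; have [|h hP] := @extend_functional k k^o N (scale_by x) (idfun : {linear
  k^o -> k^o}).
  move=> a b /= /eqP; rewrite -subr_eq0 -scalerBl scaler_eq0 subr_eq0.
  by case/orP => /eqP.
by exists h; have := hP 1; rewrite /= scale1r.
Qed.

(** * Algebras with a monomial basis *)

(* The shape of the endomorphism algebra of a family of uniserial modules over a
   graded nilpotent operator t of degree u: the i-th one has a generator g_i of
   degree [deg i] and length [len i], and [mor i j b] is the map g_i |-> t^b g_j,
   which exists when [adm i j b]. *)
Record uniserial_basis (k : fieldType) (E : algType k) (I : finType)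
    (G : zmodType) (u : G) (m : nat) := UniserialBasis {
  len : I -> nat;
  deg : I -> G;
  mor : I -> I -> nat -> E;
  coef : I -> I -> nat -> {linear E -> k^o};
  adm := fun i j b => (deg i == deg j + u *+ b) && (len j <= b + len i)%N;
  len_gt0 : forall i, (0 < len i)%N;
  len_le : forall i, (len i <= m)%N;
  objP : forall g l, (0 < l <= m)%N -> exists i, deg i = g /\ len i = l;
  obj_inj : forall i j, deg i = deg j -> len i = len j -> i = j;
  mor_adm : forall i j b, ~~ adm i j b -> mor i j b = 0;
  mor_len : forall i j b, (len j <= b)%N -> mor i j b = 0;
  morM : forall i j l b c, adm i j b -> adm j l c ->
    mor j l c * mor i j b = mor i l (b + c);
  morM0 : forall i j j' l b c, j <> j' -> mor j' l c * mor i j b = 0;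
  mor1 : \sum_i mor i i 0 = 1;
  coef_mor : forall i j b i' j' b', adm i j b -> (b < len j)%N ->
    coef i' j' b' (mor i j b) = [&& i' == i, j' == j & b' == b]%:R;
  morE : forall a,
    a = \sum_i \sum_j \sum_(b < m) (coef i j b a : k) *: mor i j b
}.

Section Basis.
Variables (k : fieldType) (E : algType k) (I : finType) (G : zmodType) (u : G).
Variables (m : nat) (B : uniserial_basis E I u m).
Implicit Types (i j p q : I) (b c : nat) (a h : E).

Local Notation F := (mor B).
Local Notation co := (coef B).
Local Notation ok := (adm B).
Local Notation ln := (len B).
Local Notation dg := (deg B).
Definition idem i := F i i 0.
Local Notation e := idem.

Lemma m_gt0 i : (0 < m)%N.
Proof. exact: leq_trans (len_gt0 B i) (len_le B i). Qed.

Lemma admP i j b : reflect (dg i = dg j + u *+ b /\ (ln j <= b + ln i)%N) (ok i j b).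
Proof. by apply: (iffP andP) => -[/eqP]. Qed.

Lemma adm_refl i : ok i i 0.
Proof. by apply/admP; rewrite mulr0n addr0 add0n. Qed.

Lemma adm_trans i j l b c : ok i j b -> ok j l c -> ok i l (b + c).
Proof.
move=> /admP[d1 h1] /admP[d2 h2]; apply/admP; split; last by lia.
by rewrite d1 d2 mulrnDr addrA addrAC.
Qed.

Lemma adm_antisym i j : ok i j 0 -> ok j i 0 -> i = j.
Proof.
move=> /admP[d1 l1] /admP[_ l2]; apply: (@obj_inj _ _ _ _ _ _ B); last by lia.
by rewrite d1 mulr0n addr0.
Qed.

Lemma mor_ind (P : E -> Prop) : P 0 -> (forall a a', P a -> P a' -> P (a + a')) ->
  (forall (c : k) a, P a -> P (c *: a)) ->
  (forall i j b, ok i j b -> (b < ln j)%N -> P (F i j b)) -> forall a, P a.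
Proof.
move=> P0 PD PZ PF a; rewrite (morE B a).
elim/big_ind: _ => // i _; elim/big_ind: _ => // j _; elim/big_ind: _ => // b _.
apply: PZ; have [adm_ijb|/mor_adm -> //] := boolP (ok i j b).
by have [/PF|/mor_len ->] := ltnP b (ln j); first exact.
Qed.

Lemma coef_eq a a' : (forall i j b, co i j b a = co i j b a') -> a = a'.
Proof.
by move=> h; rewrite (morE B a) (morE B a'); do 3!apply: eq_bigr => ? _; rewrite h.
Qed.

Lemma functional_eq (f g : {linear E -> k^o}) :
  (forall i j b, ok i j b -> (b < ln j)%N -> f (F i j b) = g (F i j b)) ->
  forall a, f a = g a.
Proof.
move=> fg; apply: mor_ind => // [|a a' ea ea'|c a ea].
- by rewrite !linear0.
- by rewrite !linearD ea ea'.
- by rewrite !linearZ /= ea.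
Qed.

Lemma coef_adm i j b a : co i j b a <> 0 -> ok i j b /\ (b < ln j)%N.
Proof.
move=> c0; apply/andP; apply: contra_notT c0 => nb; move: a.
apply: mor_ind => [|a a' ea ea'|c a ea|p q c pq cq].
- by rewrite linear0.
- by rewrite linearD ea ea' addr0.
- by rewrite linearZ /= ea scaler0.
- rewrite coef_mor //; case: and3P => // -[/eqP ? /eqP ? /eqP ?]; subst p q c.
  by rewrite pq cq in nb.
Qed.

Lemma coef_mor1 i j b : ok i j b -> (b < ln j)%N -> co i j b (F i j b) = 1.
Proof. by move=> h1 h2; rewrite coef_mor // !eqxx. Qed.

Lemma mor_neq0 i j b : ok i j b -> (b < ln j)%N -> F i j b <> 0.
Proof.
move=> h1 h2 F0; have := coef_mor1 h1 h2; rewrite F0 linear0 => /eqP.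
by rewrite eq_sym oner_eq0.
Qed.

(** Composing with [F q j c] shifts exponents by [c] and keeps distinct monomials distinct. The
    bound keeps the exponent below [ln j], from where monomials with target [j] vanish. *)
Lemma coef_mulL i q j b c a : ok q j c -> (b + c < ln j)%N ->
  co i j (b + c) (F q j c * a) = co i q b a.
Proof.
move=> qj bc; move: a; apply: mor_ind => [|a a' ea ea'|x a ea|i' q' b' iq bq].
- by rewrite mulr0 !linear0.
- by rewrite mulrDr !linearD ea ea'.
- by rewrite -scalerAr !linearZ ea.
rewrite coef_mor //; have [eqq|/eqP nq] := eqVneq q q'; last first.
  by rewrite morM0 ?linear0 ?andbF // => /esym.
subst q'; rewrite morM //; have [bc'|bc'] := ltnP (b' + c) (ln j).
  by rewrite coef_mor ?(adm_trans iq qj) // eqxx eqn_add2r.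
rewrite mor_len // linear0; case: eqP => //= _; case: eqP => // ?; lia.
Qed.

Lemma coef_mulR i q j b c a : ok i q c -> (b + c < ln j)%N ->
  co i j (b + c) (a * F i q c) = co q j b a.
Proof.
move=> qj bc; move: a; apply: mor_ind => [|a a' ea ea'|x a ea|q' j' b' iq bq].
- by rewrite mul0r !linear0.
- by rewrite mulrDl !linearD ea ea'.
- by rewrite -scalerAl !linearZ ea.
rewrite coef_mor //; have [eqq|/eqP nq] := eqVneq q q'; last first.
  by rewrite morM0 ?linear0.
subst q'; rewrite morM // [(c + b')%N]addnC; have [bc'|bc'] := ltnP (b' + c) (ln j').
  by rewrite coef_mor // ?eqxx ?eqn_add2r // addnC (adm_trans qj iq).
rewrite mor_len // linear0; case: eqP => //= ejj; subst j'.
by case: eqP => // ?; lia.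
Qed.

Lemma coef_mulL0 i j d q j' c a : (d < c)%N -> co i j d (F q j' c * a) = 0.
Proof.
move=> dc; have [qj|/mor_adm ->] := boolP (ok q j' c); last by rewrite mul0r linear0.
move: a; apply: mor_ind => [|a a' ea ea'|x a ea|i' q' b' iq bq].
- by rewrite mulr0 !linear0.
- by rewrite mulrDr !linearD ea ea' addr0.
- by rewrite -scalerAr !linearZ /= ea scaler0.
have [eqq|/eqP nq] := eqVneq q q'; last first.
  by rewrite morM0 ?linear0 // => /esym.
subst q'; rewrite morM //; have [bc'|bc'] := ltnP (b' + c) (ln j').
  rewrite coef_mor ?(adm_trans iq qj) //; case: and3P => // -[_ _ /eqP ?]; lia.
by rewrite mor_len // linear0.
Qed.

Lemma coef_mulR0 i j d i' q c a : (d < c)%N -> co i j d (a * F i' q c) = 0.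
Proof.
move=> dc; have [qj|/mor_adm ->] := boolP (ok i' q c); last by rewrite mulr0 linear0.
move: a; apply: mor_ind => [|a a' ea ea'|x a ea|q' j' b' iq bq].
- by rewrite mul0r !linear0.
- by rewrite mulrDl !linearD ea ea' addr0.
- by rewrite -scalerAl !linearZ /= ea scaler0.
have [eqq|/eqP nq] := eqVneq q q'; last first.
  by rewrite morM0 ?linear0.
subst q'; rewrite morM //; have [bc'|bc'] := ltnP (c + b') (ln j').
  rewrite coef_mor ?(adm_trans qj iq) //; case: and3P => // -[_ _ /eqP ?]; lia.
by rewrite mor_len // linear0.
Qed.

Lemma mul_idem_mor i j b : e j * F i j b = F i j b.
Proof.
have [ij|/mor_adm ->] := boolP (ok i j b); last by rewrite mulr0.
by rewrite morM ?addn0 ?adm_refl.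
Qed.

Lemma mul_mor_idem i j b : F i j b * e i = F i j b.
Proof.
have [ij|/mor_adm ->] := boolP (ok i j b); last by rewrite mul0r.
by rewrite morM ?add0n ?adm_refl.
Qed.

Lemma mul_mor_idem0 i j p b : i <> p -> F i j b * e p = 0.
Proof. by move=> ip; rewrite morM0 // => /esym. Qed.

Lemma coef_idemL i j b p a : co i j b (e p * a) = if p == j then co i j b a else 0.
Proof.
have [<-|/eqP pj] := eqVneq p j.
  have [bp|bp] := ltnP b (ln p).
    by rewrite -[in LHS](addn0 b) coef_mulL ?adm_refl ?addn0.
  have h a' : co i p b a' = 0.
    by apply: contrapT => /coef_adm[_]; lia.
  by rewrite !h.
move: a; apply: mor_ind => [|a a' ea ea'|x a ea|i' j' b' iq bq].
- by rewrite mulr0 !linear0.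
- by rewrite mulrDr !linearD ea ea' addr0.
- by rewrite -scalerAr !linearZ /= ea scaler0.
have [eqq|/eqP nq] := eqVneq j' p; last by rewrite morM0 ?linear0.
rewrite -eqq mul_idem_mor coef_mor //; case: and3P => // -[_ /eqP ? _].
by case: pj; rewrite -eqq.
Qed.

Lemma coef_idemR i j b p a : co i j b (a * e p) = if p == i then co i j b a else 0.
Proof.
move: a; apply: mor_ind => [|a a' ea ea'|x a ea|i' j' b' iq bq].
- by rewrite mul0r !linear0 if_same.
- by rewrite mulrDl !linearD ea ea'; case: ifP; rewrite ?addr0.
- by rewrite -scalerAl !linearZ /= ea; case: ifP; rewrite ?scaler0.
have [eqq|/eqP nq] := eqVneq i' p.
  rewrite -eqq mul_mor_idem; case: eqP => // ne; rewrite coef_mor //.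
  by case: and3P => // -[/eqP ? _ _]; case: ne.
rewrite mul_mor_idem0 // linear0; case: eqP => // epi; rewrite coef_mor //.
by case: and3P => // -[/eqP ? _ _]; case: nq; rewrite epi.
Qed.

(** The character by which [E] acts on the simple module of [i]. *)
Definition chi i : {linear E -> k^o} := co i i 0.

(** A product of two monomials is [e i] only if both factors are: exponents add up, and maps of
    exponent 0 in both directions force equal objects. *)
Lemma chiM i a a' : chi i (a * a') = chi i a * chi i a'.
Proof.
move: a'; apply: mor_ind => [|a' a'' ea ea'|x a' ea|j p b jp bp].
- by rewrite mulr0 !linear0 mulr0.
- by rewrite mulrDr !linearD ea ea' mulrDr.
- by rewrite -scalerAr !linearZ /= ea; rewrite /GRing.scale /= mulrCA.
move: a; apply: mor_ind => [|a a'' ea ea'|x a ea|p' q c pq cq].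
- by rewrite mul0r !linear0 mul0r.
- by rewrite mulrDl !linearD ea ea' mulrDl.
- by rewrite -scalerAl !linearZ /= ea; rewrite /GRing.scale /= mulrA.
rewrite /chi !coef_mor //; have [epp|/eqP npp] := eqVneq p p'; last first.
  rewrite morM0 // linear0; case: (and3P (b1 := i == p')) => [[/eqP ? _ _]|];
    last by rewrite mul0r.
  by case: and3P => [[_ /eqP ? _]|]; [case: npp; congruence | rewrite mulr0].
subst p'; rewrite morM //; have [bc|bc] := ltnP (b + c) (ln q); last first.
  rewrite mor_len // linear0; case: (and3P (b1 := i == p)) => [[_ _ /eqP ?]|];
    last by rewrite mul0r.
  by case: and3P => [[_ _ /eqP ?]|]; [lia | rewrite mulr0].
rewrite coef_mor ?(adm_trans jp pq) // -natrM mulnb; congr (_%:R); congr nat_of_bool.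
apply/idP/idP => [/and3P[/eqP ? /eqP ? /eqP b0]|/andP[]].
  subst j q; have [? ?] : b = 0%N /\ c = 0%N by lia.
  by subst b c; rewrite !(adm_antisym jp pq) !eqxx.
by move=> /and3P[_ -> /eqP<-] /and3P[-> _ /eqP<-].
Qed.

Lemma chi_idem i : chi i (e i) = 1.
Proof. by rewrite /chi coef_mor1 ?adm_refl ?len_gt0. Qed.

Lemma chi1 i : chi i 1 = 1.
Proof.
rewrite -(mor1 B) raddf_sum (bigD1 i) //= big1 => [|j ji]; last first.
  rewrite /chi coef_mor ?adm_refl ?len_gt0 //.
  by rewrite eq_sym (negPf ji).
by rewrite chi_idem addr0.
Qed.

Section Module.
Variable M : lmodType E.
Implicit Types (x y z : M) (N : submodClosed M).

Lemma sum_idem x : x = \sum_i e i *: x.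
Proof. by rewrite -scaler_suml mor1 scale1r. Qed.

Lemma idem_neq0 x : x <> 0 -> exists i, e i *: x <> 0.
Proof.
move=> x0; apply: contrapT => /forallNP h; apply: x0.
by rewrite [x]sum_idem big1 // => i _; apply: contrapT.
Qed.

Lemma idem_idem i x : e i *: (e i *: x) = e i *: x.
Proof. by rewrite scalerA mul_idem_mor. Qed.

Lemma idem_mor i j b x : e j *: (F i j b *: x) = F i j b *: x.
Proof. by rewrite scalerA mul_idem_mor. Qed.

Lemma mor_idem i j b x : F i j b *: (e i *: x) = F i j b *: x.
Proof. by rewrite scalerA mul_mor_idem. Qed.

Lemma mor_mor i j l b c x : ok i j b -> ok j l c ->
  F j l c *: (F i j b *: x) = F i l (b + c) *: x.
Proof. by move=> ij jl; rewrite scalerA morM. Qed.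

Lemma mor_mor0 i j j' l b c x : j <> j' -> F j' l c *: (F i j b *: x) = 0.
Proof. by move=> jj; rewrite scalerA morM0 // scale0r. Qed.

Lemma idem_fixed_mor i x j p b : e i *: x = x -> i <> p -> F p j b *: x = 0.
Proof. by move=> <- ip; rewrite mor_mor0. Qed.

(** A substitute for Nakayama's lemma: on [z] the element [a] acts as e_i a e_i, whose terms all
    have positive exponent, hence nilpotently. The induction runs down from the exponents at which
    [F i i c] vanishes. *)
Lemma local_unit i a z : e i *: z = z -> chi i a = 0 -> z = a *: z -> z = 0.
Proof.
move=> ez ca az.
have: forall n c, (ln i - n <= c)%N -> F i i c *: z = 0; last first.
  by move/(_ (ln i) 0%N); rewrite subnn ez; apply.
elim=> [|n IH] c; first by rewrite subn0 => h; rewrite mor_len // scale0r.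
move=> hc; have [ic|/mor_adm ->] := boolP (ok i i c); last by rewrite scale0r.
suff h a' : F i i c *: (a' *: z) = (chi i a' : k)%:A *: (F i i c *: z).
  by rewrite [in LHS]az h ca scalek0.
move: a'; apply: mor_ind => [|a' a'' ea ea'|x a' ea|p q d pq dq].
- by rewrite linear0 scalek0 scale0r scaler0.
- by rewrite linearD scalekDl scalerDl scalerDr ea ea'.
- by rewrite linearZ scalekA scalekC ea scalekM.
rewrite /chi coef_mor //.
have [eip|/eqP ip] := eqVneq i p; last first.
  by rewrite (idem_fixed_mor q d ez ip) scaler0 scalek0.
subst p; have [eiq|/eqP iq] := eqVneq i q; last first.
  by rewrite scalek0 mor_mor0 // => /esym.
subst q; rewrite mor_mor //.
have [<-|nd] := eqVneq 0%N d; first by rewrite scale1r scale1r.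
by rewrite scalek0 IH //; have := len_gt0 B i; lia.
Qed.

End Module.

End Basis.

(** * Standard modules *)

Section Standard.
Variables (k : fieldType) (E : algType k) (I : finType) (G : zmodType) (u : G).
Variables (m : nat) (B : uniserial_basis E I u m).
Implicit Types (i j p q : I) (b c : nat) (a h : E) (M N S : lmodType E).

Local Notation F := (mor B).
Local Notation co := (coef B).
Local Notation ok := (adm B).
Local Notation ln := (len B).
Local Notation dg := (deg B).
Local Notation e := (idem B).
Local Notation chi := (chi B).

Definition simple_at i S := exists s : S, [/\ s <> 0,
  forall y, exists c : k, y = c%:A *: s & forall a, a *: s = (chi i a : k)%:A *: s].

Lemma simple_at_fg i S : simple_at i S -> finitely_generated S.
Proof.
move=> [s [_ sS _]]; apply: (@generates_fg _ _ s) => y.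
by have [c ->] := sS y; exists c%:A.
Qed.

Lemma simple_at_map i S S' (s : S) (s' : S') :
  (forall y, exists c : k, y = c%:A *: s) -> (forall a, a *: s = (chi i a : k)%:A *: s) ->
  s <> 0 -> (forall a, a *: s' = (chi i a : k)%:A *: s') ->
  exists f : {linear S -> S'}, f s = s'.
Proof.
move=> sS sE s0 sE'; apply: generates_map => [y|a].
  by have [c ->] := sS y; exists c%:A.
rewrite sE sE'; have [->|ca] := eqVneq (chi i a : k) 0; first by rewrite !scalek0.
by move=> cs; case: s0; rewrite -(scalekK s ca) cs scaler0.
Qed.

Lemma simple_at_isom i S S' : simple_at i S -> simple_at i S' -> isom S S'.
Proof.
move=> [s [s0 sS sE]] [s' [s0' sS' sE']].
have [f fs] := simple_at_map sS sE s0 sE'.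
apply: (isom_of (f := f)) => y.
  have [c ->] := sS y; rewrite linearZ /= fs.
  have [->|c0] := eqVneq c 0; first by rewrite !scalek0.
  by move=> cs; case: s0'; rewrite -(scalekK s' c0) cs scaler0.
by have [c ->] := sS' y; exists (c%:A *: s); rewrite linearZ /= fs.
Qed.

(** Modulo [U], the element 1 - chi(a)^-1 a fixes [x] and has character 0, so [local_unit]
    applies. *)
Lemma proper_chi i M (x : M) (U : submodClosed M) a : e i *: x = x ->
  chi i a <> 0 -> a *: x \in U -> x \in U.
Proof.
move=> ex ca axU; apply/quot_pi0.
have c0 : (chi i a : k) != 0 by apply/eqP.
apply: (@local_unit _ _ _ _ _ _ B _ i (1 - (chi i a : k)^-1 *: a)).
- by rewrite -linearZ /= ex.
- rewrite linearB linearZ /= chi1 /GRing.scale /= mulVf ?subrr //.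
- rewrite scalerBl scale1r scalekA -[a *: _]linearZ.
  by have /quot_pi0 -> := axU; rewrite scaler0 subr0.
Qed.

(** If [e i *: x = x] and [x] is nonzero, this is the unique maximal submodule of the cyclic module
    E x. *)
Definition chi_kernel i M (x : M) : submodClosed M.
Proof.
refine (@sub_of _ M (fun y => exists2 a, y = a *: x & chi i a = 0) _ _ _).
- by exists 0; rewrite ?scale0r ?linear0.
- by move=> _ _ [a -> ca] [b -> cb]; exists (a + b);
  rewrite ?scalerDl ?linearD ?ca ?cb ?addr0.
- by move=> b _ [a -> ca]; exists (b * a); rewrite ?scalerA // chiM ca mulr0.
Defined.

Lemma in_chi_kernel i M (x y : M) :
  y \in chi_kernel i x <-> exists2 a, y = a *: x & chi i a = 0.
Proof. exact: in_sub_of. Qed.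

Lemma notin_chi_kernel i M (x : M) : e i *: x = x -> x <> 0 ->
  x \notin chi_kernel i x.
Proof.
move=> ex x0; apply/negP => /in_chi_kernel[a xa ca]; apply: x0.
exact: (local_unit ex ca xa).
Qed.

Lemma simple_quot i M (x : M) (U : submodClosed M) : generates x ->
  x \notin U -> (forall a, chi i a = 0 -> a *: x \in U) -> simple_at i (quotmod U).
Proof.
move=> xM xU aU.
have ax a : a *: quot_pi U x = (chi i a : k)%:A *: quot_pi U x.
  rewrite -!linearZ; apply/eqP; rewrite -subr_eq0 -linearB; apply/eqP/quot_pi0.
  rewrite -scalerBl; apply: aU.
  by rewrite linearB linearZ /= chi1 /GRing.scale /= mulr1 subrr.
exists (quot_pi U x); split => //.
- by move/quot_pi0; apply/negP.
- move=> y; have [z <-] := quot_pi_surj y; have [a ->] := xM z.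
  by exists (chi i a); rewrite linearZ -ax.
Qed.

Lemma simple_at_top i M (x : M) : generates x -> e i *: x = x -> x <> 0 ->
  simple_at i (module_top M).
Proof.
move=> xM ex x0; apply: (simple_quot xM).
  apply/negP => /asboolP/(_ (chi_kernel i x)) xr.
  have /negP := notin_chi_kernel ex x0; apply; apply: xr; split.
    by exists x; apply: notin_chi_kernel.
  move=> V NV; have [xV|xV] := boolP (x \in V); [left|right].
    by move=> y; have [a ->] := xM y; apply: rpredZ.
  move=> y; have [a ->] := xM y => ayV; apply/in_chi_kernel; exists a => //.
  by apply: contrapT => ca; move/negP: xV; apply; apply: (proper_chi ex ca ayV).
move=> a ca; apply/asboolP => U [[y yU] Umax].
have UN : {subset U <= chi_kernel i x}.
  move=> z; have [b ->] := xM z => bU; apply/in_chi_kernel; exists b => //.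
  apply: contrapT => cb; have xU := proper_chi ex cb bU.
  by move: yU; have [d ->] := xM y; rewrite rpredZ.
have [NT|NU] := Umax _ UN.
  by have := notin_chi_kernel ex x0; rewrite NT.
by apply: NU; apply/in_chi_kernel; exists a.
Qed.

(** With the converse [idem_factor], this detects the composition factor [S_j] by a nonzero vector
    fixed by [e j], so that bounds on factors become conditions on vectors. *)
Lemma factor_idem j S M : simple_at j S -> is_composition_factor S M ->
  exists2 y : M, e j *: y = y & y <> 0.
Proof.
move=> [s [s0 _ sE]] [Y [X /isom_linear[f [f0 fS]]]].
have [z fz] := fS s; have [y ezy] := quot_pi_surj z.
exists (val (e j *: y)); first by rewrite /= idem_idem.
move=> /(@submod_inj _ _ _ _ 0) ey0; apply: s0.
rewrite -(scalek1 s) -(chi_idem B j) -sE -fz -ezy -!linearZ.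
by rewrite ey0 !linear0.
Qed.

Lemma idem_factor j S M (y : M) : simple_at j S -> e j *: y = y -> y <> 0 ->
  is_composition_factor S M.
Proof.
move=> Sj ey y0; exists (cyc y), (chi_kernel j (cyc_gen y)).
have ex : e j *: cyc_gen y = cyc_gen y by apply: submod_inj.
have x0 : cyc_gen y <> 0 by move/(congr1 val).
apply: simple_at_isom Sj; apply: (simple_quot (@cyc_generates _ _ y)).
  exact: notin_chi_kernel.
by move=> a ca; apply/in_chi_kernel; exists a.
Qed.

Variables (S : I -> lmodType E) (lt : I -> I -> Prop).
Hypothesis Ssimple : forall i, simple_at i (S i).
Hypothesis ltP : forall i j, lt i j <-> (ln j < ln i)%N.

Lemma factors_leP i M : factors_le S lt i M <->
  forall j (y : M), e j *: y = y -> y <> 0 -> j = i \/ (ln i < ln j)%N.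
Proof.
split=> [h j y ey y0|h j].
  by have := h j (idem_factor (Ssimple j) ey y0); rewrite ltP.
by case/(factor_idem (Ssimple j)) => y ey y0; rewrite ltP; apply: (h _ y).
Qed.

Lemma factors_le_isom i M N : isom M N -> factors_le S lt i M -> factors_le S lt i N.
Proof.
move=> /isom_sym/isom_linear[f [f0 _]] /factors_leP h; apply/factors_leP => j y ey y0.
apply: (h _ (f y)); first by rewrite -linearZ ey.
by move/f0.
Qed.

(* The indecomposable projective P_i, as the left ideal E e_i. *)
Definition proj i : lmodType E := submod (cyc (e i : E^o)).

Lemma proj_gen i (x : proj i) : x = val x *: (cyc_gen (e i : E^o) : proj i).
Proof.
apply: submod_inj; have /in_cyc[a ->] := valP x.
by rewrite /= {2}/GRing.scale /= /GRing.scale /= -mulrA mul_idem_mor.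
Qed.

Lemma proj_projective i : is_projective (proj i).
Proof.
move=> M N f g _ _ fS; have [x fx] := fS (g (cyc_gen (e i : E^o))).
have L : linear (fun y : proj i => (val y : E) *: x).
  by move=> a y z; rewrite /= scalerDl -scalerA.
exists (pack_linear L) => y; rewrite /= linearZ /= fx -linearZ; congr (g _).
exact/esym/proj_gen.
Qed.

Lemma idem_cyc_gen i : e i *: (cyc_gen (e i : E^o) : proj i) = cyc_gen (e i : E^o).
Proof. by apply: submod_inj; rewrite /= /GRing.scale /= mul_idem_mor. Qed.

Lemma proj_cover i : is_projective_cover (S i) (proj i).
Proof.
split; first exact: (generates_fg (@cyc_generates _ _ (e i : E^o))).
split; first exact: proj_projective.
have [s [s0 sS sE]] := Ssimple i.
have L : linear (fun y : proj i => (val y : E) *: s).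
  by move=> a y z; rewrite /= scalerDl -scalerA.
exists (pack_linear L); split=> [y|U UP x].
  have [c ->] := sS y; exists (c%:A *: cyc_gen (e i : E^o)); rewrite /= -scalerA.
  by rewrite sE chi_idem scalek1.
have [y yU /= ys] := UP s.
have xU : cyc_gen (e i : E^o) \in U; last by rewrite [x]proj_gen rpredZ.
apply: (proper_chi (idem_cyc_gen i) (a := val y)); last by rewrite -proj_gen.
by move=> cy; apply: s0; rewrite -ys sE cy scalek0.
Qed.

(* The simple object which is the socle of the i-th one. *)
Definition soc i : I := sval (cid (@objP _ _ _ _ _ _ B (dg i + u *+ (ln i).-1) 1
  (m_gt0 B i))).

Lemma socP i : dg (soc i) = dg i + u *+ (ln i).-1 /\ ln (soc i) = 1%N.
Proof. by rewrite /soc; case: cid. Qed.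

Definition soc_incl i : E := F (soc i) i (ln i).-1.

Lemma soc_adm i : ok (soc i) i (ln i).-1.
Proof. by apply/admP; have [-> ->] := socP i; split=> //; lia. Qed.

(* Restricting the maps from L_i to the socle kills exactly the non-injective ones,
   so that Delta_i is E (soc_incl i). *)
Definition std i : lmodType E := submod (cyc (soc_incl i : E^o)).

Lemma mor_soc i j b : ok i j b ->
  F i j b * soc_incl i = F (soc i) j ((ln i).-1 + b).
Proof. by move=> ij; rewrite morM // soc_adm. Qed.

Lemma mor_soc_eq i j b : ok i j b -> F i j b * soc_incl i <> 0 ->
  b = (ln j - ln i)%N /\ (ln i <= ln j)%N.
Proof.
move=> ij; rewrite mor_soc //; have [h|h] := leqP (ln j) ((ln i).-1 + b).
  by rewrite mor_len.
by move=> _; have /admP[_] := ij; have := len_gt0 B i; lia.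
Qed.

(** A nonzero map from the simple object [soc i] to L_j lands in the socle of L_j, so its exponent
    is [(ln j).-1], and e_j Delta_i has dimension at most one. *)
Lemma std_idem i a j : exists c : k,
  e j * (a * soc_incl i) = c *: F (soc i) j (ln j).-1.
Proof.
move: a; apply: (mor_ind (B := B)) => [|a a' [c ec] [c' ec']|x a [c ec]|p q b pq bq].
- by exists 0; rewrite mul0r mulr0 scale0r.
- by exists (c + c'); rewrite mulrDl mulrDr ec ec' scalerDl.
- by exists (x * c); rewrite -scalerAl -scalerAr ec scalerA.
have [epi|/eqP npi] := eqVneq p i; last first.
  by exists 0; rewrite /soc_incl morM0 ?mulr0 ?scale0r // => /esym.
have [eqj|/eqP nqj] := eqVneq q j; last first.
  by exists 0; rewrite mulrA [e j * _]morM0 ?mul0r ?scale0r.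
subst p q; rewrite mor_soc // mul_idem_mor.
have [h|h] := leqP (ln j) ((ln i).-1 + b).
  by exists 0; rewrite mor_len // scale0r.
exists 1; rewrite scale1r; congr (F _ _ _).
by have /admP[_] := pq; have := len_gt0 B i; lia.
Qed.

Lemma std_elem i (x : std i) j : e j *: x = x ->
  exists c : k, val x = c *: F (soc i) j (ln j).-1.
Proof.
move=> ex; have /in_cyc[a xa] := valP x; have [c ec] := std_idem i a j.
by exists c; rewrite -ec -ex /= xa.
Qed.


Lemma act_neq0 i j M (x : M) a : e i *: x = x -> e j *: (a *: x) <> 0 ->
  exists b, [/\ ok i j b, (b < ln j)%N & F i j b *: x <> 0].
Proof.
move=> ex ax; apply: contrapT => /forallNP h; apply: ax; move: a.
apply: (mor_ind (B := B)) => [|a a' ea ea'|c a ea|p q b pq bq].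
- by rewrite scale0r scaler0.
- by rewrite scalerDl scalerDr ea ea' addr0.
- by rewrite scalekA scalekC ea scaler0.
have [eqj|/eqP nqj] := eqVneq q j; last by rewrite mor_mor0.
have [epi|/eqP npi] := eqVneq i p; last by rewrite (idem_fixed_mor q b ex npi) scaler0.
subst p q; rewrite idem_mor; apply: contrapT => nz.
by apply: (h b); split.
Qed.

(** The exponent [ln j - ln i] is that of the embedding of L_i in L_j: it sends g_i to a generator
    of the submodule of length [ln i]. *)
Definition mono_mod M := forall i j (x : M), ok i j (ln j - ln i) ->
  (ln i <= ln j)%N -> e i *: x = x -> F i j (ln j - ln i) *: x = 0 -> x = 0.

Lemma std_mono i : mono_mod (std i).
Proof.
move=> p q x pq lpq ex Fx; have [c xc] := std_elem ex.
have [sp|/mor_adm F0] := boolP (ok (soc i) p (ln p).-1); last first.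
  by apply: submod_inj; rewrite xc F0 scaler0.
move: Fx => /(congr1 val) /=; rewrite xc /GRing.scale /= -scalerAr morM //.
have -> : ((ln p).-1 + (ln q - ln p) = (ln q).-1)%N by have := len_gt0 B p; lia.
have sq : ok (soc i) q (ln q).-1.
  have := adm_trans sp pq; congr is_true; congr (ok _ _ _).
  by have := len_gt0 B p; lia.
move/eqP; rewrite scaler_eq0; case/orP => /eqP; last first.
  by move/(mor_neq0 sq); case; have := len_gt0 B q; lia.
by move=> c0; apply: submod_inj; rewrite xc c0 scale0r.
Qed.

Lemma std_map_subproof i (x : proj i) :
  (val x * soc_incl i : E^o) \in cyc (soc_incl i : E^o).
Proof. exact: mem_cyc. Qed.

Lemma std_map_linear i :
  linear (fun x : proj i => to_submod (std_map_subproof x) : std i).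
Proof. by move=> a x y; apply: submod_inj; rewrite /= mulrDl /GRing.scale /= mulrA. Qed.

Definition std_map i : {linear proj i -> std i} := pack_linear (@std_map_linear i).

Lemma std_mapE i x : val (std_map i x) = val x * soc_incl i :> E.
Proof. by []. Qed.

Lemma std_map_surj i y : exists x, std_map i x = y.
Proof.
have /in_cyc[a ya] := valP y; exists (a *: cyc_gen (e i : E^o)).
apply: submod_inj; rewrite ya std_mapE /= /GRing.scale /= -mulrA.
by congr (a * _); apply: mul_idem_mor.
Qed.

Lemma std_kernel_min i (V : submodClosed (proj i)) :
  factors_le S lt i (quotmod V) -> {subset kernel_sub (std_map i) <= V}.
Proof.
move=> /factors_leP Vi x /in_kernel_sub /(congr1 val); rewrite std_mapE => aw.
set a := val x : E in aw; set g : proj i := cyc_gen (e i : E^o).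
have gV j b : ok i j b -> (b < ln j)%N -> (ln j < ln i + b)%N -> F i j b *: g \in V.
  move=> ij bj lij; have [|q [dq lq]] := @objP _ _ _ _ _ _ B (dg i) (ln j - b).
    by have := len_le B j; lia.
  have /admP[dij _] := ij.
  have iq : ok i q 0 by apply/admP; rewrite dq mulr0n addr0; split=> //; lia.
  have qj : ok q j b by apply/admP; rewrite dq; split=> //; lia.
  rewrite -(add0n b) -(mor_mor _ iq qj); apply: rpredZ; apply/quot_pi0.
  apply: contrapT => nz; have [] := Vi q _ _ nz; rewrite ?lq; last by lia.
    by rewrite -linearZ idem_mor.
  by move=> eqi; rewrite -eqi lq in lij; lia.
rewrite [x]proj_gen -/a -/g (morE B a) scaler_suml rpred_sum // => p _.
rewrite scaler_suml rpred_sum // => q _; rewrite scaler_suml rpred_sum // => b _.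
rewrite scalekA; have [epi|/eqP npi] := eqVneq p i; last first.
  by rewrite (idem_fixed_mor q b (idem_cyc_gen i)) ?scaler0 ?rpred0 // => /esym.
rewrite epi; have [->|/eqP c0] := eqVneq (co i q b a : k) 0;
  first by rewrite scalek0 rpred0.
have [ij bj] := coef_adm c0; apply: rpredZ; apply: gV => //.
(* An injective monomial survives restriction to the socle of L_i, so its coefficient in [a] can be
   read off [a * soc_incl i], which is 0. *)
rewrite ltnNge; apply/negP => lij; apply: c0.
rewrite -(coef_mulR a (soc_adm i)); last by have := len_gt0 B i; lia.
by rewrite -/(soc_incl i) [a * _]aw linear0.
Qed.

Lemma std_factors i : factors_le S lt i (std i).
Proof.
apply/factors_leP => j x ex x0; have [a xa] := @cyc_generates _ _ (soc_incl i : E^o) x.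
have ew : e i *: (soc_incl i : E^o) = soc_incl i by apply: mul_idem_mor.
have ea : e j *: (a *: (soc_incl i : E^o)) <> 0.
  by move=> h; apply: x0; apply: submod_inj; rewrite -ex xa /= -[RHS]h.
have [b [ij bj nz]] := act_neq0 ew ea.
have := mor_soc_eq ij nz; have /admP[dij _] := ij => -[eb lij].
have [lt_ij|le_ji] := ltnP (ln i) (ln j); [by right | left].
apply: (@obj_inj _ _ _ _ _ _ B); last by lia.
by rewrite dij eb (eqP (_ : ln j - ln i == 0)%N) ?mulr0n ?addr0 // subn_eq0.
Qed.

Lemma std_isom i : isom (quotmod (kernel_sub (std_map i))) (std i).
Proof.
by apply: (quot_isom (@std_map_surj i)) => x; rewrite in_kernel_sub.
Qed.

Lemma std_standard i : is_standard S lt i (std i).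
Proof.
exists (proj i), (kernel_sub (std_map i)); split; first exact: proj_cover.
- exact: (@factors_le_isom i _ _ (isom_sym (std_isom i)) (@std_factors i)).
- exact: std_kernel_min.
- exact: std_isom.
Qed.

Lemma standard_isom i M N : isom M N -> is_standard S lt i M -> is_standard S lt i N.
Proof.
move=> iMN [P [U [h1 h2 h3 h4]]]; exists P, U; split=> //; exact: isom_trans iMN.
Qed.

Lemma standard_std i M : is_standard S lt i M -> isom (std i) M.
Proof.
move=> [P [U [cP leU minU iU]]].
have [f [g [fK gK]]] :=
  isom_can (projective_cover_unique (simple_at_fg (Ssimple i)) cP (proj_cover i)).
have fS y : exists x, f x = y by exists (g y).
have gS y : exists x, g x = y by exists (f y).
have iK : isom (quotmod (preimage_sub f (kernel_sub (std_map i)))) (std i).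
  apply: isom_trans (std_isom i); apply: (quot_map_isom fS) => x.
  exact: in_preimage_sub.
have UK : {subset U <= preimage_sub f (kernel_sub (std_map i))}.
  apply: minU; exact: (@factors_le_isom i _ _ (isom_sym iK) (@std_factors i)).
have KU : {subset kernel_sub (std_map i) <= preimage_sub g U}.
  apply: std_kernel_min; apply: (@factors_le_isom i (quotmod U)) => //; apply: isom_sym.
  by apply: (quot_map_isom gS) => x; apply: in_preimage_sub.
apply: isom_trans iU; apply: isom_sym; apply: isom_trans iK.
apply: (@quot_map_isom _ _ _ (idfun : {linear P -> P})) => [x|x]; first by exists x.
split=> [/UK//|/in_preimage_sub/KU/in_preimage_sub]; by rewrite fK.
Qed.

Lemma mono_isom M N : isom M N -> mono_mod M -> mono_mod N.
Proof.
move=> /isom_sym/isom_linear[f [f0 _]] mM i j x ij lij ex Fx; apply: f0.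
by apply: (mM _ _ _ ij lij); rewrite -linearZ ?ex // Fx linear0.
Qed.

Lemma mono_extension M (U : submodClosed M) :
  mono_mod (submod U) -> mono_mod (quotmod U) -> mono_mod M.
Proof.
move=> mU mQ i j x ij lij ex Fx.
have /quot_pi0 xU : quot_pi U x = 0.
  by apply: (mQ _ _ _ ij lij); rewrite -linearZ ?ex // Fx linear0.
have /(congr1 val) : to_submod xU = 0; last exact.
by apply: (mU _ _ _ ij lij); apply: submod_inj.
Qed.

Lemma filtered_mono M :
  filtered (fun D => exists i, is_standard S lt i D) M -> mono_mod M.
Proof.
elim=> {M} [M M0|M U _ mU [i /standard_std iU]]; first by move=> i j x _ _ _ _; apply: M0.
apply: (mono_extension mU); apply: (mono_isom iU); exact: std_mono.
Qed.

End Standard.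

(** * Costandard modules *)

Section Dual.
Variables (k : fieldType) (E : algType k).

Definition dual : Type := Defs.hom (E : lmodType k) (k^o : lmodType k).
HB.instance Definition _ := GRing.Zmodule.on dual.

Definition dual_of (f : {linear E -> k^o}) : dual := f.
Definition ev (f : dual) (h : E) : k := (f : {linear E -> k^o}) h.

Lemma dualP (f g : dual) : (forall a, ev f a = ev g a) -> f = g.
Proof. by move=> h; apply: homP. Qed.

Lemma ev_of f h : ev (dual_of f) h = f h.
Proof. by []. Qed.

Lemma ev_linear (f : dual) : linear (ev f : E -> k^o).
Proof. exact: (linearP (f : {linear E -> k^o})). Qed.

Lemma ev0r (f : dual) : ev f 0 = 0.
Proof. exact: (linear0 (f : {linear E -> k^o})). Qed.

Lemma evDr (f : dual) g h : ev f (g + h) = ev f g + ev f h.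
Proof. exact: (linearD (f : {linear E -> k^o})). Qed.

Lemma evZr (f : dual) c h : ev f (c *: h) = c * ev f h.
Proof. by have := linearZZ (f : {linear E -> k^o}) c h. Qed.

Lemma ev0l h : ev 0 h = 0.
Proof. by []. Qed.

Lemma evDl (f g : dual) a : ev (f + g) a = ev f a + ev g a.
Proof. by []. Qed.

Lemma dual_scale_linear (a : E) (f : dual) : linear (fun h => ev f (h * a) : k^o).
Proof. by move=> c x y; rewrite mulrDl -scalerAl ev_linear. Qed.

Definition dual_scale (a : E) (f : dual) : dual :=
  dual_of (pack_linear (dual_scale_linear a f)).

Lemma dual_scaleA a b f : dual_scale a (dual_scale b f) = dual_scale (a * b) f.
Proof. by apply: dualP => h; rewrite /ev /= -mulrA. Qed.
Lemma dual_scale1 : left_id 1 dual_scale.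
Proof. by move=> f; apply: dualP => h; rewrite /ev /= mulr1. Qed.
Lemma dual_scaleDr : right_distributive dual_scale +%R.
Proof. by move=> a f g; apply: dualP. Qed.
Lemma dual_scaleDl f : {morph dual_scale^~ f : a b / a + b}.
Proof.
by move=> a b; apply: dualP => h; rewrite evDl !ev_of /= mulrDr evDr.
Qed.

HB.instance Definition _ := GRing.Zmodule_isLmodule.Build E dual
  dual_scaleA dual_scale1 dual_scaleDr dual_scaleDl.

Lemma evZl a (f : dual) h : ev (a *: f) h = ev f (h * a).
Proof. by []. Qed.

Lemma evZk (c : k) (f : dual) h : ev ((c%:A : E) *: f) h = c * ev f h.
Proof. by rewrite evZl mulr_algr evZr. Qed.

End Dual.

Arguments ev : simpl never.

Section Costandard.
Variables (k : fieldType) (E : algType k) (I : finType) (G : zmodType) (u : G).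
Variables (m : nat) (B : uniserial_basis E I u m).
Implicit Types (i j p q : I) (b c : nat) (a h : E) (M N S : lmodType E).

Local Notation F := (mor B).
Local Notation co := (coef B).
Local Notation ok := (adm B).
Local Notation ln := (len B).
Local Notation dg := (deg B).
Local Notation e := (idem B).
Local Notation chi := (chi B).

Lemma dual_eq (f g : dual E) :
  (forall i j b, ok i j b -> (b < ln j)%N -> ev f (F i j b) = ev g (F i j b)) -> f = g.
Proof. by move=> fg; apply: dualP; apply: (functional_eq (B := B) fg). Qed.

Definition inj_sub i : submodClosed (dual E).
Proof.
refine (@sub_of E (dual E) (fun f => forall h, ev f (e i * h) = ev f h) _ _ _).
- by [].
- by move=> f g fi gi h; rewrite !evDl fi gi.
- by move=> a f fi h; rewrite !evZl -mulrA fi.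
Defined.

Lemma in_inj_sub i f : f \in inj_sub i <-> forall h, ev f (e i * h) = ev f h.
Proof. exact: in_sub_of. Qed.

(* The indecomposable injective Q_i is the dual of the right ideal e_i E. *)
Definition inj i : lmodType E := submod (inj_sub i).

Lemma inj_mor0 i (f : dual E) p q b : f \in inj_sub i -> q <> i -> ev f (F p q b) = 0.
Proof.
move=> /in_inj_sub fi qi; rewrite -fi /idem morM0 //.
exact: ev0r.
Qed.

Lemma inj_fg i : finitely_generated (inj i).
Proof.
have gP (x : I * 'I_m) : dual_of (co x.1 i x.2) \in inj_sub i.
  by apply/in_inj_sub => h; apply: (etrans (coef_idemL B _ _ _ _ _)); rewrite eqxx.
apply: (fin_generated_by (g := fun x => to_submod (gP x) : inj i)) => f.
exists (fun x : I * 'I_m => (ev (val f) (F x.1 i x.2) : k)%:A); apply: submod_inj.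
have sumE h : ev (val (\sum_(x : I * 'I_m)
      (ev (val f) (F x.1 i x.2))%:A *: (to_submod (gP x) : inj i))) h =
    \sum_(x : I * 'I_m) ev (val f) (F x.1 i x.2) * (co x.1 i x.2 h : k).
  rewrite (big_morph (fun g : inj i => ev (val g) h) (id1 := 0) (op1 := +%R)) //.
  by apply: eq_bigr => x _; apply: evZk.
apply: dual_eq => p q b pq bq; rewrite sumE.
have [eqi|/eqP nqi] := eqVneq q i; last first.
  rewrite (inj_mor0 _ _ (valP f) nqi) big1 // => -[j c] _ /=.
  rewrite coef_mor //.
  by case: and3P => [[_ /eqP ? _]|]; [case: nqi | rewrite mulr0].
subst q; have bm : (b < m)%N by apply: leq_trans bq (len_le B i).
rewrite (bigD1 (p, Ordinal bm)) //= big1 => [|[j c] ne].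
  by rewrite addr0 coef_mor1 // mulr1.
rewrite coef_mor //.
case: and3P => [[/eqP jp _ /eqP cb]|]; last by rewrite mulr0.
by case/eqP: ne; congr pair => //; apply: val_inj.
Qed.

(** Evaluation at 1 identifies the E-linear maps from M to Q_i with the functionals on e_i M, so
    injectivity is the extension of functionals over a field. *)
Lemma inj_injective i : is_injective (inj i).
Proof.
move=> M N f g _ _ fI.
have gL : linear (fun x : restrict_scalars M => ev (val (g x)) 1 : k^o).
  move=> c x y; rewrite [g _](linearP g).
  exact: (congr1 (+%R^~ _) (evZk c _ _)).
have fL : linear (f : restrict_scalars M -> restrict_scalars N).
  by move=> c x y; apply: (linearP f).
have [w wf] := extend_functional (f := pack_linear fL) (pack_linear gL) fI.
have wL (y : N) : linear (fun h : E => w (e i *: (h *: y) : N) : k^o).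
  move=> c h h'; rewrite scalerDl scalerDr scalekA scalekC.
  exact: (linearP w).
have wP y : dual_of (pack_linear (wL y)) \in inj_sub i.
  by apply/in_inj_sub => h; rewrite /ev /= -scalerA idem_idem.
have hL : linear (fun y => to_submod (wP y) : inj i).
  move=> a y z; apply: submod_inj; apply: dualP => h /=.
  rewrite evDl evZl /ev /= -linearD; congr (w _).
  by rewrite !scalerDr !scalerA mulrA.
exists (pack_linear hL) => x; apply: submod_inj; apply: dualP => h.
rewrite /= {1}/ev /= -!linearZ /= [LHS](wf (e i *: (h *: x))) /=.
rewrite !linearZ /= !evZl mul1r.
by have /in_inj_sub := valP (g x).
Qed.

Variables (S : I -> lmodType E) (lt : I -> I -> Prop).
Hypothesis Ssimple : forall i, simple_at B i (S i).
Hypothesis ltP : forall i j, lt i j <-> (ln j < ln i)%N.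

Lemma inj_socle i (f : dual E) : f \in inj_sub i -> f <> 0 ->
  exists j b (c : k), c <> 0 /\ F j i b *: f = (c%:A : E) *: dual_of (chi i).
Proof.
move=> fi f0.
have [j [b fjb]] : exists j b, ev f (F j i b) != 0.
  apply: contrapT => h; apply: f0; apply: dual_eq => p q b _ _; rewrite ev0l.
  have [eqi|/eqP/(inj_mor0 _ _ fi)//] := eqVneq q i; subst q.
  apply/eqP; apply: contrapT => nz; apply: h; exists p, b; exact/negP.
(* With [c] maximal, [F j i c *: f] vanishes on [F i i b'] for positive [b'], because its value
   there is that of [f] at exponent [c + b']. Only a multiple of [chi i] is left. *)
have [|c fc cmax] := @ex_maxnP (fun b => ev f (F j i b) != 0) m (ex_intro _ b fjb).
  move=> c; apply: contraNT; rewrite -ltnNge => mc.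
  by rewrite mor_len ?ev0r //; have := len_le B i; lia.
have ji : ok j i c by apply: contraNT fc => /mor_adm ->; rewrite ev0r.
exists j, c, (ev f (F j i c)); split; first exact/eqP.
apply: dual_eq => p q b' pq bq; rewrite evZl evZk.
rewrite ev_of coef_mor //.
have [<-|/eqP nip] := eqVneq i p; last first.
  by rewrite morM0 // ev0r mulr0.
have [eiq|/eqP niq] := eqVneq i q; last first.
  have [ip|/mor_adm ->] := boolP (ok i q b'); last by rewrite mul0r ev0r mulr0.
  by rewrite morM // (inj_mor0 _ _ fi) ?mulr0 // => /esym.
subst q; have [ip|/mor_adm F0] := boolP (ok i i b'); last first.
  by case: eqP F0 => [<- /(mor_neq0 (adm_refl B i) (len_gt0 B i))|_ ->] //;
    rewrite mul0r ev0r mulr0.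
rewrite morM //; have [<-|nb] := eqVneq 0%N b'; first by rewrite addn0 mulr1.
rewrite mulr0; apply/eqP; apply: contraTT isT => nz.
by have := cmax _ nz; lia.
Qed.

Lemma inj_envelope i : is_injective_envelope (S i) (inj i).
Proof.
split; first exact: inj_fg.
split; first exact: inj_injective.
have chP : dual_of (chi i) \in inj_sub i.
  apply/in_inj_sub => h; rewrite -[LHS]/(chi i (e i * h)) chiM chi_idem mul1r.
  by [].
have [s [s0 sS sE]] := Ssimple i.
have ch a : a *: (to_submod chP : inj i) = (chi i a : k)%:A *: (to_submod chP : inj i).
  apply: submod_inj; apply: dualP => h; rewrite /= evZk evZl.
  by rewrite mulrC; apply: chiM.
have [f fs] := simple_at_map sS sE s0 ch.
exists f; split=> [|U fU x xU].
  apply: linear_eq0_inj => y; have [c ->] := sS y; rewrite linearZ /= fs.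
  move/(congr1 val)/(congr1 (fun f : dual E => ev f (e i))) => /=.
  rewrite evZk ev_of chi_idem mulr1 ev0l => ->.
  exact: scalek0.
apply: contrapT => x0.
have [|j [b [c [c0 ec]]]] := inj_socle (valP x); first by move=> h; apply: x0;
  apply: submod_inj.
apply: s0; apply: fU; rewrite fs.
have <- : c^-1%:A *: (F j i b *: x) = to_submod chP.
  apply: submod_inj => /=; rewrite ec scalekK //; exact/eqP.
by rewrite !rpredZ.
Qed.

(* The simple object which is the top of the i-th one. *)
Definition top i : I := sval (cid (@objP _ _ _ _ _ _ B (dg i) 1 (m_gt0 B i))).

Lemma topP i : dg (top i) = dg i /\ ln (top i) = 1%N.
Proof. by rewrite /top; case: cid. Qed.

Definition top_proj i : E := F i (top i) 0.

Lemma top_adm i : ok i (top i) 0.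
Proof. by apply/admP; have [-> ->] := topP i; rewrite mulr0n addr0 len_gt0. Qed.

(* The functionals that vanish on the non-surjective maps to L_i. *)
Definition costd_sub i : submodClosed (dual E).
Proof.
refine (@sub_of E (dual E) (fun f => forall h, top_proj i * h = 0 -> ev f h = 0) _ _ _).
- by [].
- by move=> f g fi gi h h0; rewrite evDl fi // gi // addr0.
- by move=> a f fi h h0; rewrite evZl fi // mulrA h0 mul0r.
Defined.

Definition costd i : lmodType E := submod (costd_sub i).

Lemma in_costd_sub i f : f \in costd_sub i <->
  forall p q b, ok p q b -> (b < ln q)%N -> ~ (q = i /\ b = 0%N) -> ev f (F p q b) = 0.
Proof.
split=> [/in_sub_of fi p q b pq bq nqb|fi].
  apply: fi; rewrite /top_proj; have [eqi|/eqP nqi] := eqVneq q i; last by rewrite morM0.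
  subst q; rewrite morM ?top_adm // addn0 mor_len //.
  by have [_ ->] := topP i; case: b nqb {pq bq} => // h; case: h.
apply/in_sub_of => h h0.
have fE h' : ev f h' = \sum_j (co j i 0 h' : k) * ev f (F j i 0).
  move: h'; apply: (mor_ind (B := B)) => [|x y ex ey|c x ex|p q b pq bq].
  - by rewrite ev0r big1 // => j _; rewrite linear0 mul0r.
  - rewrite evDr ex ey -big_split; apply: eq_bigr => j _.
    by rewrite linearD mulrDl.
  - rewrite evZr ex mulr_sumr; apply: eq_bigr => j _.
    by rewrite linearZ /= mulrA.
  have [[eqi b0]|nqb] := EM (q = i /\ b = 0%N).
    subst q b; rewrite (bigD1 p) //= coef_mor1 // mul1r big1 ?addr0 // => j jp.
    by rewrite coef_mor // (negPf jp) mul0r.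
  rewrite fi // big1 // => j _; rewrite coef_mor //.
  by case: and3P => [[_ /eqP ? /eqP ?]|]; [case: nqb | rewrite mul0r].
rewrite fE big1 // => j _.
have <- : co j (top i) 0 (top_proj i * h) = co j i 0 h.
  by rewrite -[0%N in LHS](addn0 0) coef_mulL ?top_adm //; have [_ ->] := topP i.
by rewrite h0 linear0 mul0r.
Qed.

Lemma costd_factors i : factors_le S lt i (costd i).
Proof.
apply/(factors_leP Ssimple ltP) => j x ex x0.
have fx h : ev (val x) h = ev (val x) (h * e j) by rewrite -{1}ex.
have [[ji lij]|nji] := EM (ok j i 0 /\ (ln i <= ln j)%N).
  have [lt_ij|le_ji] := ltnP (ln i) (ln j); [by right | left].
  have /admP[dji _] := ji.
  by apply: (@obj_inj _ _ _ _ _ _ B); [rewrite dji mulr0n addr0 | lia].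
case: x0; apply: submod_inj; apply: dual_eq => p q b pq bq; rewrite ev0l fx.
have [epj|/eqP npj] := eqVneq p j; last by rewrite mul_mor_idem0 // ev0r.
have /in_costd_sub fi := valP x.
subst p; rewrite mul_mor_idem fi // => -[? ?]; subst q b; apply: nji.
by split=> //; have /admP[] := pq.
Qed.

Lemma costd_inj i : {subset costd_sub i <= inj_sub i}.
Proof.
move=> f /in_sub_of fi; apply/in_inj_sub => h; apply/eqP; rewrite -subr_eq0; apply/eqP.
rewrite -mulN1r -evZr -evDr; apply: fi.
by rewrite scaleN1r mulrBr mulrA mul_mor_idem subrr.
Qed.

Definition costd_inj_sub i : submodClosed (inj i) :=
  preimage_sub (submod_val (inj_sub i)) (costd_sub i).

Lemma costd_max i (V : submodClosed (inj i)) : factors_le S lt i (submod V) ->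
  {subset V <= costd_inj_sub i}.
Proof.
move=> /(factors_leP Ssimple ltP) Vi x xV; apply/in_preimage_sub/in_costd_sub.
move=> j q b jq bq nqb; have xi := valP x.
have [eqi|/eqP nqi] := eqVneq q i; last by rewrite (inj_mor0 _ _ xi).
subst q; have b0 : (0 < b)%N by case: b nqb {jq bq} => // h; case: h.
have [|q [dq lq]] := @objP _ _ _ _ _ _ B (dg j) (ln i - b).
  by have := len_le B i; lia.
have /admP[dji lji] := jq.
have jo : ok j q 0 by apply/admP; rewrite dq mulr0n addr0; split=> //; lia.
have qi : ok q i b by apply/admP; rewrite dq; split=> //; lia.
have yV : F j q 0 *: x \in V by apply: rpredZ.
have y0 : F j q 0 *: x = 0.
  apply: contrapT => nz; have [] := Vi q (to_submod yV).
  - by apply: submod_inj => /=; rewrite idem_mor.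
  - by move/(congr1 val).
  - by move=> eqi; move: lq; rewrite eqi; lia.
  - by rewrite lq; lia.
have /(congr1 (fun y : inj i => ev (val y) (F q i b))) /= := y0.
by rewrite evZl morM // add0n.
Qed.

Lemma costd_isom i : isom (submod (costd_inj_sub i)) (costd i).
Proof.
exact: (sub_sub_isom (@costd_inj i)).
Qed.

Lemma costd_costandard i : is_costandard S lt i (costd i).
Proof.
exists (inj i), (costd_inj_sub i); split; first exact: inj_envelope.
- exact: (factors_le_isom Ssimple ltP (isom_sym (costd_isom i)) (@costd_factors i)).
- exact: costd_max.
- exact: costd_isom.
Qed.

Lemma costandard_isom i M N : isom M N -> is_costandard S lt i M -> is_costandard S
  lt i N.
Proof.
move=> iMN [P [U [h1 h2 h3 h4]]]; exists P, U; split=> //; exact: isom_trans iMN.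
Qed.

Lemma costandard_costd i M : is_costandard S lt i M -> isom (costd i) M.
Proof.
move=> [Q [U [cQ leU maxU iU]]].
have [f [g [fK gK]]] :=
  isom_can (injective_envelope_unique (simple_at_fg (Ssimple i)) cQ (inj_envelope i)).
have fS y : exists x, f x = y by exists (g y).
have gS y : exists x, g x = y by exists (f y).
have f0 x : f x = 0 -> x = 0 by move=> h; rewrite -(fK x) h linear0.
have g0 x : g x = 0 -> x = 0 by move=> h; rewrite -(gK x) h linear0.
have iK : isom (submod (preimage_sub f (costd_inj_sub i))) (costd i).
  apply: isom_trans (costd_isom i); apply: (sub_isom f0 fS) => x.
  exact: in_preimage_sub.
have KU : {subset preimage_sub f (costd_inj_sub i) <= U}.
  apply: maxU; exact: (factors_le_isom Ssimple ltP (isom_sym iK) (@costd_factors i)).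
have UK : {subset preimage_sub g U <= costd_inj_sub i}.
  apply: costd_max; apply: (factors_le_isom Ssimple ltP _ leU); apply: isom_sym.
  by apply: (sub_isom g0 gS) => x; apply: in_preimage_sub.
apply: isom_trans iU; apply: isom_sym; apply: isom_trans iK.
apply: (@sub_isom _ _ _ (idfun : {linear Q -> Q})) => [x|x|x] //; first by exists x.
split=> [xU|/KU//]; apply/in_preimage_sub/UK/in_preimage_sub.
by rewrite fK.
Qed.

(** The maps of exponent 0 send generator to generator: they are the surjections between the L_i. *)
Definition epi_mod M := forall i j (y : M), ok i j 0 -> e j *: y = y ->
  exists x, F i j 0 *: x = y.

Lemma costd_epi i : epi_mod (costd i).
Proof.
move=> p q y pq ey.
have fy h : ev (val y) h = ev (val y) (h * e q) by rewrite -{1}ey.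
(* In the costandard module a vector fixed by [e q] is determined by its value at [F q i 0]; the
   preimage is the same multiple of the functional dual to [F p i 0]. *)
pose c : k := ev (val y) (F q i 0).
have xP : (c%:A : E) *: dual_of (co p i 0) \in costd_sub i.
  apply: rpredZ; apply/in_costd_sub => p' q' b pq' bq nqb.
  rewrite -[LHS]/(co p i 0 (F p' q' b)) coef_mor //.
  by case: and3P => [[_ /eqP ? /eqP ?]|] //; case: nqb.
exists (to_submod xP); apply: submod_inj; apply: dual_eq => p' q' b pq' bq /=.
rewrite evZl evZk ev_of.
rewrite (coef_mulR (b := 0) (c := 0) _ pq (len_gt0 B i)) coef_mor // fy.
have [eqp|/eqP nqp] := eqVneq q p'; last first.
  by rewrite mulr0 mul_mor_idem0 ?ev0r // => /esym.
subst p'; rewrite mul_mor_idem; have /in_costd_sub yi := valP y.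
have [[eqi b0]|nqb] := EM (q' = i /\ b = 0%N); first by subst q' b; rewrite !eqxx mulr1.
rewrite yi //; case: and3P => [[_ /eqP eqi /eqP b0]|_]; last by rewrite mulr0.
by case: nqb.
Qed.

Lemma epi_isom M N : isom M N -> epi_mod M -> epi_mod N.
Proof.
move=> /isom_can[f [g [fK gK]]] eM i j y ij ey.
have [|x xg] := eM i j (g y) ij; first by rewrite -linearZ ey.
by exists (f x); rewrite -linearZ /= xg gK.
Qed.

Lemma epi_extension M (U : submodClosed M) :
  epi_mod (submod U) -> epi_mod (quotmod U) -> epi_mod M.
Proof.
move=> eU eQ i j y ij ey.
have [|z zy] := eQ i j (quot_pi U y) ij; first by rewrite -linearZ ey.
have [x xz] := quot_pi_surj z.
have yU : y - F i j 0 *: x \in U.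
  by apply/quot_pi0; rewrite linearB -zy -xz -linearZ subrr.
have [|w /(congr1 val) /= wy] := eU i j (to_submod yU) ij.
  by apply: submod_inj; rewrite /= scalerBr ey idem_mor.
by exists (val w + x); rewrite scalerDr wy subrK.
Qed.

Lemma filtered_epi M :
  filtered (fun D => exists i, is_costandard S lt i D) M -> epi_mod M.
Proof.
elim=> {M} [M M0|M U _ mU [i /costandard_costd iU]].
  by move=> i j y _ _; exists 0; rewrite (M0 y) scaler0.
apply: (epi_extension mU); apply: (epi_isom iU); exact: costd_epi.
Qed.

End Costandard.

(** * Tilting modules *)

Section Tilting.
Variables (k : fieldType) (E : algType k) (I : finType) (G : zmodType) (u : G).
Variables (m : nat) (B : uniserial_basis E I u m).
Implicit Types (i j p q : I) (b c : nat) (a h : E) (M N S : lmodType E).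

Local Notation F := (mor B).
Local Notation co := (coef B).
Local Notation ok := (adm B).
Local Notation ln := (len B).
Local Notation dg := (deg B).
Local Notation e := (idem B).
Local Notation chi := (chi B).

Lemma adm_factor i j q b c : ok i j b -> dg i = dg q + u *+ c -> (c <= b)%N ->
  (ln j <= b - c + ln q)%N -> ok q j (b - c).
Proof.
move=> /admP[d1 _] d2 cb lj; apply/admP; split=> //.
by apply: (addIr (u *+ c)); rewrite -d2 d1 -addrA -mulrnDr subnK.
Qed.

(** The image of [F i q b] is t^b L_q, which depends only on [q] and [b] and shrinks as [b] grows;
    what kills the larger image kills the smaller one. *)
Lemma ann_le i i' q b c a : ok i q b -> ok i' q c -> (b <= c)%N ->
  a * F i q b = 0 -> a * F i' q c = 0.
Proof.
move=> iq iq' bc a0; apply: (coef_eq (B := B)) => p j d; rewrite linear0.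
have [eip|/eqP nip] := eqVneq i' p; last first.
  by rewrite -(mul_mor_idem B i') mulrA coef_idemR; case: eqP.
subst p; have [dc|cd] := ltnP d c; first exact: coef_mulR0.
have [jd|dj] := leqP (ln j) d.
  by apply: contrapT => /coef_adm[_]; rewrite ltnNge jd.
rewrite -(subnK cd) coef_mulR ?subnK // -(coef_mulR a iq); last by lia.
by rewrite a0 linear0.
Qed.

Lemma coef_build (g : I -> I -> nat -> k) :
  (forall i j b, g i j b <> 0 -> ok i j b /\ (b < ln j)%N) ->
  exists a, forall i j b, co i j b a = g i j b.
Proof.
move=> gP; exists (\sum_p \sum_q \sum_(c < m) g p q c *: F p q c) => i j b.
have h p q c : co i j b (g p q c *: F p q c) =
    if [&& i == p, j == q & b == c] then g i j b else 0.
  rewrite linearZ /=; have [gc|/eqP gc] := eqVneq (g p q c) 0.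
    rewrite gc scale0r; case: and3P => // -[/eqP ? /eqP ? /eqP ?]; subst p q c.
    by rewrite gc.
  have [pq cq] := gP _ _ _ gc; rewrite coef_mor // /GRing.scale /=.
  case: and3P => [[/eqP ? /eqP ? /eqP ?]|_]; last by rewrite mulr0.
  by subst p q c; rewrite mulr1.
rewrite linear_sum (bigD1 i) //= [X in _ + X]big1 ?addr0 => [|p pi]; last first.
  rewrite linear_sum big1 // => q _; rewrite linear_sum big1 // => c _.
  by rewrite h eq_sym (negPf pi).
rewrite linear_sum (bigD1 j) //= [X in _ + X]big1 ?addr0 => [|q qj]; last first.
  rewrite linear_sum big1 // => c _.
  by rewrite h [j == q]eq_sym (negPf qj) andbF.
rewrite linear_sum; have [bm|mb] := ltnP b m.
  rewrite (bigD1 (Ordinal bm)) //= h !eqxx /= big1 ?addr0 // => c cb.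
  rewrite h !eqxx /=; case: eqP => // bc; case/eqP: cb; exact: val_inj.
rewrite big1 => [|c _]; last by rewrite h; case: and3P => // -[_ _ /eqP bc];
  have := ltn_ord c; lia.
apply: contrapT => ne; have [|_] := gP i j b; last by have := len_le B j; lia.
by move=> g0; apply: ne.
Qed.

(** The objects of length [m] are the indecomposable projectives. The degree is chosen so that t^(m
    - ln i) takes the generator of the hull to that of the submodule L_i. *)
Definition hull i : I :=
  sval (cid (@objP _ _ _ _ _ _ B (dg i - u *+ (m - ln i)) m (introT andP (conj (m_gt0
    B i) (leqnn m))))).

Lemma hullP i : dg i = dg (hull i) + u *+ (m - ln i) /\ ln (hull i) = m.
Proof. by rewrite /hull; case: cid => j [/= -> ->]; rewrite subrK. Qed.

(* The embedding of L_i in its injective hull. Projectives being injective, the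
   maps that factor through it are those that factor through a projective. *)
Definition hull_incl i : E := F i (hull i) (m - ln i).

Lemma hull_adm i : ok i (hull i) (m - ln i).
Proof.
by apply/admP; have [{1}-> ->] := hullP i; split=> //; have := len_le B i; lia.
Qed.

Definition tilt i : lmodType E := submod (cyc (hull_incl i : E^o)).
Definition tilt_gen i : tilt i := cyc_gen (hull_incl i : E^o).

Lemma tilt_ann i a : a *: tilt_gen i = 0 <-> a * hull_incl i = 0.
Proof. by split=> [/(congr1 val)|h]; last exact: submod_inj. Qed.

Lemma tilt_generates i : generates (tilt_gen i).
Proof. exact: cyc_generates. Qed.

Lemma idem_tilt_gen i : e (hull i) *: tilt_gen i = tilt_gen i.
Proof. by apply: submod_inj; apply: mul_idem_mor. Qed.

(** * Filtrations and socles of the modules T(i) *)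

Section Filtrations.
Variables (S : I -> lmodType E) (lt : I -> I -> Prop).
Hypothesis Ssimple : forall i, simple_at B i (S i).
Hypothesis ltP : forall i j, lt i j <-> (ln j < ln i)%N.

Lemma gen_zero M (x : M) : generates x -> (forall a, a *: x = 0) -> is_zero_module M.
Proof. by move=> xM h y; have [a ->] := xM y. Qed.

Lemma idem_gen i q b M (x : M) : (forall a, a *: x = 0 <-> a * F i q b = 0) ->
  e q *: x = x.
Proof.
move=> ann; apply/eqP; rewrite -subr_eq0 -{2}[x]scale1r -scalerBl; apply/eqP/ann.
by rewrite mulrBl mul_idem_mor mul1r subrr.
Qed.

Lemma sum_act q M (x : M) (U : submodClosed M) a : e q *: x = x ->
  (forall j c, co q j c a <> 0 -> F q j c *: x \in U) -> a *: x \in U.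
Proof.
move=> ex h; rewrite (morE B a) scaler_suml rpred_sum // => p _.
rewrite scaler_suml rpred_sum // => j _; rewrite scaler_suml rpred_sum // => c _.
rewrite scalekA; have [epq|/eqP npq] := eqVneq q p; last first.
  by rewrite (idem_fixed_mor j c ex npq) scaler0 rpred0.
subst p; have [->|/eqP c0] := eqVneq (co q j c a : k) 0; first by rewrite scalek0 rpred0.
by apply: rpredZ; apply: h.
Qed.

(** The module is given by its annihilator, that of [F i q b], so that the induction can pass to
    submodules. Restriction to the socle of L_q maps it onto Delta_q. The kernel consists of
    non-injective maps, which factor through the quotient L_q' of L_q by its socle, and is of the
    same kind for [F i q' b]. *)
Lemma gen_filtered_std n i q b M (x : M) : ok i q b -> (ln q - b <= n)%N ->
  generates x -> (forall a, a *: x = 0 <-> a * F i q b = 0) ->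
  filtered (fun D => exists i, is_standard S lt i D) M.
Proof.
elim: n i q b M x => [|n IH] i q b M x iq nq xM ann.
  apply: filtered_zero; apply: (gen_zero xM) => a; apply/ann.
  by rewrite mor_len ?mulr0 //; lia.
have [lqb|blq] := leqP (ln q) b.
  apply: filtered_zero; apply: (gen_zero xM) => a; apply/ann.
  by rewrite mor_len ?mulr0.
have ex := idem_gen ann.
have [|f fx] := generates_map (y := cyc_gen (soc_incl B q : E^o)) xM.
  move=> a /ann a0; apply: submod_inj.
  by apply: ann_le a0 => //; [exact: soc_adm | lia].
have fS y : exists z, f z = y.
  by have [a ->] := cyc_generates y; exists (a *: x); rewrite linearZ /= fx.
have kerP a : f (a *: x) = 0 -> forall j c, co q j c a <> 0 -> (ln j < ln q + c)%N.
  rewrite linearZ /= fx => /(congr1 val) /= aw j c ca.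
  rewrite ltnNge; apply/negP => lqc; apply: ca.
  rewrite -(coef_mulR a (soc_adm B q)); last by have := len_gt0 B q; lia.
  by rewrite -/(soc_incl B q) [_ * _]aw linear0.
apply: (filtered_step (U := kernel_sub f)); last first.
  exists q; apply: standard_isom (std_standard Ssimple ltP q).
  by apply/isom_sym/(quot_isom fS) => y; rewrite in_kernel_sub.
(* A simple L_q leaves no [q']; nonzero maps out of it are injective, so the kernel is 0. [sum_act]
   is used with the zero submodule. *)
have [lq1|lq1] := eqVneq (ln q) 1%N.
  apply: filtered_zero => -[y yP]; apply: submod_inj => /=.
  have /in_kernel_sub := yP; have [a ->] := xM y => /kerP ka.
  have [z0 z0D z0Z] : [/\ (0 : M) = 0, forall y z : M, y = 0 -> z = 0 -> y + z = 0 &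
    forall a (y : M), y = 0 -> a *: y = 0].
    by split=> // [y' z -> ->|a' y' ->]; rewrite ?addr0 ?scaler0.
  apply/(in_sub_of z0 z0D z0Z); apply: (sum_act ex) => j c ca.
  have := ka _ _ ca; have [_] := coef_adm ca; rewrite lq1; lia.
have [|q' [dq lq]] := @objP _ _ _ _ _ _ B (dg q) (ln q).-1.
  by have := len_le B q; have := len_gt0 B q; move/eqP: lq1; lia.
have qq : ok q q' 0 by apply/admP; rewrite dq mulr0n addr0; split=> //; lia.
have yU : F q q' 0 *: x \in kernel_sub f.
  apply/in_kernel_sub; rewrite linearZ /= fx; apply: submod_inj => /=.
  by rewrite /GRing.scale /= /soc_incl morM ?soc_adm // mor_len //; lia.
apply: (IH i q' b _ (to_submod yU)); last 1 first.
- move=> a; have -> : (a * F i q' b = 0) <-> (a * F q q' 0 *: x = 0).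
    by rewrite ann -mulrA morM // addn0.
  by rewrite -scalerA; split=> [/(congr1 val)|h]; last exact: submod_inj.
- by have := adm_trans iq qq; rewrite addn0.
- by lia.
move=> [y yP]; have [a ea] := xM y.
have ka : forall j c, co q j c a <> 0 -> (ln j < ln q + c)%N.
  by apply: kerP; rewrite -ea; apply/in_kernel_sub.
have: a *: x \in cyc (F q q' 0 *: x).
  apply: (sum_act ex) => j c ca; have [qj cj] := coef_adm ca.
  have q'j : ok q' j c.
    have /admP[d _] := qj; apply/admP; rewrite dq; split=> //.
    by have := ka _ _ ca; lia.
  rewrite -[c in F q j c]add0n -(mor_mor _ qq q'j); exact: mem_cyc.
by move/in_cyc => [a' ea']; exists a'; apply: submod_inj; rewrite /= ea.
Qed.

Lemma coef_costd p i : dual_of (co p i 0) \in costd_sub B i.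
Proof.
apply/in_costd_sub => p' q' b pq' bq nqb; rewrite ev_of coef_mor //.
by case: and3P => [[_ /eqP ? /eqP ?]|] //; case: nqb.
Qed.

(** The layers are those of the exponent: maps out of L_p of positive exponent factor through
    [F p p' 1], with [p'] again projective, and form a module of the same kind with [b.+1]. What
    remains is spanned by the surjections [F p j 0] with [b < ln j], which is the costandard module
    of [i']. *)
Lemma gen_filtered_costd n i p b M (x : M) : ok i p b -> ln p = m -> (m - b <= n)%N ->
  generates x -> (forall a, a *: x = 0 <-> a * F i p b = 0) ->
  filtered (fun D => exists i, is_costandard S lt i D) M.
Proof.
elim: n i p b M x => [|n IH] i p b M x ip lp nb xM ann.
  apply: filtered_zero; apply: (gen_zero xM) => a; apply/ann.
  by rewrite mor_len ?mulr0 //; lia.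
have [mb|bm] := leqP m b.
  apply: filtered_zero; apply: (gen_zero xM) => a; apply/ann.
  by rewrite mor_len ?mulr0 // lp.
have ex := idem_gen ann.
(* The length [b.+1] is that of the shortest quotient of L_p on which t^b is nonzero. *)
have [|i' [di li]] := @objP _ _ _ _ _ _ B (dg p) b.+1; first by lia.
have coE h : co p i' 0 h = co i i' b (h * F i p b).
  by rewrite -(coef_mulR (b := 0) h ip) ?add0n // li.
have [|f fx] := generates_map (y := to_submod (coef_costd p i') : costd B i') xM.
  move=> a /ann a0; apply: submod_inj; apply: dualP => h /=.
  by rewrite evZl ev_of coE -mulrA a0 mulr0 linear0.
have fS y : exists z, f z = y.
  (* [F p j 0] takes [f x] to the functional dual to [F j i' 0], and [y] is determined by its values
     at these monomials. *)
  pose a := \sum_j ev (val y) (F j i' 0) *: F p j 0.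
  exists (a *: x); rewrite linearZ /= fx; apply: submod_inj.
  apply: (dual_eq (B := B)) => q j c qj cj /=; rewrite evZl ev_of /a mulr_sumr linear_sum.
  rewrite (bigD1 q) //= big1 => [|q' qq]; last first.
    by have /eqP ne := qq; rewrite -scalerAr morM0 // scaler0 linear0.
  rewrite addr0 -scalerAr linearZ /=.
  have /in_costd_sub yi := valP y.
  have [pq|npq] := boolP (ok p q 0).
    rewrite (coef_mulR (b := 0) (c := 0) _ pq (len_gt0 B i')) coef_mor // eqxx /=.
    have [[ej c0]|nqb] := EM (j = i' /\ c = 0%N).
      by subst j c; rewrite !eqxx /GRing.scale /= mulr1.
    rewrite (yi _ _ _ qj cj nqb); case: andP => [[/eqP ej /eqP c0]|_];
      last by rewrite scaler0.
    by case: nqb.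
  rewrite (mor_adm npq) mulr0 linear0 scaler0 yi // => -[ej c0].
  subst j c; move/negP: npq; apply; have /admP[dq lq] := qj.
  by apply/admP; rewrite dq di !mulr0n !addr0 lp add0n len_le.
have [|p' [dp lp']] := @objP _ _ _ _ _ _ B (dg p - u) m.
  by rewrite leqnn andbT; exact: m_gt0 B p.
have dpp : dg p = dg p' + u *+ 1 by rewrite dp subrK.
have pp : ok p p' 1 by apply/admP; rewrite lp lp'; split=> //; lia.
apply: (filtered_step (U := kernel_sub f)); last first.
  exists i'; apply: costandard_isom (costd_costandard Ssimple ltP i').
  by apply/isom_sym/(quot_isom fS) => y; rewrite in_kernel_sub.
have yU : F p p' 1 *: x \in kernel_sub f.
  apply/in_kernel_sub; rewrite linearZ /= fx; apply: submod_inj; apply: dualP => h /=.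
  by rewrite evZl ev_of coef_mulR0.
apply: (IH i p' b.+1 _ (to_submod yU)) => //; last 1 first.
- move=> a; have -> : (a * F i p' b.+1 = 0) <-> (a * F p p' 1 *: x = 0).
    by rewrite ann -mulrA morM // addn1.
  by rewrite -scalerA; split=> [/(congr1 val)|h]; last exact: submod_inj.
- by have := adm_trans ip pp; rewrite addn1.
- by lia.
move=> [y yP]; have [a ea] := xM y.
have /(congr1 val) /= a0 : a *: f x = 0.
  by rewrite -linearZ -ea; apply/in_kernel_sub.
rewrite fx /= in a0.
have: a *: x \in cyc (F p p' 1 *: x).
  apply: (sum_act ex) => j [|c] ca; have [pj cj] := coef_adm ca; last first.
    have := adm_factor pj dpp; rewrite subn1 /= => /(_ isT) h.
    rewrite -[c.+1]add1n -(mor_mor _ pp) ?mem_cyc //; apply: h.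
    by rewrite lp'; have := len_le B j; lia.
  suff -> : F p j 0 *: x = 0 by rewrite rpred0.
  apply/ann; rewrite morM // addn0 mor_len // leqNgt; apply/negP => bj; apply: ca.
  have ji : ok j i' 0.
    by have /admP[d _] := pj; apply/admP; rewrite di d mulr0n !addr0 li; split.
  have := coef_mulL (b := 0) p a ji (len_gt0 B i'); rewrite addn0 => <-.
  by rewrite -[LHS]evZl a0 ev0l.
by move/in_cyc => [a' ea']; exists a'; apply: submod_inj; rewrite /= ea.
Qed.

(** As an element of [E], the left-hand side is [F i q m.-1], with image the socle of L_q. If
    [F i j c] is a term of [y] of least exponent, then [F j q (m.-1 - c)] moves it there; it raises
    larger exponents to at least [m] and kills terms with other targets. *)
Lemma tilt_socle i q (y : tilt i) : ln q = m -> ok (hull i) q (ln i).-1 ->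
  y <> 0 -> exists a, F (hull i) q (ln i).-1 *: tilt_gen i = a *: y.
Proof.
move=> lq hq y0; pose v : E := val y.
have [j [b vb]] : exists j b, co i j b v != 0.
  apply: contrapT => h; apply: y0; apply: submod_inj.
  apply: (coef_eq (B := B)) => p j b; rewrite [RHS]linear0.
  have [epi|/eqP npi] := eqVneq i p.
    by apply: contrapT => /eqP nz; apply: h; exists j, b; rewrite epi.
  have [a ->] := tilt_generates y; rewrite [val _](_ : _ = a * hull_incl i) //.
  by rewrite /hull_incl -(mul_mor_idem B i) mulrA coef_idemR; case: eqP.
have [c vc cmin] := @ex_minnP (fun b => co i j b v != 0) (ex_intro _ b vb).
have [ij cj] : ok i j c /\ (c < ln j)%N by apply: (coef_adm (a := v)); apply/eqP.
have iq : ok i q m.-1.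
  have := adm_trans (hull_adm i) hq; congr is_true; congr (ok _ _ _).
  by have := len_le B i; have := len_gt0 B i; lia.
have jq : ok j q (m.-1 - c).
  have /admP[d _] := ij; apply: (adm_factor iq d); have := len_le B j; lia.
exists ((co i j c v)^-1 *: F j q (m.-1 - c)); apply: submod_inj.
rewrite [RHS](_ : _ = (co i j c v)^-1 *: (F j q (m.-1 - c) * v)); last first.
  by rewrite scalerAl.
rewrite [LHS](_ : _ = F i q m.-1); last first.
  rewrite [LHS](_ : _ = F (hull i) q (ln i).-1 * hull_incl i) //.
  rewrite morM ?hull_adm //; congr (F _ _ _).
  by have := len_le B i; have := len_gt0 B i; lia.
have m0 := m_gt0 B i.
suff -> : F j q (m.-1 - c) * v = (co i j c v : k) *: F i q m.-1.
  by rewrite scalerA mulVf // scale1r.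
apply: (coef_eq (B := B)) => i' q' d; rewrite linearZ /= coef_mor ?lq //; last by lia.
have [eq'|/eqP nq] := eqVneq q' q; last first.
  by rewrite andbF scaler0 -(mul_idem_mor B j) -mulrA coef_idemL; case: eqP => // /esym.
subst q'; have [ei|/eqP ni] := eqVneq i' i; last first.
  rewrite /= scaler0; have [a ya] := tilt_generates y.
  rewrite /v ya [val _](_ : _ = a * hull_incl i) //.
  by rewrite /hull_incl -(mul_mor_idem B i) !mulrA coef_idemR; case: eqP => // /esym.
subst i'; rewrite /=; have [dc|cd] := ltnP d (m.-1 - c).
  by rewrite coef_mulL0 //; case: eqP; rewrite ?scaler0 //; lia.
have [md|dm] := leqP m d.
  case: eqP => [|_]; first by lia.
  by rewrite scaler0; apply: contrapT => /coef_adm[_]; rewrite lq; lia.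
rewrite -(subnK cd) coef_mulL ?subnK ?lq //.
case: eqP => [->|nd].
  by rewrite /GRing.scale /= mulr1; congr (co _ _ _ _); have := len_le B j; lia.
rewrite scaler0; apply/eqP; apply: contraTT isT => /cmin; lia.
Qed.

Lemma hull_bot i : exists q, ln q = m /\ ok (hull i) q (ln i).-1.
Proof.
have [|q [dq lq]] := @objP _ _ _ _ _ _ B (dg (hull i) - u *+ (ln i).-1) m.
  by rewrite leqnn andbT; exact: m_gt0 B i.
exists q; split=> //; apply/admP; rewrite dq subrK lq; have [_ ->] := hullP i.
by split=> //; lia.
Qed.

Lemma tilt_socle_neq0 i q : ln q = m -> ok (hull i) q (ln i).-1 ->
  F (hull i) q (ln i).-1 *: tilt_gen i <> 0.
Proof.
move=> lq hq /tilt_ann; rewrite morM ?hull_adm //; apply: mor_neq0.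
  exact: adm_trans (hull_adm i) hq.
by rewrite lq; have := len_le B i; have := len_gt0 B i; lia.
Qed.

Lemma tilt_uniform i : uniform (tilt i).
Proof.
have [q [lq hq]] := hull_bot i; exists (F (hull i) q (ln i).-1 *: tilt_gen i).
  exact: tilt_socle_neq0.
by move=> y; apply: tilt_socle.
Qed.

Lemma tilt_tilting i : indecomposable_tilting S lt (tilt i).
Proof.
split; first exact: (generates_fg (@tilt_generates i)).
- exact/uniform_indecomposable/tilt_uniform.
- apply: (gen_filtered_std (hull_adm i) (leqnn _) (@tilt_generates i)).
  exact: tilt_ann.
- have [_ lh] := hullP i.
  exact: (gen_filtered_costd (hull_adm i) lh (leqnn _) (@tilt_generates i) (@tilt_ann i)).
Qed.

Lemma tilt_act i j q c (y : tilt i) : F j q c *: y <> 0 ->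
  exists b, ok (hull i) j b /\ (m - ln i + (b + c) < ln q)%N.
Proof.
move=> Fy; have [jq|/mor_adm F0] := boolP (ok j q c); last by case: Fy;
  rewrite F0 scale0r.
apply: contrapT => /forallNP h; apply: Fy; have [a ->] := tilt_generates y; move: a.
apply: (mor_ind (B := B)) => [|a a' ea ea'|x a ea|p r b pr br].
- by rewrite scale0r scaler0.
- by rewrite scalerDl scalerDr ea ea' addr0.
- by rewrite scalekA scalekC ea scaler0.
have [erj|/eqP nrj] := eqVneq r j; last by rewrite mor_mor0.
have [eph|/eqP nph] := eqVneq (hull i) p; last first.
  by rewrite (idem_fixed_mor r b (idem_tilt_gen i) nph) scaler0.
subst p r; rewrite mor_mor //; apply/tilt_ann.
rewrite morM ?hull_adm ?(adm_trans pr jq) // mor_len // leqNgt; apply/negP => lt_q.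
by apply: (h b).
Qed.

(** The largest exponent of a map between projectives that is nonzero on T(i) is [(ln i).-1], and it
    is attained only by maps out of [hull i]. So the length and the hull of [i] are invariants of
    T(i), and they determine [i]. *)
Lemma tilt_inj i i' : isom (tilt i) (tilt i') -> i = i'.
Proof.
have le j j' : isom (tilt j) (tilt j') ->
    (ln j <= ln j')%N /\ (ln j = ln j' -> hull j = hull j').
  move=> /isom_linear[f [f0 _]]; have [q [lq hq]] := hull_bot j.
  have /(contra_not (f0 _)) := tilt_socle_neq0 lq hq; rewrite linearZ /=.
  move=> /tilt_act[b [hb]]; rewrite lq => lt_m.
  have h0 := len_gt0 B j; have h1 := len_le B j'.
  split=> [|eq_jj]; first by lia.
  have b0 : b = 0%N by lia.
  subst b; have /admP[d _] := hb; have [_ l1] := hullP j; have [_ l2] := hullP j'.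
  by apply: (@obj_inj _ _ _ _ _ _ B); rewrite ?l1 ?l2 // d addr0.
move=> ii; have [l1 h1] := le _ _ ii; have [l2 _] := le _ _ (isom_sym ii).
have el : ln i = ln i' by lia.
apply: (@obj_inj _ _ _ _ _ _ B) => //.
by have [-> _] := hullP i; have [-> _] := hullP i'; rewrite h1 // el.
Qed.

End Filtrations.

End Tilting.

(** * Classification of tilting modules and their endomorphisms *)

Section Splitting.
Variables (k : fieldType) (E : algType k) (I : finType) (G : zmodType) (u : G).
Variables (m : nat) (B : uniserial_basis E I u m).
Implicit Types (i j p q : I) (b c : nat) (a h : E) (M N S : lmodType E).

Local Notation F := (mor B).
Local Notation co := (coef B).
Local Notation ok := (adm B).
Local Notation ln := (len B).
Local Notation dg := (deg B).
Local Notation e := (idem B).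

Section OneModule.
Variable M : lmodType E.
Hypotheses (Mmono : mono_mod B M) (Mepi : epi_mod B M).

Definition acts n := exists j q (x : M),
  [/\ ln j = m, ln q = m, ok j q n & F j q n *: x <> 0].

Lemma acts_lt n : acts n -> (n < m)%N.
Proof.
move=> [j [q [x [_ lq _ Fx]]]]; rewrite ltnNge; apply/negP => mn.
by apply: Fx; rewrite mor_len ?lq // scale0r.
Qed.

(** L_i is the image of its projective cover in its hull. A vector of e_i M lifts along the cover
    and is not killed by the embedding, so the composite acts nontrivially. *)
Lemma acts_ex (x : M) : x <> 0 -> exists n, acts n.
Proof.
move=> /(idem_neq0 B)[i ex]; exists (m - ln i)%N.
have [|p [dp lp]] := @objP _ _ _ _ _ _ B (dg i) m.
  by rewrite leqnn andbT; exact: m_gt0 B i.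
have pi : ok p i 0 by apply/admP; rewrite dp lp mulr0n addr0 add0n len_le.
have [y Fy] := Mepi pi (idem_idem B i x).
exists p, (hull B i), y; have [_ lh] := hullP B i; split=> //.
  by have := adm_trans pi (hull_adm B i).
rewrite -[(m - _)%N]add0n -(mor_mor _ pi (hull_adm B i)) Fy => Fe; apply: ex.
by apply: (Mmono (i := i) (j := hull B i)); rewrite ?idem_idem ?lh ?len_le // hull_adm.
Qed.

Lemma acts_max (x : M) : x <> 0 ->
  exists2 n, acts n & forall c, acts c -> (c <= n)%N.
Proof.
move=> /acts_ex[n0 n0P].
have [||n /asboolP nP nmax] := @ex_maxnP (fun c => `[< acts c >]) m.
- by exists n0; apply/asboolP.
- by move=> c /asboolP/acts_lt/ltnW.
by exists n => // c cP; apply: nmax; apply/asboolP.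
Qed.

End OneModule.

(* Take n maximal such that some map t^n between projectives acts nontrivially on
   M, say on x. The map T(i) -> M defined by x is split: for a functional w with
   w (t^n x) = 1, a complement of its image is the largest submodule killed by w. *)
Lemma indecomposable_tilt M : mono_mod B M -> epi_mod B M -> indecomposable M ->
  exists i, isom (tilt B i) M.
Proof.
move=> Mmono Mepi indM; have [M0 _] := indM.
have [x0 x00] : exists x : M, x <> 0.
  by apply: contrapT => /forallNP h; apply: M0 => x; apply: contrapT.
have [n nP nmax] := acts_max Mmono Mepi x00.
have nm := acts_lt nP.
have [j [j' [x [lj lj' jj Fx]]]] := nP.
have F0 p q c (y : M) : ln p = m -> ln q = m -> (n < c)%N -> F p q c *: y = 0.
  move=> lp lq nc; have [pq|/mor_adm ->] := boolP (ok p q c); last by rewrite scale0r.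
  apply: contrapT => Fy; suff /nmax : acts M c by rewrite leqNgt nc.
  by exists p, q, y.
(* The length [n.+1] and the degree are forced: the hull of [i] must be [j], and the socle of T(i),
   at exponent [(ln i).-1], must go to t^n x. *)
have [|i [di li]] := @objP _ _ _ _ _ _ B (dg j + u *+ (m - n.+1)) n.+1.
  by rewrite nm.
have hj : hull B i = j.
  have [dh lh] := hullP B i; apply: (@obj_inj _ _ _ _ _ _ B); last by rewrite lh lj.
  by apply: (addIr (u *+ (m - n.+1))); rewrite -di dh li.
have hA := hull_adm B i; rewrite hj li in hA.
have [|f fx] := generates_map (y := e j *: x) (@tilt_generates _ _ _ _ _ _ B i).
  move=> a /tilt_ann; rewrite /hull_incl hj li => a0.
  (* The kernel of the identity is the zero submodule. A term [F j q c] of [a] followed by the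
     embedding of L_q in its hull has exponent above [n], so it kills [x] by maximality; the
     embedding is then cancelled with [Mmono]. *)
  have: a *: (e j *: x) \in kernel_sub (idfun : {linear M -> M}).
    apply: (sum_act (idem_idem B j x)) => q c ca; apply/in_kernel_sub;
      rewrite [LHS]mor_idem.
    have [jq cq] := coef_adm ca; have [dh lh] := hullP B q.
    have lq : (ln q <= c + (m - n.+1))%N.
      rewrite leqNgt; apply/negP => lt_q; apply: ca.
      by rewrite -(coef_mulR a hA lt_q) a0 linear0.
    apply: (Mmono q (hull B q)); rewrite ?lh ?len_le ?hull_adm ?idem_mor //.
    rewrite (mor_mor _ jq (hull_adm B q)); apply: F0 => //.
    by have := len_le B q; lia.
  by move/in_kernel_sub.
have [w wx] := @separating_functional k (restrict_scalars M) _ Fx.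
pose W (y : M) : k := w (e j' *: y : M).
have WD y z : W (y + z) = W y + W z by rewrite /W scalerDr; apply: (linearD w).
have WZ (c : k) y : W (c%:A *: y) = c * W y.
  by rewrite /W scalekC; apply: (linearZZ w).
have W0 : W 0 = 0 by rewrite /W scaler0; apply: (linear0 w).
have WB y z : W (y - z) = W y - W z.
  by apply/eqP; rewrite -subr_eq0 opprB addrA -WD subrK subrr.
have Wx : W (F j j' n *: x) = 1 by rewrite /W idem_mor.
have K0 : forall h : E, W (h *: 0) = 0 by move=> h; rewrite scaler0.
have KD (y z : M) : (forall h, W (h *: y) = 0) -> (forall h, W (h *: z) = 0) ->
    forall h, W (h *: (y + z)) = 0.
  by move=> hy hz h; rewrite scalerDr WD hy hz addr0.
have KZ a (y : M) : (forall h, W (h *: y) = 0) -> forall h, W (h *: (a *: y)) = 0.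
  by move=> hy h; rewrite scalerA.
pose K := @sub_of E M (fun y => forall h, W (h *: y) = 0) K0 KD KZ.
pose U := image_mod f.
have xU a : a *: (e j *: x) \in U.
  by apply/in_image_mod; exists (a *: tilt_gen B i); rewrite linearZ /= fx.
have hq : ok (hull B i) j' (ln i).-1 by rewrite hj li.
have fz t : t <> 0 -> exists a, a *: f t = F j j' n *: x.
  move=> /(tilt_socle lj' hq)[a az]; exists a.
  by move/(congr1 f): az; rewrite !linearZ /= fx hj li mor_idem => ->.
have UK y : y \in U -> y \in K -> y = 0.
  move=> /in_image_mod[t ->] /(in_sub_of K0 KD KZ) h.
  have [->|/fz[a az]] := EM (t = 0); first by rewrite linear0.
  by have := h a; rewrite az Wx => /eqP; rewrite oner_eq0.
pose good y := exists2 v, v \in U & y - v \in K.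
have goodD y z : good y -> good z -> good (y + z).
  move=> [v vU yv] [v' vU' zv]; exists (v + v'); first exact: rpredD.
  by rewrite opprD addrACA rpredD.
have goodZ a y : good y -> good (a *: y).
  by move=> [v vU yv]; exists (a *: v); rewrite -?scalerBr rpredZ.
have good0 : good 0 by exists 0; rewrite ?subr0 rpred0.
have goodp p (y : M) : ln p = m -> good (e p *: y).
  move=> lp; have: exists v, [/\ v \in U, e p *: v = v &
      forall b, W (F p j' b *: (e p *: y - v)) = 0]; last first.
    move=> [v [vU ev hv]]; exists v => //; apply/(in_sub_of K0 KD KZ) => h.
    have {}ev : e p *: (e p *: y - v) = e p *: y - v by rewrite scalerBr idem_idem ev.
    have -> : W (h *: (e p *: y - v)) = W ((e j' * h) *: (e p *: y - v)).
      by rewrite /W -scalerA idem_idem.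
    move: h; apply: (mor_ind (B := B)) => [|a a' ea ea'|c a ea|p' q b pq bq].
    - by rewrite mulr0 scale0r.
    - by rewrite mulrDr scalerDl WD ea ea' addr0.
    - by rewrite -scalerAr scalekA WZ ea mulr0.
    have [eq|/eqP nq] := eqVneq q j'; last by rewrite [e j' * _]morM0 ?scale0r.
    subst q; rewrite mul_idem_mor.
    have [ep|/eqP np] := eqVneq p p'; first by subst p'.
    by rewrite (idem_fixed_mor j' b ev np).
  (* The exponents are treated one at a time, from the top. At stage [N] the correction is a
     multiple of [F j p N *: x]: exponent [n - N] takes it to t^n x, where [W] is 1, and larger
     exponents kill it, so earlier stages are undisturbed. *)
  have: forall N : nat, exists v, [/\ v \in U, e p *: v = v &
      forall b, (n < b + N)%N -> W (F p j' b *: (e p *: y - v)) = 0].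
    elim=> [|N [v [vU ev hv]]].
      exists 0; rewrite rpred0 scaler0; split=> // b nb.
      by rewrite F0 //; lia.
    have [nN|Nn] := ltnP n N.
      exists v; split=> // b nb; have [nb'|nb'] := ltnP n (b + N); first exact: hv.
      by lia.
    have [pj|npj] := boolP (ok p j' (n - N)); last first.
      exists v; split=> // b nb; have [nb'|nb'] := ltnP n (b + N); first exact: hv.
      have -> : b = (n - N)%N by lia.
      by rewrite mor_adm // scale0r.
    have jp : ok j p N.
      have /admP[d _] := pj; have /admP[d' _] := jj; apply/admP; split;
        last by rewrite lj lp; lia.
      by rewrite d' d -addrA -mulrnDr subnK.
    pose c := W (F p j' (n - N) *: (e p *: y - v)).
    exists (v + c%:A *: (F j p N *: x)); split.
    - by rewrite rpredD // rpredZ // -mor_idem xU.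
    - by rewrite scalerDr ev scalekC idem_mor.
    move=> b nb; rewrite opprD addrA scalerBr WB scalekC WZ.
    have [pb|npb] := boolP (ok p j' b);
      last by rewrite mor_adm // !scale0r W0 mulr0 subrr.
    rewrite (mor_mor _ jp pb).
    have [nb'|nb'] := ltnP n (b + N).
      by rewrite hv // F0 ?W0 ?mulr0 ?subrr //; lia.
    have eb : b = (n - N)%N by lia.
    by rewrite eb subnKC // Wx mulr1 subrr.
  move=> /(_ n.+1)[v [vU ev hv]]; exists v; split=> // b.
  by apply: hv; lia.
(* Each e_q M is the image of some e_p M with L_p projective, by [Mepi], so [goodp] covers all of
   [M]. *)
have UKM y : good y.
  rewrite [y](sum_idem B); elim/big_ind: _ => // q _.
  have [|p [dp lp]] := @objP _ _ _ _ _ _ B (dg q) m.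
    by rewrite leqnn andbT; exact: m_gt0 B q.
  have pq : ok p q 0 by apply/admP; rewrite dp lp mulr0n addr0 add0n len_le.
  have [z <-] := Mepi _ _ _ pq (idem_idem B q y).
  by rewrite -mor_idem; apply/goodZ/goodp.
exists i; apply: (isom_of (f := f)) => [t ft|y].
  apply: contrapT => /fz[a]; rewrite ft scaler0 => Fx0.
  by apply: Fx.
have : y \in U.
  apply: (indecomposable_summand indM UK UKM); exists (e j *: x).
    by rewrite -[e j *: x]scale1r xU.
  by move=> ex0; apply: Fx; rewrite -mor_idem ex0 scaler0.
by move/in_image_mod => [t ->]; exists t.
Qed.

(** * The ideal of maps that factor through a projective *)

Definition ideal_sub : submodClosed (E^o : lmodType E).
Proof.
refine (@sub_of E E^o (fun a : E => forall i, exists h, a * e i = h * hull_incl B i)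
  _ _ _).
- by move=> i; exists 0; rewrite !mul0r.
- move=> a a' ha ha' i; have [h eh] := ha i; have [h' eh'] := ha' i.
  by exists (h + h'); rewrite !mulrDl eh eh'.
- move=> b a ha i; have [h eh] := ha i; exists (b * h).
  by rewrite /GRing.scale /= -!mulrA eh.
Defined.

Lemma in_ideal_sub (a : E) : a \in ideal_sub <-> 
  forall i, exists h, a * e i = h * hull_incl B i.
Proof. by split=> [/asboolP|h]; last apply/asboolP. Qed.

Lemma hull_incl_ideal i h : h * hull_incl B i \in ideal_sub.
Proof.
apply/in_ideal_sub => j; have [eij|/eqP nij] := eqVneq i j; last first.
  by exists 0; rewrite mul0r -mulrA /hull_incl mul_mor_idem0 ?mulr0.
by exists h; rewrite -eij -mulrA /hull_incl mul_mor_idem.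
Qed.

(** A map from L_i to L_q, followed by the embedding of L_q in its hull, extends to the hull of L_i
    because the target is injective. On monomials the extension is explicit: its exponent is the
    difference of the two. *)
Lemma ideal_mulr a (b : E) : a \in ideal_sub -> (a * b : E) \in ideal_sub.
Proof.
move=> aI; move: b; apply: (mor_ind (B := B)) => [|b b' eb eb'|c b eb|j q c jq cq].
- by rewrite mulr0; apply: (rpred0 ideal_sub).
- by rewrite mulrDr; apply: (rpredD (S := ideal_sub)).
- by rewrite -scalerAr -mulr_algl; apply: (rpredZ (s := ideal_sub) (c%:A : E)).
apply/in_ideal_sub => i; have [eji|/eqP nji] := eqVneq j i; last first.
  by exists 0; rewrite mul0r -mulrA mul_mor_idem0 ?mulr0.
subst j; rewrite -mulrA mul_mor_idem -(mul_idem_mor B) mulrA.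
move/in_ideal_sub: aI => /(_ q)[h ->]; rewrite -mulrA /hull_incl.
rewrite (morM jq (hull_adm B q)).
have iq := adm_trans jq (hull_adm B q); have [d l] := hullP B i; have [_ l'] := hullP B q.
have /admP[_ lq] := jq; have := len_le B q; have := len_le B i => li lq'.
have hh : ok (hull B i) (hull B q) (c + (m - ln q) - (m - ln i)).
  by apply: (adm_factor iq d); rewrite ?l ?l'; lia.
exists (h * F (hull B i) (hull B q) (c + (m - ln q) - (m - ln i))).
rewrite -mulrA (morM (hull_adm B i) hh); congr (h * F _ _ _); lia.
Qed.

(** Each [hull_incl B j] lies in the ideal and is a monomorphism, so it can be cancelled on the
    left. *)
Lemma ideal_faithful (b : E) : (forall a, a \in ideal_sub -> a * b = 0) -> b = 0.
Proof.
move=> h; apply: (coef_eq (B := B)) => i j d; rewrite linear0.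
have [jd|dj] := leqP (ln j) d.
  by apply: contrapT => /coef_adm[_]; lia.
have [_ lh] := hullP B j.
rewrite -(coef_mulL i b (hull_adm B j)); last by rewrite lh; have := len_le B j; lia.
rewrite -/(hull_incl B j) h ?linear0 //.
by have := hull_incl_ideal j 1; rewrite mul1r.
Qed.

(** The map [F (hull i) q (ln i)] has the submodule L_i of the hull as its kernel. It kills
    [hull_incl B i], hence also [y], so [y] takes values in L_i; the coefficients of [b] are those
    of [y] shifted by [m - ln i]. *)
Lemma hull_incl_divides i y : e (hull B i) * y = y ->
  (forall h, h * hull_incl B i = 0 -> h * y = 0) -> exists b : E, y = hull_incl B i * b.
Proof.
move=> ey ann; have [dh lh] := hullP B i; have li := len_le B i; have li0 := len_gt0 B i.
have y0 p c : (c < m - ln i)%N -> co p (hull B i) c y = 0.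
  move=> cm; have [|q [dq lq]] := @objP _ _ _ _ _ _ B (dg (hull B i) - u *+ ln i) m.
    by rewrite leqnn andbT; exact: m_gt0 B i.
  have hq : ok (hull B i) q (ln i) by apply/admP; rewrite dq subrK lh lq; split=> //; lia.
  rewrite -(coef_mulL p y hq); last by rewrite lq; lia.
  rewrite ann ?linear0 // /hull_incl morM ?hull_adm // mor_len // lq; lia.
pose g p q d : k := if q == i then co p (hull B i) (d + (m - ln i)) y else 0.
have [|b bP] := @coef_build _ _ _ _ _ _ B g.
  move=> p q d; rewrite /g; case: eqP => // -> /coef_adm[ph]; rewrite lh => dm.
  split; last by lia.
  have /admP[d1 l1] := ph; apply/admP; rewrite lh in l1; split; last by lia.
  by rewrite d1 dh -addrA -mulrnDr addnC.
exists b; apply: (coef_eq (B := B)) => p q c.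
have [eq|/eqP nq] := eqVneq q (hull B i); last first.
  rewrite -ey /hull_incl -(mul_idem_mor B i) -mulrA !coef_idemL.
  by case: eqP => // /esym.
subst q; have [cm|mc] := ltnP c (m - ln i); first by rewrite y0 // coef_mulL0.
have [mc'|cm'] := leqP m c.
  have h a : co p (hull B i) c a = 0.
    by apply: contrapT => /coef_adm[_]; rewrite lh; lia.
  by rewrite !h.
rewrite -(subnK mc) coef_mulL ?hull_adm ?subnK ?lh // bP /g eqxx.
by rewrite subnK.
Qed.

(** The embeddings [hull_incl B i] generate the ideal as a left ideal. A linear map respects
    annihilators, so it sends each of them to a right multiple of itself; the cofactors [b i] are
    glued along the idempotents. *)
Lemma ideal_endo (f : {linear submod ideal_sub -> E^o}) :
  exists b : E, forall x, f x = (val x * b : E).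
Proof.
pose gen i : submod ideal_sub := to_submod (hull_incl_ideal i 1).
have genE i : val (gen i) = hull_incl B i by rewrite /= mul1r.
have fZ (h : E) x : f (h *: x) = (h * f x : E) by rewrite linearZ.
have bP i : exists b : E, f (gen i) = hull_incl B i * b.
  apply: hull_incl_divides => [|h h0].
    rewrite -fZ; congr (f _).
    by apply: submod_inj; rewrite /= mul1r; apply: mul_idem_mor.
  rewrite -fZ -(linear0 f); congr (f _).
  by apply: submod_inj; rewrite /= mul1r.
pose b i := sval (cid (bP i)).
have fb i : f (gen i) = hull_incl B i * b i by rewrite /b; case: cid.
exists (\sum_i e i * b i) => x.
have hP i : exists h, val x * e i = h * hull_incl B i.
  by have /in_ideal_sub := valP x; apply.
pose h i := sval (cid (hP i)).
have hE i : val x * e i = h i * hull_incl B i by rewrite /h; case: cid.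
have {1}-> : x = \sum_i h i *: gen i.
  apply: submod_inj; rewrite (linear_sum (submod_val ideal_sub)) /=.
  rewrite -[LHS]mulr1 -[X in _ * X = _](mor1 B) mulr_sumr; apply: eq_bigr => i _.
  by rewrite [LHS]hE mul1r.
rewrite linear_sum mulr_sumr; apply: eq_bigr => i _.
by rewrite fZ fb !mulrA hE.
Qed.

End Splitting.

(** * Modules over a Nakayama algebra *)

(* Modules over such an algebra are graded vector spaces with an operator t of
   degree u and order of nilpotency at most m. *)
Record nakayama_basis (k : fieldType) (R : algType k) (G : finZmodType) (u : G)
    (m : nat) := NakayamaBasis {
  vtx : G -> R;
  shift : R;
  nb_gt0 : (0 < m)%N;
  vtxM : forall g h, vtx g * vtx h = if g == h then vtx g else 0;
  vtx1 : \sum_g vtx g = 1;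
  shift_vtx : forall g, shift * vtx g = vtx (g + u) * shift;
  shift_nilp : shift ^+ m = 0;
  shift_neq0 : forall g, shift ^+ m.-1 * vtx g <> 0;
  nb_span : forall r, exists c : G -> nat -> k,
    r = \sum_g \sum_(a < m) c g a *: (shift ^+ a * vtx g)
}.

Section GradedModules.
Variables (k : fieldType) (R : algType k) (G : finZmodType) (u : G) (m : nat).
Variable D : nakayama_basis R u m.
Implicit Types (X Y : lmodType R) (g : G) (l : nat).

Local Notation v := (vtx D).
Local Notation t := (shift D).

Lemma shiftX_vtx a g : t ^+ a * v g = v (g + u *+ a) * t ^+ a.
Proof.
elim: a g => [|a IH] g; first by rewrite mulr1 mul1r mulr0n addr0.
by rewrite exprS -mulrA IH mulrA shift_vtx -mulrA -addrA -mulrSr.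
Qed.

Section OneModule.
Variable X : lmodType R.
Implicit Types x y : X.

Lemma vtx_other g h x : v g *: x = x -> h <> g -> v h *: x = 0.
Proof. by move=> <- /eqP hg; rewrite scalerA vtxM (negPf hg) scale0r. Qed.

Lemma vtx_shift g a x : v g *: x = x -> v (g + u *+ a) *: (t ^+ a *: x) = t ^+ a *: x.
Proof. by move=> gx; rewrite scalerA -shiftX_vtx -scalerA gx. Qed.

Lemma shift_shift a b x : t ^+ a *: (t ^+ b *: x) = t ^+ (a + b) *: x.
Proof. by rewrite scalerA exprD. Qed.

Lemma shift_ge a b x : t ^+ a *: x = 0 -> (a <= b)%N -> t ^+ b *: x = 0.
Proof. by move=> ax ab; rewrite -(subnK ab) -shift_shift ax scaler0. Qed.

End OneModule.

(** The coefficients are chosen before the module, so that a relation in one module can be carried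
    to another of the same degree, as in [uniserial_map]. *)
Lemma span_act g (r : R) : exists c : nat -> k,
  forall Y (y : Y), v g *: y = y -> r *: y = \sum_(a < m) (c a)%:A *: (t ^+ a *: y).
Proof.
have [c ->] := nb_span D r; exists (c g) => Y y gy.
rewrite scaler_suml (bigD1 g) //= [X in _ + X]big1 ?addr0 => [|h hg].
  rewrite scaler_suml; apply: eq_bigr => a _.
  by rewrite scalekA -scalerA gy.
rewrite scaler_suml big1 // => a _.
by rewrite scalekA -scalerA (vtx_other gy) ?scaler0 //; apply/eqP.
Qed.

Definition uniserial_at X g l (x : X) :=
  [/\ (0 < l <= m)%N, v g *: x = x, t ^+ l *: x = 0, t ^+ l.-1 *: x <> 0 & generates x].


Lemma uniserial_span X g l (x : X) y : uniserial_at g l x ->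
  exists c : nat -> k, y = \sum_(a < l) (c a)%:A *: (t ^+ a *: x).
Proof.
move=> [/andP[_ lm] gx lx _ xX]; have [r ->] := xX y; have [c cP] := span_act g r.
exists c; rewrite (cP _ _ gx) (big_ord_widen m (fun a => (c a)%:A *: (t ^+ a *: x)) lm).
rewrite [RHS]big_mkcond /=; apply: eq_bigr => a _; case: ltnP => // la.
by rewrite (shift_ge lx la) scaler0.
Qed.

Lemma shift_sum X l b (x : X) (c : nat -> k) : t ^+ l *: x = 0 -> (b < l)%N ->
  (forall a, (a < b)%N -> c a = 0) ->
  t ^+ (l.-1 - b) *: (\sum_(a < l) (c a)%:A *: (t ^+ a *: x)) =
    (c b)%:A *: (t ^+ l.-1 *: x).
Proof.
move=> lx bl cb; rewrite scaler_sumr (bigD1 (Ordinal bl)) //= big1 ?addr0 => [|a ab].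
  by rewrite scalekC shift_shift; congr (_ *: (t ^+ _ *: x)); lia.
rewrite scalekC shift_shift; have [lt_ab|gt_ab|eab] := ltngtP a b.
- by rewrite cb // scalek0.
- by rewrite (shift_ge lx) ?scaler0 //; lia.
- by case/eqP: ab; apply: val_inj.
Qed.

Lemma uniserial_free X g l (x : X) (c : nat -> k) : uniserial_at g l x ->
  \sum_(a < l) (c a)%:A *: (t ^+ a *: x) = 0 -> forall a, (a < l)%N -> c a = 0.
Proof.
move=> [_ _ lx lx' _] c0 a; elim/ltn_ind: a => a IH al.
apply: contrapT => /eqP ca; apply: lx'.
rewrite -(scalekK (t ^+ l.-1 *: x) ca) -(shift_sum lx al) ?c0 ?scaler0 // => b ba.
by apply: IH => //; lia.
Qed.

Lemma uniserial_socle X g l (x y : X) : uniserial_at g l x -> y <> 0 ->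
  exists r : R, t ^+ l.-1 *: x = r *: y.
Proof.
move=> ux y0; have [lm gx lx lx' xX] := ux.
have [c yc] := uniserial_span y ux.
have [a [al ca]] : exists a, (a < l)%N /\ c a != 0.
  apply: contrapT => /forallNP h; apply: y0; rewrite yc big1 // => a _.
  have [->|ca] := eqVneq (c a) 0; first by rewrite scalek0.
  by case: (h a).
have [|b /andP[bl cb] bmin] := @ex_minnP (fun a => (a < l)%N && (c a != 0)).
  by exists a; rewrite al.
exists ((c b)^-1%:A * t ^+ (l.-1 - b)); rewrite -scalerA yc.
rewrite (shift_sum lx bl) ?scalekK // => d db.
apply/eqP; apply: contraTT isT => cd.
by have := bmin d; rewrite cd andbT; lia.
Qed.

Lemma uniserial_uniform X g l (x : X) : uniserial_at g l x -> uniform X.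
Proof.
move=> ux; have [_ _ _ lx' _] := ux; exists (t ^+ l.-1 *: x) => // y.
exact: (uniserial_socle ux).
Qed.

Lemma uniserial_le X g h l l' (x x' : X) :
  uniserial_at g l x -> uniserial_at h l' x' -> (l' <= l)%N.
Proof.
move=> ux [/andP[l0 _] _ _ lx' _]; have [_ _ lx _ _] := ux.
have [c xc] := uniserial_span x' ux; rewrite leqNgt; apply/negP => ll.
apply: lx'; rewrite xc scaler_sumr big1 // => a _.
by rewrite scalekC shift_shift (shift_ge lx) ?scaler0 //; lia.
Qed.

Lemma uniserial_unique X g h l l' (x x' : X) :
  uniserial_at g l x -> uniserial_at h l' x' -> g = h /\ l = l'.
Proof.
move=> ux ux'; have el : l = l'.
  by have := uniserial_le ux ux'; have := uniserial_le ux' ux; lia.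
subst l'; split=> //; apply: contrapT => gh.
have [_ hx' _ lx' _] := ux'; have [/andP[l0 _] gx lx _ _] := ux.
have [c xc] := uniserial_span x' ux; apply: lx';
  rewrite -hx' xc !scaler_sumr big1 // => a _.
rewrite !scalekC; have [a0|a0] := eqVneq (a : nat) 0%N.
  by rewrite a0 scale1r (vtx_other gx) ?scaler0 // => /esym.
rewrite [v h *: _]scalerA (_ : v h * t ^+ a = t ^+ a * v (h - u *+ a)); last first.
  by rewrite shiftX_vtx subrK.
rewrite -[(_ * _) *: x]scalerA.
have [->|/eqP gg] := eqVneq (h - u *+ a) g.
  by rewrite gx shift_shift (shift_ge lx) ?scaler0 //; lia.
by rewrite (vtx_other gx gg) !scaler0.
Qed.

Lemma uniserial_isom X Y g l (x : X) : isom X Y -> uniserial_at g l x ->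
  exists y : Y, uniserial_at g l y.
Proof.
move=> /isom_linear[f [f0 fS]] [lm gx lx lx' xX]; exists (f x); split=> //.
- by rewrite -linearZ gx.
- by rewrite -linearZ lx linear0.
- by rewrite -linearZ => /f0.
- by move=> y; have [z <-] := fS y; have [r ->] := xX z; exists r; rewrite linearZ.
Qed.

Lemma uniserial_map X Y g l (x : X) (y : Y) : uniserial_at g l x ->
  v g *: y = y -> t ^+ l *: y = 0 -> exists f : {linear X -> Y}, f x = y.
Proof.
move=> ux gy ly; have [/andP[_ lm] gx lx _ xX] := ux.
apply: generates_map xX _ => r rx; have [c cP] := span_act g r.
rewrite (cP _ _ gy) big1 // => a _.
have [al|la] := ltnP a l; last by rewrite (shift_ge ly la) scaler0.
rewrite (uniserial_free ux _ al) ?scalek0 //; apply: etrans rx; rewrite (cP _ _ gx).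
rewrite (big_ord_widen m (fun a => (c a)%:A *: (t ^+ a *: x)) lm).
rewrite [LHS]big_mkcond /=; apply: eq_bigr => b _; case: ltnP => // lb.
by rewrite (shift_ge lx lb) scaler0.
Qed.

Lemma uniserial_isom_of X Y g l (x : X) (y : Y) :
  uniserial_at g l x -> uniserial_at g l y -> isom X Y.
Proof.
move=> ux uy; have [_ gx lx lx' xX] := ux; have [_ gy ly ly' yY] := uy.
have [f fx] := uniserial_map ux gy ly; have [h hy] := uniserial_map uy gx lx.
apply: (isom_of (f := f)) => [z fz|z]; last first.
  by have [r ->] := yY z; exists (r *: x); rewrite linearZ /= fx.
have [r zr] := xX z; rewrite zr -hy -linearZ -fx -linearZ -zr fz !linear0 //.
Qed.

(** Let [n] be the largest exponent with t^n nonzero on [X], and [x] homogeneous with t^n x nonzero.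
    Then R x splits off: for a functional that is 1 at t^n x, the largest submodule [K] on which it
    vanishes is a complement. *)
Lemma indecomposable_uniserial X : indecomposable X -> exists g l (x : X),
  uniserial_at g l x.
Proof.
move=> indX; have [X0 _] := indX; have m0 := nb_gt0 D.
have [x0 x00] : exists x : X, x <> 0.
  by apply: contrapT => /forallNP h; apply: X0 => x; apply: contrapT.
have [||n /asboolP[x' nx'] nmax] := @ex_maxnP (fun c => `[< exists x : X, t ^+ c *: x
  <> 0 >]) m.
- by exists 0%N; apply/asboolP; exists x0; rewrite scale1r.
- move=> c /asboolP[x]; rewrite leqNgt => cx; apply/negP => mc; apply: cx.
  by apply: (shift_ge (a := m)); [rewrite shift_nilp scale0r | lia].
have n0 c (x : X) : (n < c)%N -> t ^+ c *: x = 0.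
  move=> nc; apply: contrapT => cx; have /nmax : `[< exists x : X, t ^+ c *: x <> 0 >].
    by apply/asboolP; exists x.
  by rewrite leqNgt nc.
have nm : (n < m)%N.
  rewrite ltnNge; apply/negP => mn; apply: nx'.
  by apply: (shift_ge (a := m)) => //; rewrite shift_nilp scale0r.
have [g gx'] : exists g, t ^+ n *: (v g *: x') <> 0.
  apply: contrapT => /forallNP h; apply: nx'.
  rewrite -[x']scale1r -(vtx1 D) scaler_suml scaler_sumr big1 // => g _.
  exact: contrapT.
pose x := v g *: x'; have gx : v g *: x = x by rewrite /x scalerA vtxM eqxx.
have [w wx] := @separating_functional k (restrict_scalars X) _ gx'.
pose h := g + u *+ n.
have hx : v h *: (t ^+ n *: x) = t ^+ n *: x by apply: vtx_shift.
pose W (y : X) : k := w (v h *: y : X).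
have WD y z : W (y + z) = W y + W z by rewrite /W scalerDr; apply: (linearD w).
have WZ (c : k) y : W (c%:A *: y) = c * W y.
  by rewrite /W scalekC; apply: (linearZZ w).
have W0 : W 0 = 0 by rewrite /W scaler0; apply: (linear0 w).
have WB y z : W (y - z) = W y - W z.
  by apply/eqP; rewrite -subr_eq0 opprB addrA -WD subrK subrr.
have Wx : W (t ^+ n *: x) = 1 by rewrite /W hx.
have K0 : forall r : R, W (r *: 0) = 0 by move=> r; rewrite scaler0.
have KD (y z : X) : (forall r, W (r *: y) = 0) -> (forall r, W (r *: z) = 0) ->
    forall r, W (r *: (y + z)) = 0.
  by move=> hy hz r; rewrite scalerDr WD hy hz addr0.
have KZ a (y : X) : (forall r, W (r *: y) = 0) -> forall r, W (r *: (a *: y)) = 0.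
  by move=> hy r; rewrite scalerA.
pose K := @sub_of R X (fun y => forall r, W (r *: y) = 0) K0 KD KZ.
have ux : uniserial_at g n.+1 (cyc_gen x).
  split=> //; last exact: cyc_generates.
  - exact: submod_inj.
  - by apply: submod_inj; apply: n0.
  - by move/(congr1 val).
have UK y : y \in cyc x -> y \in K -> y = 0.
  move=> yx /(in_sub_of K0 KD KZ) hy; apply: contrapT => y0.
  have [|r /(congr1 val) /= e] := uniserial_socle (y := to_submod yx) ux.
    by move/(congr1 val).
  by have := hy r; rewrite -e Wx => /eqP; rewrite oner_eq0.
have UKM y : exists2 z, z \in cyc x & y - z \in K.
  (* Stage [N] corrects exponent [n - N] by a multiple of t^N x: t^(n - N) takes it to t^n x, where
     [W] is 1, while larger exponents kill it. *)
  have: forall N : nat, exists2 z, z \in cyc x & forall b, (n < b + N)%N ->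
      W (t ^+ b *: (y - z)) = 0.
    elim=> [|N [z zx hz]].
      by exists 0; rewrite ?rpred0 // => b nb; rewrite n0 //; lia.
    have [nN|Nn] := ltnP n N; first by exists z => // b nb; apply: hz; lia.
    pose c := W (t ^+ (n - N) *: (y - z)).
    exists (z + c%:A *: (t ^+ N *: x)); first by rewrite rpredD // rpredZ // mem_cyc.
    move=> b nb; rewrite opprD addrA scalerBr WB scalekC WZ shift_shift.
    have [nb'|nb'] := ltnP n (b + N).
      by rewrite hz // n0 // W0 mulr0 subrr.
    have eb : b = (n - N)%N by lia.
    by rewrite eb subnK // Wx mulr1 subrr.
  move=> /(_ n.+1)[z zx hz]; exists z => //; apply/(in_sub_of K0 KD KZ) => r.
  have [c ->] := nb_span D r; rewrite scaler_suml.
  rewrite (big_morph W WD W0) big1 // => q _;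
    rewrite scaler_suml (big_morph W WD W0) big1 // => a _.
  rewrite scalekA WZ shiftX_vtx.
  have -> : W ((v (q + u *+ a) * t ^+ a) *: (y - z)) =
      if q + u *+ a == h then W (t ^+ a *: (y - z)) else 0.
    rewrite /W -scalerA [v h *: (v _ *: _)]scalerA vtxM eq_sym; case: eqP => //.
    by move=> _; rewrite scale0r (linear0 w).
  by rewrite hz ?if_same ?mulr0 //; lia.
exists g, n.+1, x; split=> //; first exact: n0.
move=> y; apply/in_cyc; apply: (indecomposable_summand indX UK UKM).
exists x; first by have := mem_cyc x 1; rewrite scale1r.
by move=> x1; apply: gx'; rewrite -/x x1 scaler0.
Qed.

(** It generates the submodule of length [l] of a projective R v_h, with [h] chosen to give the
    generator degree [g]. The index type ['I_1] presents R as a free module of rank one, as [in_sub]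
    demands. *)
Definition uniserial_model g l : {ffun 'I_1 -> R^o} :=
  [ffun=> t ^+ (m - l) * v (g - u *+ (m - l))].

Lemma uniserial_modelP g l : (0 < l <= m)%N ->
  uniserial_at g l (cyc_gen (uniserial_model g l)).
Proof.
move=> lm; have m0 := nb_gt0 D; split=> //; last exact: cyc_generates.
- apply: submod_inj; apply/ffunP => i; rewrite !ffunE /= shiftX_vtx subrK.
  by rewrite /GRing.scale /= mulrA vtxM eqxx.
- apply: submod_inj; apply/ffunP => i; rewrite !ffunE /= /GRing.scale /= mulrA -exprD.
  by rewrite subnKC ?shift_nilp ?mul0r //; case/andP: lm.
- move/(congr1 val)/ffunP/(_ ord0); rewrite !ffunE /= /GRing.scale /= mulrA -exprD.
  rewrite (_ : (_ + _ = m.-1)%N); last by lia.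
  exact: shift_neq0.
Qed.

Lemma uniserial_in_sub g l : in_sub (submod (cyc (uniserial_model g l))).
Proof. by apply: add_base; exists 1%N, (cyc (uniserial_model g l)); apply: isom_refl. Qed.

Lemma dim_rV_unique a b : isom ('rV[k]_a : lmodType k) ('rV[k]_b : lmodType k) -> a = b.
Proof.
have le c d : isom ('rV[k]_c : lmodType k) ('rV[k]_d : lmodType k) -> (c <= d)%N.
  move=> /isom_linear[f [f0 _]].
  have /eqP <- : row_free (lin1_mx f).
    by apply: inj_row_free => w; rewrite mul_rV_lin1; apply: f0.
  exact: rank_leq_col.
by move=> ab; apply/eqP; rewrite eqn_leq !le //; apply: isom_sym.
Qed.

Lemma uniserial_coords X g l (x : X) : uniserial_at g l x ->
  exists f : {linear 'rV[k]_l -> restrict_scalars X},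
    [/\ forall w, f w = \sum_(a < l) (w 0 a)%:A *: (t ^+ a *: x),
        forall w, f w = 0 -> w = 0 & forall y, exists w, f w = y].
Proof.
move=> ux; have L : linear (fun w : 'rV[k]_l =>
    \sum_(a < l) (w 0 a)%:A *: (t ^+ a *: x) : restrict_scalars X).
  move=> c w w'; rewrite scaler_sumr -big_split; apply: eq_bigr => a _ /=.
  by rewrite !mxE [(_ + _)%:A]scalerDl scalerDl -[(c * _)%:A *: _]scalekM.
exists (pack_linear L); split=> // [w /= w0|y].
  apply/rowP => a; rewrite mxE.
  pose c b := if insub b is Some i then w 0 (i : 'I_l) else 0.
  have cE (b : 'I_l) : c b = w 0 b by rewrite /c valK.
  rewrite -cE; apply: (uniserial_free ux _ (ltn_ord a)); rewrite -[RHS]w0.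
  by apply: eq_bigr => b _; rewrite cE.
have [c ->] := uniserial_span y ux; exists (\row_a c a) => /=.
by apply: eq_bigr => a _; rewrite mxE.
Qed.

Lemma uniserial_kdim X g l (x : X) : uniserial_at g l x -> kdim X = l.
Proof.
move=> /uniserial_coords[f [_ f0 fS]]; rewrite /kdim;
  case: xgetP => [d -> /= iX|/(_ l)[]].
  by apply/dim_rV_unique/isom_sym; apply: isom_trans iX; apply: (isom_of (f := f)).
by apply/isom_sym; apply: (isom_of (f := f)).
Qed.

Lemma uniserial_coef X g l (x : X) : uniserial_at g l x ->
  exists cf : nat -> {linear restrict_scalars X -> k^o},
  [/\ forall a b, (b < l)%N -> cf a (t ^+ b *: x) = (a == b)%:R,
      forall a y, (l <= a)%N -> cf a y = 0 &
      forall y, y = \sum_(a < l) (cf a y : k)%:A *: (t ^+ a *: x)].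
Proof.
move=> ux; have [f [fE f0 fS]] := uniserial_coords ux.
have [h fK hK] := bij_of_inj_surj (linear_eq0_inj f0) fS.
have hL := can2_linear fK hK.
pose c a y : k := if insub a is Some i then h y 0 (i : 'I_l) else 0.
have cL a : linear (c a : restrict_scalars X -> k^o).
  move=> d y z; rewrite /c; case: insubP => [i _ _|_]; last by rewrite scaler0 addr0.
  by rewrite hL !mxE.
have cE (a : 'I_l) y : c a y = h y 0 a by rewrite /c valK.
have cS y : y = \sum_(a < l) (c a y)%:A *: (t ^+ a *: x).
  by rewrite -[LHS]hK fE; apply: eq_bigr => a _; rewrite cE.
exists (fun a => pack_linear (cL a)); split=> //= [a b bl|a y la].
  have hx : h (t ^+ b *: x) = \row_i ((i : nat) == b)%:R.
    apply: (linear_eq0_inj f0);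
      rewrite hK fE (bigD1 (Ordinal bl)) //= big1 ?addr0 => [|i ib].
      by rewrite mxE eqxx !scale1r.
    rewrite mxE; case: eqP => [eib|_]; last by rewrite scalek0.
    by case/eqP: ib; apply: val_inj.
  rewrite /c; case: insubP => [i _ <-|]; first by rewrite hx mxE.
  by rewrite -leqNgt => la; case: eqP => // ab; lia.
by rewrite /c; case: insubP => // i; rewrite ltnNge la.
Qed.

End GradedModules.

(** * The endomorphism algebra of SUB(R) *)

Section DirectSumMaps.
Variables (A : pzRingType) (I : finType) (M : I -> lmodType A).

Definition dsum_inj j (y : M j) : dsum M :=
  [ffun i => if @eqP _ j i is ReflectT e then eq_rect j (fun i => M i) y i e else 0].

Lemma dsum_injE j (y : M j) : dsum_inj y j = y.
Proof.
rewrite ffunE; case: eqP => // e.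
by rewrite (eq_irrelevance e erefl).
Qed.

Lemma dsum_inj0 j i (y : M j) : j <> i -> dsum_inj y i = 0.
Proof. by move=> ji; rewrite ffunE; case: eqP. Qed.

Lemma dsum_inj_linear j : linear (@dsum_inj j).
Proof.
move=> a y z; apply/ffunP => i; rewrite [RHS]ffunE [in RHS]ffunE.
have [e|/eqP ne] := eqVneq j i; first by subst i; rewrite !dsum_injE.
by rewrite !dsum_inj0 // scaler0 addr0.
Qed.

Lemma dsum_injZ j a (y : M j) : dsum_inj (a *: y) = a *: dsum_inj y.
Proof. exact: (linearZZ (pack_linear (@dsum_inj_linear j))). Qed.

Lemma dsum_inj_0 j : dsum_inj (0 : M j) = 0.
Proof. exact: (linear0 (pack_linear (@dsum_inj_linear j))). Qed.

Lemma dsum_proj_linear j : linear (fun x : dsum M => x j).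
Proof. by move=> a x y; rewrite [LHS]ffunE [in LHS]ffunE. Qed.

Lemma dsum_sumE (J : finType) (f : J -> dsum M) i : (\sum_j f j) i = \sum_j f j i.
Proof. exact: (linear_sum (pack_linear (dsum_proj_linear i))). Qed.

Lemma dsum_decomp (x : dsum M) : x = \sum_j dsum_inj (x j).
Proof.
apply/ffunP => i; rewrite dsum_sumE (bigD1 i) //= dsum_injE big1 ?addr0 // => j.
by move/eqP => ji; rewrite dsum_inj0.
Qed.

End DirectSumMaps.

Section EndomorphismBasis.
Variables (k : fieldType) (R : algType k) (G : finZmodType) (u : G) (m : nat).
Variable D : nakayama_basis R u m.
Variables (r : nat) (L : 'I_r.+1 -> nzLmodType R).
Hypothesis subL : is_SUB L.
Local Notation I := 'I_r.+1.
Implicit Types (i j p q : I) (b c : nat).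

Local Notation v := (vtx D).
Local Notation t := (shift D).
Local Notation E := (E_R L).

Lemma SUB_uniserial i : exists p : G * nat * L i, uniserial_at D p.1.1 p.1.2 p.2.
Proof.
have [indL _ _] := subL; have [/(indecomposable_uniserial D)[g [l [x ux]]] _] := indL i.
by exists (g, l, x).
Qed.

Definition SUB_deg i : G := (sval (cid (SUB_uniserial i))).1.1.
Definition SUB_len i : nat := (sval (cid (SUB_uniserial i))).1.2.
Definition SUB_gen i : L i := (sval (cid (SUB_uniserial i))).2.
Local Notation dg := SUB_deg.
Local Notation ln := SUB_len.
Local Notation gen := SUB_gen.

Lemma SUB_genP i : uniserial_at D (dg i) (ln i) (gen i).
Proof. exact: svalP (cid (SUB_uniserial i)). Qed.

Local Notation ok := (fun i j b => (dg i == dg j + u *+ b) && (ln j <= b + ln i)%N).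

Lemma SUB_mor_ex i j b : exists f : {linear L i -> L j},
  f (gen i) = if ok i j b then t ^+ b *: gen j else 0.
Proof.
have ui := SUB_genP i; have [_ gj lj _ _] := SUB_genP j.
case: ifP => [/andP[/eqP d l]|_]; last by exists (\0 : {linear L i -> L j}).
apply: (uniserial_map ui); first by rewrite d vtx_shift.
by rewrite shift_shift (shift_ge lj) // addnC.
Qed.

Definition SUB_mor i j b : {linear L i -> L j} := sval (cid (SUB_mor_ex i j b)).

Lemma SUB_morE i j b : SUB_mor i j b (gen i) = if ok i j b then t ^+ b *: gen j else 0.
Proof. exact: svalP (cid (SUB_mor_ex i j b)). Qed.

Lemma SUB_mor_id i y : SUB_mor i i 0 y = y.
Proof.
have [_ _ _ _ /(_ y)[a ->]] := SUB_genP i.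
by rewrite linearZ /= SUB_morE mulr0n addr0 eqxx add0n leqnn /= scale1r.
Qed.

Lemma end_mor_linear i j b :
  linear (fun x : nzdsum L => dsum_inj (SUB_mor i j b (x i)) : nzdsum L).
Proof.
move=> a x y; rewrite (dsum_proj_linear (M := fun i => L i : lmodType R)) linearP.
exact: dsum_inj_linear.
Qed.

Definition end_mor i j b : E := pack_linear (end_mor_linear i j b).

Definition SUB_elt i : nzdsum L := dsum_inj (M := fun i => L i : lmodType R) (gen i).

Definition app (f : E) (x : nzdsum L) : nzdsum L := hom_app f x.

Arguments app : simpl never.

Lemma appZ (f : E) (a : R) x : app f (a *: x) = a *: app f x.
Proof. exact: (linearZZ (f : {linear nzdsum L -> nzdsum L})). Qed.
Lemma app0 (f : E) : app f 0 = 0.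
Proof. exact: (linear0 (f : {linear nzdsum L -> nzdsum L})). Qed.
Lemma app_sum (J : finType) (f : E) (x : J -> nzdsum L) :
  app f (\sum_j x j) = \sum_j app f (x j).
Proof. exact: (linear_sum (f : {linear nzdsum L -> nzdsum L})). Qed.
Lemma appM (f g : E) x : app (f * g) x = app f (app g x).
Proof. by []. Qed.
Lemma appD (f g : E) x : app (f + g) x = app f x + app g x.
Proof. by []. Qed.
Lemma app_scale (c : k) (f : E) x : app (c *: f) x = c%:A *: app f x.
Proof. by []. Qed.
Lemma app_suml (J : finType) (f : J -> E) x : app (\sum_j f j) x = \sum_j app (f j) x.
Proof. exact: (big_morph (fun f => app f x)). Qed.

Lemma app_mor i j b p : app (end_mor i j b) (SUB_elt p) =
  if (p == i) && ok i j b then t ^+ b *: SUB_elt j else 0.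
Proof.
rewrite /app /hom_app /= /SUB_elt.
have [e|/eqP ne] := eqVneq p i; last first.
  by rewrite dsum_inj0 // linear0; apply: dsum_inj_0.
subst p; rewrite dsum_injE SUB_morE /=; case: ifP => _.
  exact: dsum_injZ.
exact: dsum_inj_0.
Qed.

Lemma app_eq (f g : E) : (forall i, app f (SUB_elt i) = app g (SUB_elt i)) -> f = g.
Proof.
move=> fg; apply: homP => x; rewrite -![hom_app _ _]/(app _ _).
rewrite (dsum_decomp (M := fun i => L i : lmodType R) x) !app_sum.
apply: eq_bigr => i _; have [_ _ _ _ /(_ (x i))[a ->]] := SUB_genP i.
have -> : dsum_inj (M := fun i => L i : lmodType R) (a *: gen i) = a *: SUB_elt i.
  exact: dsum_injZ.
by rewrite !appZ fg.
Qed.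


Lemma SUB_coef_ex i : exists cf : nat -> {linear restrict_scalars (L i) -> k^o},
  [/\ forall a b, (b < ln i)%N -> cf a (t ^+ b *: gen i) = (a == b)%:R,
      forall a y, (ln i <= a)%N -> cf a y = 0 &
      forall y, y = \sum_(a < ln i) (cf a y : k)%:A *: (t ^+ a *: gen i)].
Proof. exact: (uniserial_coef (SUB_genP i)). Qed.

Definition SUB_coef i b : {linear restrict_scalars (L i) -> k^o} :=
  sval (cid (SUB_coef_ex i)) b.

Lemma SUB_coefP i :
  [/\ forall a b, (b < ln i)%N -> SUB_coef i a (t ^+ b *: gen i) = (a == b)%:R,
      forall a y, (ln i <= a)%N -> SUB_coef i a y = 0 &
      forall y, y = \sum_(a < ln i) (SUB_coef i a y : k)%:A *: (t ^+ a *: gen i)].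
Proof. exact: svalP (cid (SUB_coef_ex i)). Qed.

Lemma end_coef_linear i j b :
  linear (fun f : E => SUB_coef j b (app f (SUB_elt i) j) : k^o).
Proof.
move=> c f g; rewrite appD app_scale -linearP; congr (SUB_coef j b _).
by rewrite (dsum_proj_linear (M := fun i => L i : lmodType R)).
Qed.

Definition end_coef i j b : {linear E -> k^o} := pack_linear (end_coef_linear i j b).

Lemma SUB_elt_vtx i : v (dg i) *: SUB_elt i = SUB_elt i.
Proof. by have [_ gi _ _ _] := SUB_genP i; rewrite /SUB_elt -dsum_injZ gi. Qed.

Lemma SUB_elt_nilp i b : (ln i <= b)%N -> t ^+ b *: SUB_elt i = 0.
Proof.
have [_ _ li _ _] := SUB_genP i => lb; apply: (shift_ge _ lb).
by rewrite /SUB_elt -dsum_injZ li dsum_inj_0.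
Qed.

(** The vector [y] is the L_j-component of an image of g_i. Its degree selects the exponents; since
    t^(ln i) kills it, terms with [b + ln i < ln j] cannot occur. *)
Lemma SUB_coef_adm i j b (y : L j) : v (dg i) *: y = y -> t ^+ ln i *: y = 0 ->
  SUB_coef j b y <> 0 -> ok i j b.
Proof.
move=> gy ly cb; have [c1 c2 cS] := SUB_coefP j; have uj := SUB_genP j.
have [_ gj lj _ _] := uj.
have bj : (b < ln j)%N by rewrite ltnNge; apply/negP => /(c2 _ y).
have free (c : nat -> k) : \sum_(a < ln j) (c a)%:A *: (t ^+ a *: gen j) = 0 -> c b = 0.
  by move=> c0; apply: (uniserial_free uj c0).
apply/andP; split.
  apply: contrapT => /negP dn; apply: cb.
  pose c a : k := if dg i == dg j + u *+ a then 0 else SUB_coef j a y.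
  suff /free : \sum_(a < ln j) (c a)%:A *: (t ^+ a *: gen j) = 0 by rewrite /c (negPf dn).
  have e : y - v (dg i) *: y = 0 by rewrite gy subrr.
  rewrite -[RHS]e {1 2}[y]cS scaler_sumr -sumrB; apply: eq_bigr => a _.
  rewrite /c scalekC; have [d|/eqP d] := eqVneq (dg i) (dg j + u *+ a).
    by rewrite d vtx_shift // subrr scalek0.
  have gj' : v (dg j + u *+ a) *: (t ^+ a *: gen j) = t ^+ a *: gen j by apply: vtx_shift.
  by rewrite (vtx_other gj' d) scaler0 subr0.
rewrite leqNgt; apply/negP => lb; apply: cb.
set cf := SUB_coef j (b + ln i).
have cfZ (c : k) (z : L j) : cf (c%:A *: z) = c * cf z by apply: (linearZZ cf).
have <- : cf 0 = 0 by apply: linear0.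
have -> : (0 : L j) = \sum_(a < ln j) (SUB_coef j a y : k)%:A *: (t ^+ (ln i + a) *:
  gen j).
  apply: (etrans (esym ly)); rewrite {1}[y]cS scaler_sumr; apply: eq_bigr => a _.
  by rewrite scalekC shift_shift.
rewrite [RHS](linear_sum cf) (bigD1 (Ordinal bj)) //= [X in _ + X]big1 ?addr0 => [|a ab].
  by rewrite cfZ addnC c1 // eqxx mulr1.
rewrite cfZ; have [lt_j|ge_j] := ltnP (ln i + a) (ln j); last first.
  by rewrite (shift_ge lj ge_j) linear0 mulr0.
rewrite c1 // addnC eqn_add2l; case: eqP => [e|_]; last by rewrite mulr0.
by case/eqP: ab; apply: val_inj.
Qed.

Lemma app_coef (f : E) i j : app f (SUB_elt i) j =
  \sum_(b < m) (end_coef i j b f : k)%:A *: (t ^+ b *: gen j).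
Proof.
have [_ c2 cS] := SUB_coefP j; have [/andP[_ lm] _ _ _ _] := SUB_genP j.
rewrite [LHS]cS (big_ord_widen m (fun b => (SUB_coef j b (app f (SUB_elt i) j) :
  k)%:A *: (t ^+ b *: gen j)) lm).
rewrite big_mkcond /=; apply: eq_bigr => b _; case: ltnP => // lb.
by rewrite c2 // scalek0.
Qed.

Lemma end_coef_adm i j b (f : E) : end_coef i j b f <> 0 -> ok i j b.
Proof.
apply: SUB_coef_adm.
  have := appZ f (v (dg i)) (SUB_elt i); rewrite SUB_elt_vtx => {2}->.
  by rewrite [RHS]ffunE.
have := appZ f (t ^+ ln i) (SUB_elt i); rewrite SUB_elt_nilp // app0.
by move/ffunP/(_ j); rewrite !ffunE => <-.
Qed.

Lemma dsum_scaleE (a : R) (x : nzdsum L) j : (a *: x) j = a *: x j.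
Proof. by rewrite [LHS]ffunE. Qed.

Lemma end_coef_mor i j b i' j' b' : ok i j b -> (b < ln j)%N ->
  end_coef i' j' b' (end_mor i j b) = [&& i' == i, j' == j & b' == b]%:R.
Proof.
move=> ij bj;
  rewrite -[LHS]/(SUB_coef j' b' (app (end_mor i j b) (SUB_elt i') j')) app_mor ij
  andbT; have [c1 _ _] := SUB_coefP j'.
have [ei|ni] := eqVneq i' i; last by rewrite [in LHS]ffunE linear0.
rewrite dsum_scaleE; have [ej|/eqP nj] := eqVneq j' j; last first.
  by rewrite /SUB_elt dsum_inj0 ?scaler0 ?linear0 // => /esym.
by subst j'; rewrite /SUB_elt dsum_injE c1.
Qed.

Lemma SUB_elt_sum (f : E) i : app f (SUB_elt i) =
  \sum_j \sum_(b < m) (end_coef i j b f : k)%:A *: (t ^+ b *: SUB_elt j).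
Proof.
rewrite [LHS](dsum_decomp (M := fun i => L i : lmodType R)); apply: eq_bigr => j _.
rewrite app_coef;
  apply: (etrans (linear_sum (pack_linear (@dsum_inj_linear R _ (fun i => L i :
  lmodType R) j)) _ _ _)).
by apply: eq_bigr => b _; rewrite /= !dsum_injZ.
Qed.

Definition SUB_basis : uniserial_basis E I u m.
Proof.
refine (@UniserialBasis k E I G u m ln dg end_mor end_coef _ _ _ _ _ _ _ _ _ _ _).
- by move=> i; have [/andP[]] := SUB_genP i.
- by move=> i; have [/andP[]] := SUB_genP i.
(* The submodule of R with generator of degree [g] and length [l] is an indecomposable of sub(R), so
   the complete list [L] contains it. *)
- move=> g l lm; have um := uniserial_modelP D g lm.
  have [_ _ cL] := subL.
  have [|i Xi] := cL (submod (cyc (uniserial_model D g l))).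
    by split; [exact/uniform_indecomposable/(uniserial_uniform um) | exact:
      uniserial_in_sub].
  have [x ux] := uniserial_isom Xi um; exists i.
  by have [-> ->] := uniserial_unique ux (SUB_genP i).
- move=> i j d l; have [_ iL _] := subL; apply: iL.
  by have ui := SUB_genP i; rewrite d l in ui; apply: (uniserial_isom_of ui (SUB_genP j)).
- move=> i j b nij; apply: app_eq => p; rewrite app_mor (negPf nij) andbF.
  by [].
- move=> i j b lb; apply: app_eq => p; rewrite app_mor SUB_elt_nilp // if_same.
  by [].
- move=> i j l b c ij jl; apply: app_eq => p; rewrite appM !app_mor ij andbT.
  have il : ok i l (b + c).
    move: ij jl => /andP[/eqP -> h1] /andP[/eqP -> h2].
    by rewrite mulrnDr addrA addrAC eqxx /=; lia.
  case: eqP => [_|_]; last by rewrite app0.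
  by rewrite appZ app_mor eqxx jl il shift_shift.
- move=> i j j' l b c jj; apply: app_eq => p; rewrite appM app_mor.
  case: ifP => _; last by rewrite app0.
  by rewrite appZ app_mor; case: eqP => // _; rewrite scaler0.
- apply: app_eq => p; rewrite app_suml (bigD1 p) //= big1 ?addr0 => [|j jp].
    by rewrite app_mor eqxx mulr0n addr0 eqxx add0n leqnn scale1r.
  by rewrite app_mor eq_sym (negPf jp).
- exact: end_coef_mor.
- move=> f; apply: app_eq => p.
  have e i : i != p ->
      app (\sum_j \sum_(b < m) (end_coef i j b f : k) *: end_mor i j b) (SUB_elt p) = 0.
    move=> ip; rewrite app_suml big1 // => j _; rewrite app_suml big1 // => b _.
    by rewrite app_scale app_mor eq_sym (negPf ip) scaler0.
  rewrite app_suml (bigD1 p isT) [X in _ = Algebra.add _ X](big1 _ _ _ e) [RHS]addr0.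
  rewrite app_suml SUB_elt_sum; apply: eq_bigr => j _; rewrite app_suml.
  apply: eq_bigr => b _; rewrite app_scale app_mor eqxx andTb.
  case: ifP => // nok; have [->|/eqP/end_coef_adm h] := eqVneq (end_coef p j b f : k) 0.
    by rewrite scalek0 scaler0.
  by rewrite h in nok.
Defined.

Lemma layer_ltP i j : layer_lt L i j <-> (len SUB_basis j < len SUB_basis i)%N.
Proof.
rewrite /layer_lt /ideal_layer !(uniserial_kdim (SUB_genP _)) /=.
lia.
Qed.

Lemma simple_module_at i : simple_at SUB_basis i (simple_module L i).
Proof.
pose M := fun i => L i : lmodType R.
(* The inclusion of L_i generates Hom(L_i, SUB(R)): a map [h] is [h] after the projection to L_i
   after the inclusion. *)
pose x : proj_module L i := pack_linear (@dsum_inj_linear R _ M i) : {linear L i ->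
  nzdsum L}.
have xE y : hom_app x y = dsum_inj (M := M) y by [].
apply: (@simple_at_top _ _ _ _ _ _ _ _ _ x).
- move=> h; have hL : linear (fun z : nzdsum L => hom_app h (z i)).
    by move=> a y z; rewrite (dsum_proj_linear (M := M)); apply: (linearP h).
  exists (pack_linear hL); apply: homP => y.
  by rewrite /hom_app /= [dsum_inj _ _](dsum_injE (M := M)).
- apply: homP => y;
  rewrite -[LHS]/(dsum_inj (M := M) (SUB_mor i i 0 (dsum_inj (M := M) y i))).
  by rewrite dsum_injE SUB_mor_id.
- move/(congr1 (fun h => hom_app h (gen i))); rewrite xE => /ffunP/(_ i).
  rewrite dsum_injE [RHS]ffunE => g0; have [_ _ _ gn _] := SUB_genP i.
  by apply: gn; rewrite g0 scaler0.
Qed.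

End EndomorphismBasis.

(** * The path algebra of the oriented cycle *)

Section PathLength.
Variables (k : fieldType) (Q : quiver).
Local Notation PA := (path_algebra k Q).
Implicit Types (x y : PA) (p q : qpath Q).

Definition path_len p := size (path_arrows p).

(** This bounds J^N from above: by [min_len_exp] its elements involve only paths of length at least
    [N]. It shows that a path of length [m] is nonzero modulo J^(m+1). *)
Definition min_len N x := forall p, (path_len p < N)%N -> mcoeff p x = 0.

Lemma min_len0 N : min_len N 0.
Proof. by move=> p _; rewrite mcoeff0. Qed.

Lemma min_lenD N x y : min_len N x -> min_len N y -> min_len N (x + y).
Proof. by move=> hx hy p pN; rewrite mcoeffD hx // hy // addr0. Qed.

Lemma min_len_sum N (r : nat) (f : 'I_r -> PA) :
  (forall i, min_len N (f i)) -> min_len N (\sum_i f i).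
Proof.
by move=> h; elim/big_ind: _ => //; [exact: min_len0 | move=> x y; exact: min_lenD].
Qed.

Lemma min_lenM N N' x y : min_len N x -> min_len N' y -> min_len (N + N') (x * y).
Proof.
move=> hx hy p pN; rewrite -[x * y]/(path_algebra_mul x y) /path_algebra_mul.
rewrite raddf_sum big1 // => q _; rewrite raddf_sum big1 // => q' _.
rewrite [LHS]mcoeffZ; case: path_compP => [r _ _ ra _|_] /=;
  last by rewrite mcoeff0 mulr0.
rewrite mcoeffU; case: eqP => [erp|_]; last by rewrite mulr0.
have : path_len p = (path_len q' + path_len q)%N by rewrite -erp /path_len ra size_cat.
move=> sp; have [qN|Nq] := ltnP (path_len q) N; first by rewrite hx // !mul0r.
by rewrite hy ?mulr0 ?mul0r //; lia.
Qed.

Lemma min_len_arrow_ideal x : @arrow_ideal k Q x -> min_len 1 x.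
Proof.
move=> [r [a [g [b [hg ->]]]]]; apply: min_len_sum => i.
have hgi : min_len 1 (g i).
  have [c _ <-] := hg i => p p0; rewrite mcoeffU; case: eqP => // e.
  by move: p0; rewrite -e.
have h0 y : min_len 0 y by [].
by have := min_lenM (min_lenM (h0 (a i)) hgi) (h0 (b i)).
Qed.

Lemma min_len_exp N x : ideal_exp (@arrow_ideal k Q) N x -> min_len N x.
Proof.
elim: N x => [|N IH] x; first by [].
move=> [r [a [b [ha [hb ->]]]]]; apply: min_len_sum => i.
exact: min_lenM (min_len_arrow_ideal (ha i)) (IH _ (hb i)).
Qed.

End PathLength.

Section CyclePaths.
Variables (k : fieldType) (n : nat).
Local Notation Q := (oriented_cycle n).
Local Notation PA := (path_algebra k Q).

(** The degree of an arrow. For [n = 0] the cycle is a loop and [inZp 1] is 0, as it must be. *)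
Definition cycle_step : 'I_n.+1 := inZp 1.

Lemma ordS_step (g : 'I_n.+1) : ordS g = g + cycle_step.
Proof. by apply: val_inj; rewrite /= modnDmr addn1. Qed.

Definition vertex_elt (g : 'I_n.+1) : PA := of_path k (trivial_path (Q := Q) g).
Definition arrow_elt (g : 'I_n.+1) : PA := of_path k (arrow_path (Q := Q) g).
(** This will be the operator t: a path on a cycle is determined by its start and its length, so it
    is a power of this sum times a vertex. *)
Definition arrow_sum : PA := \sum_g arrow_elt g.

Lemma mul_of_path (p q : qpath Q) :
  (of_path k p * of_path k q : PA) = of_opath k (path_comp p q).
Proof. exact: path_algebra_mulPP. Qed.

Lemma vertex_eltM g h :
  vertex_elt g * vertex_elt h = if g == h then vertex_elt g else 0.
Proof.
rewrite mul_of_path path_comp_triv_l -[path_end _]/h [h == g]eq_sym.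
case: eqP => [->|_]; reflexivity.
Qed.

Lemma arrow_sum_path (p : qpath Q) : exists r : qpath Q,
  [/\ arrow_sum * of_path k p = of_path k r, path_start r = path_start p &
      path_len r = (path_len p).+1].
Proof.
have := path_compP (arrow_path (Q := Q) (path_end p)) p.
case e: (path_comp _ p) => [r|] H; last by inversion H.
have [rs ra] : path_start r = path_start p /\
    path_arrows r = path_arrows p ++ [:: path_end p] by inversion H.
exists r; split=> //; last by rewrite /path_len ra size_cat addn1.
rewrite mulr_suml (bigD1 (path_end p)) //= big1 => [|a ap].
  by rewrite mul_of_path e addr0.
rewrite mul_of_path; case: path_compP => //= r' e'.
by case/eqP: ap; rewrite e'.
Qed.

Lemma arrow_sum_vertex g : arrow_sum * vertex_elt g = arrow_elt g.
Proof.
rewrite mulr_suml (bigD1 g) //= big1 => [|a ag].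
  by rewrite mul_of_path path_comp_triv_r eqxx addr0.
by rewrite mul_of_path path_comp_triv_r [path_start _ == _](negPf ag).
Qed.

Lemma vertex_arrow_sum g : vertex_elt (g + cycle_step) * arrow_sum = arrow_elt g.
Proof.
rewrite mulr_sumr (bigD1 g) //= big1 => [|a ag].
  by rewrite mul_of_path path_comp_triv_l addr0 /path_end /= ordS_step eqxx.
rewrite mul_of_path path_comp_triv_l /path_end /= ordS_step.
case: eqP => // /addIr ea; by rewrite ea eqxx in ag.
Qed.

Lemma arrow_sumX g a : exists p : qpath Q,
  [/\ arrow_sum ^+ a * vertex_elt g = of_path k p, path_start p = g & path_len p = a].
Proof.
elim: a => [|a [p [e ps pl]]]; first by exists (trivial_path (Q := Q) g); rewrite mul1r.
have [r [er rs rl]] := arrow_sum_path p.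
exists r; split; last by rewrite rl pl.
  rewrite exprS.
  rewrite -mulrA.
  rewrite [X in _ * X]e.
  exact: er.
by rewrite rs ps.
Qed.

Lemma cycle_path_unique (p q : qpath Q) :
  path_start p = path_start q -> path_len p = path_len q -> p = q.
Proof.
move=> es el; apply: qpath_inj => //.
have: walk (path_start p) (path_arrows p) by apply: (valP p).
have: walk (path_start p) (path_arrows q) by rewrite es; apply: (valP q).
move: (path_start p) el; rewrite /path_len.
elim: (path_arrows p) (path_arrows q) => [|a s IH] [|b s'] //= g [ss].
by move=> /andP[/eqP <- w'] /andP[/eqP -> w]; congr (_ :: _); apply: IH w' w.
Qed.

Lemma path_arrow_sum (p : qpath Q) :
  of_path k p = arrow_sum ^+ path_len p * vertex_elt (path_start p).
Proof.
have [q [-> qs ql]] := arrow_sumX (path_start p) (path_len p).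
by congr (of_path k _); apply: cycle_path_unique.
Qed.

Lemma arrow_sum_ideal : @arrow_ideal k Q arrow_sum.
Proof.
exists n.+1, (fun=> 1), arrow_elt, (fun=> 1); split=> [i|]; first by exists i.
by apply: eq_bigr => i _; rewrite mul1r mulr1.
Qed.

Lemma arrow_sum_exp a : ideal_exp (@arrow_ideal k Q) a (arrow_sum ^+ a).
Proof.
elim: a => [|a IH]; first by [].
exists 1%N, (fun=> arrow_sum), (fun=> arrow_sum ^+ a); split; first by move=> _;
  exact: arrow_sum_ideal.
by split=> [_|]; [exact: IH | rewrite big_ord1 exprS].
Qed.

End CyclePaths.

Lemma nakayama_basis_exists (k : fieldType) (R : algType k) :
  self_injective_nakayama R ->
  exists n m, inhabited (nakayama_basis R (cycle_step n) m).
Proof.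
move=> [n [m [f [fS fK]]]]; exists n, m.+1; constructor.
have fXe a g : f (arrow_sum k n) ^+ a * f (vertex_elt k g) =
    f (arrow_sum k n ^+ a * vertex_elt k g) by rewrite rmorphM rmorphXn.
have nilp : f (arrow_sum k n) ^+ m.+1 = 0.
  by rewrite -rmorphXn; apply/fK; apply: arrow_sum_exp.
refine (@NakayamaBasis k R 'I_n.+1 (cycle_step n) m.+1
  (fun g => f (vertex_elt k g)) (f (arrow_sum k n)) _ _ _ _ _ _ _) => //.
- by move=> g h; rewrite -rmorphM vertex_eltM; case: ifP; rewrite ?rmorph0.
- by rewrite -rmorph_sum -[RHS](rmorph1 f).
- by move=> g; rewrite -!rmorphM arrow_sum_vertex vertex_arrow_sum.
(* The order of nilpotency is [m.+1], so the claim concerns t^m v_g, which is a single path of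
   length [m] and therefore not in J^(m+1). *)
- move=> g /=; rewrite fXe; have [p [-> _ pl]] := arrow_sumX k g m.
  move/fK/min_len_exp/(_ p); rewrite pl ltnSn mcoeffUU => /(_ isT)/eqP.
  by rewrite oner_eq0.
move=> r; have [x <-] := fS r; move: x; apply: path_algebra_ind.
- exists (fun _ _ => 0); rewrite rmorph0 big1 // => g _; rewrite big1 // => a _.
  by rewrite scale0r.
- move=> x y [c ec] [d ed]; exists (fun g a => c g a + d g a); rewrite linearD /= ec ed.
  rewrite -big_split; apply: eq_bigr => g _; rewrite -big_split; apply: eq_bigr => a _.
  by rewrite scalerDl.
- move=> c x [d ed]; exists (fun g a => c * d g a); rewrite linearZ /= ed scaler_sumr.
  apply: eq_bigr => g _; rewrite scaler_sumr; apply: eq_bigr => a _.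
  by rewrite scalerA.
move=> p; exists (fun g a => ((g == path_start p) && (a == path_len p))%:R).
rewrite path_arrow_sum -fXe (bigD1 (path_start p)) //= [X in _ + X]big1 ?addr0 => [|g gp].
  have [pm|mp] := ltnP (path_len p) m.+1.
    rewrite (bigD1 (Ordinal pm)) //= !eqxx scale1r big1 ?addr0 // => a ap.
    case: eqP => [ea|_]; last by rewrite scale0r.
    by case/eqP: ap; apply: val_inj.
  rewrite -(subnK mp) exprD nilp mulr0 mul0r big1 // => a _.
  by rewrite eqxx; case: eqP => [ea|_]; [have := ltn_ord a; lia | rewrite scale0r].
by rewrite big1 // => a _; rewrite (negPf gp) scale0r.
Qed.

(** * The Ringel dual *)

Lemma algebra_isom_of (k : fieldType) (A C : algType k) (f : A -> C) :
  linear f -> f 1 = 1 -> {morph f : x y / x * y} ->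
  (forall x, f x = 0 -> x = 0) -> (forall y, exists x, f x = y) -> algebra_isom A C.
Proof.
move=> fL f1 fM f0 fS.
pose g : {lrmorphism A -> C} := HB.pack f (GRing.isLinear.Build k A C *:%R f fL)
  (GRing.isMonoidMorphism.Build A C f (conj f1 fM)).
exists g; apply: bij_of_inj_surj => // x y e; apply/eqP; rewrite -subr_eq0; apply/eqP/f0.
exact: (etrans (linearB (pack_linear fL) x y) (etrans (congr1 (+%R^~ _) e) (subrr _))).
Qed.

Section RingelDual.
Variables (k : fieldType) (E : algType k) (I : finType) (G : zmodType) (u : G).
Variables (m : nat) (B : uniserial_basis E I u m).

(** An endomorphism [phi] corresponds to the [b] with f(phi x) = f(x) b. It exists by [ideal_endo]
    and is unique by [ideal_faithful]; every [b] occurs because the ideal is closed on the right.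
    Right multiplications compose in reverse order, hence the converse algebra. *)
Lemma ideal_end_isom (M : nzLmodType E) (f : {linear M -> E^o}) :
  (forall x, f x = 0 -> x = 0) -> (forall x, f x \in ideal_sub B) ->
  (forall a, a \in ideal_sub B -> exists x, f x = a) ->
  algebra_isom ((endalg M)^c) E.
Proof.
move=> f0 fI fS; have f_inj := linear_eq0_inj f0.
have hL : linear (fun x => to_submod (fI x)).
  by move=> a x y; apply: submod_inj; rewrite /= linearP.
have h_inj : injective (pack_linear hL) by move=> x y /(congr1 val) /= /f_inj.
have h_surj y : exists x, pack_linear hL x = y.
  by have [x fx] := fS _ (valP y); exists x; apply: submod_inj.
have [h' hK h'K] := bij_of_inj_surj h_inj h_surj.
pose g := pack_linear (can2_linear hK h'K).
have fg y : f (g y) = val y by have /(congr1 val) := h'K y.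
have rP (phi : (endalg M)^c) : exists b : E, forall x, f (hom_app phi x) = (f x * b : E).
  pose w := (f : {linear M -> E^o}) \o (phi : {linear M -> M}) \o (g : {linear submod
    (ideal_sub B) -> M}).
  have [b bP] := ideal_endo (w : {linear _ -> _}); exists b => x.
  have := bP (to_submod (fI x)); rewrite /w /= => <-; congr (f (hom_app phi _)).
  by apply: f_inj; rewrite fg.
have uniq (b b' : E) : (forall x, f x * b = f x * b') -> b = b'.
  move=> e; apply/eqP; rewrite -subr_eq0; apply/eqP/(@ideal_faithful _ _ _ _ _ _ B).
  by move=> a /fS[x <-]; rewrite mulrBr e subrr.
pose rho (phi : (endalg M)^c) : E := sval (cid (rP phi)).
have rhoP phi x : f (hom_app phi x) = (f x * rho phi : E) by rewrite /rho; case: cid.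
apply: (@algebra_isom_of _ _ _ rho).
- move=> c phi psi; apply: uniq => x; rewrite -rhoP mulrDr -scalerAr -!rhoP.
  rewrite -[LHS]/(f (c%:A *: hom_app phi x + hom_app psi x)) linearD linearZ /=.
  by rewrite /GRing.scale /= mulr_algl.
- by apply: uniq => x; rewrite -rhoP mulr1.
- by move=> phi psi; apply: uniq => x; rewrite mulrA -!rhoP.
- move=> phi rp0; apply: homP => x; apply: f_inj.
  by rewrite rhoP rp0 mulr0; apply: (esym (linear0 f)).
move=> b.
have bI x : (f x * b : E) \in ideal_sub B by apply: ideal_mulr.
pose phi x := g (to_submod (bI x)).
have fphi x : f (phi x) = (f x * b : E) by rewrite /phi fg.
have phiL : linear phi.
  move=> a x y; apply: f_inj; rewrite fphi [RHS]linearP !fphi linearP.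
  by rewrite mulrDl /GRing.scale /= mulrA.
exists (pack_linear phiL : Defs.hom M M); apply: uniq => x; rewrite -rhoP.
exact: fphi.
Qed.

End RingelDual.

Lemma SUB_ringel_dual (k : fieldType) (R : algType k) (G : finZmodType) (u : G) (m : nat)
    (D : nakayama_basis R u m) (r : nat) (L : 'I_r.+1 -> nzLmodType R) (subL : is_SUB L)
    (s : nat) (T : 'I_s.+1 -> nzLmodType (E_R L)) :
  is_characteristic_tilting T -> algebra_isom (ringel_dual T) (E_R L).
Proof.
pose B := SUB_basis D subL => -[Ttilt Tinj Tcompl].
have Ssimple := simple_module_at D subL; have ltP := layer_ltP D subL.
have iT j : exists i, isom (T j) (tilt B i).
  have [_ indT fs fc] := Ttilt j.
  have [i iTi] := indecomposable_tilt (filtered_mono Ssimple ltP fs)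
    (filtered_epi Ssimple ltP fc) indT.
  by exists i; apply: isom_sym.
pose sg j := sval (cid (iT j));
  have sgP j : isom (T j) (tilt B (sg j)) by rewrite /sg; case: cid.
(* [sg] is a bijection: [T] lists the tilting modules without repetition and completely, and the
   T(i) are pairwise nonisomorphic. *)
have sg_inj : injective sg.
  move=> j j' e; apply: Tinj; apply: isom_trans (sgP j) _; rewrite e.
  exact/isom_sym/sgP.
have sg_surj i : exists j, sg j = i.
  have [j iTj] := Tcompl _ (tilt_tilting Ssimple ltP i); exists j.
  by apply/esym/(tilt_inj (B := B)); apply: isom_trans iTj (sgP j).
have thP j : exists f : {linear T j -> (E_R L)^o}, (forall x, f x = 0 -> x = 0) /\
    forall a : E_R L, (exists x, f x = a) <-> exists h, a = h * hull_incl B (sg j).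
  have [f [f0 fS]] := isom_linear (sgP j).
  exists ((submod_val _ : {linear tilt B (sg j) -> (E_R L)^o}) \o (f : {linear T j ->
    tilt B (sg j)})).
  split=> [x /= fx|a]; first by apply: f0; apply: submod_inj.
  split=> [[x <-]|[h ->]] /=.
    by have /in_cyc[h ->] := valP (f x); exists h.
  by have [x fx] := fS (h *: tilt_gen B (sg j)); exists x; rewrite fx.
pose th j := sval (cid (thP j)).
have th0 j x : th j x = 0 -> x = 0 by rewrite /th; case: cid => f /= [+ _]; apply.
have thI j a : (exists x, th j x = a) <-> exists h, a = h * hull_incl B (sg j).
  by rewrite /th; case: cid => f /= [_]; apply.
have thE j x i : th j x * idem B i = if sg j == i then th j x else 0.
  have [h ->] := (thI j (th j x)).1 (ex_intro _ x erefl).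
  rewrite -mulrA /hull_incl; case: eqP => [<-|ne]; first by rewrite mul_mor_idem.
  by rewrite mul_mor_idem0 ?mulr0.
(* Under [th j] the module T_j becomes the left ideal I e_i with [i = sg j], where I is the ideal.
   These lie in different summands E e_i, so adding them up is injective, with image I. *)
have fL : linear (fun x : nzdsum T => \sum_j th j (x j) : (E_R L)^o).
  move=> a x y; rewrite scaler_sumr -big_split; apply: eq_bigr => j _.
  by rewrite (dsum_proj_linear (M := fun j => T j : lmodType _)) linearP.
have fE x j : pack_linear fL x * idem B (sg j) = th j (x j).
  rewrite /= mulr_suml (bigD1 j) //= thE eqxx big1 ?addr0 // => j' jj.
  by rewrite thE (inj_eq sg_inj) (negPf jj).
apply: (@ideal_end_isom _ _ _ _ _ _ B (nzdsum T) (pack_linear fL)).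
- move=> x fx; apply/ffunP => j; rewrite [RHS]ffunE; apply: th0.
  by rewrite -fE fx mul0r.
- move=> x; apply/in_ideal_sub => i; have [j <-] := sg_surj i; rewrite fE.
  by apply/thI; exists (x j).
move=> a aI; have xP j : exists x, th j x = a * idem B (sg j).
  by apply/thI; move/in_ideal_sub: aI; apply.
pose x : nzdsum T := [ffun j => sval (cid (xP j))] : dsum (fun j => T j : lmodType _).
have xE j : th j (x j) = a * idem B (sg j) by rewrite ffunE; case: cid.
exists x; rewrite -[RHS]mulr1 -(mor1 B) mulr_sumr /=.
rewrite [RHS](reindex sg) /=; first by apply: eq_bigr => j _; rewrite xE.
by apply: onW_bij; apply: bij_of_inj_surj.
Qed.

Theorem corollary6p20 (k : closedFieldType) (R : algType k)
    (nakayamaR : self_injective_nakayama R)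
    (r : nat) (L : 'I_r.+1 -> nzLmodType R) (subL : is_SUB L)
    (s : nat) (T : 'I_s.+1 -> nzLmodType (E_R L))
    (tiltingT : is_characteristic_tilting T) :
  algebra_isom (ringel_dual T) (E_R L).
Proof.
have [n [m [D]]] := nakayama_basis_exists nakayamaR.
exact: (SUB_ringel_dual D subL tiltingT).
Qed.
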